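(* Consider the family of It\^o stochastic linear systems with additive Brownian noise, indexed by $\beta\in K$, $$\mathrm{d}X(t,\beta)=A(t,\beta)X(t,\beta)\,\mathrm{d}t+B(t,\beta)u(t)\,\mathrm{d}t+G(t,\beta)\,\mathrm{d}W(t),$$ with $A\in L_\infty^{n\times n}(D)$, $B\in L_2^{n\times m}(D)$, $G\in L_2^{n\times k}(D)$, $D=[0,T]\times K$, and suppose that this family is ensemble controllable on $\mathcal{H}_K$. Let $X_0,X_F\in\mathcal{H}_K$. Then the control $u\in\mathcal{H}_T$ that steers the system from the initial state $X(0,\beta)=X_0(\beta)$ to the terminal state $X(T,\beta)=X_F(\beta)$, while minimizing $$\mathcal{J}_2=\mathcal{E}\|X_T-X_F\|_K^2=\int_K\mathcal{E}\|X(T,\beta)-X_F(\beta)\|_2^2\,\mathrm{d}\mu(\beta),$$ the mean square error in the terminal state, must satisfy $$\int_0^{T}\Phi(0,\sigma,\beta)B(\sigma,\beta)u(\sigma)\,\mathrm{d}\sigma=\Phi(0,T,\beta)X_F(\beta)-X_0(\beta)$$ for all $\beta\in K$. The minimum value of $\mathcal{J}_2$ is $$\int_K\mathrm{tr}\,C(T,\beta)\,\mathrm{d}\mu(\beta),\qquad\text{where}\quad C(t,\beta)=\int_0^t\Phi(t,\sigma,\beta)G(\sigma,\beta)G'(\sigma,\beta)\Phi'(t,\sigma,\beta)\,\mathrm{d}\sigma .$$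
   Context: Setting: $T>0$; $K\subset\mathbb{R}^d$ is compact; $D=[0,T]\times K$; the state $X$ takes values in $M\subset\mathbb{R}^n$, and the control $u:[0,T]\to U\subset\mathbb{R}^m$ is open-loop, i.e. a function of $t$ only, the same for all $\beta$ and all realizations of the noise. $A\in L_\infty^{n\times n}(D)$, $B\in L_2^{n\times m}(D)$, $G\in L_2^{n\times k}(D)$ mean that $A(t,\beta)\in\mathbb{R}^{n\times n}$, $B(t,\beta)\in\mathbb{R}^{n\times m}$, $G(t,\beta)\in\mathbb{R}^{n\times k}$ have entries that are real $L_\infty(D)$, $L_2(D)$, $L_2(D)$ functions, respectively. $W:[0,T]\times\Omega\to\mathbb{R}^k$ is a standard $k$-dimensional Brownian motion (independent identically distributed components) on a probability space $(\Omega,\mathcal{F},\mathbb{P})$ with its natural filtration, so $\mathcal{E}W(t)=0$ and $\mathcal{E}[W(t)W'(s)]=I\min(t,s)$. $\mathcal{E}$ denotes expectation with respect to $\mathbb{P}$, $'$ denotes transpose, and $\mathrm{tr}$ denotes trace. The argument $\omega\in\Omega$ of $X$ and $W$ is suppressed. Function spaces: $\mathcal{H}_T=L_2^m[0,T]$ is the Hilbert space of square-integrable $\mathbb{R}^m$-valued functions on $[0,T]$ with inner product $\langle g,h\rangle_T=\int_0^T g'(t)h(t)\,\mathrm{d}t$. $\mathcal{H}_K=L_2^n(K)$ is the Hilbert space of square-integrable $\mathbb{R}^n$-valued functions on $K$ with inner product $\langle p,q\rangle_K=\int_K p'(\beta)q(\beta)\,\mathrm{d}\mu(\beta)$, $\mu$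 being Lebesgue measure, and induced norm $\|\cdot\|_K$; $\|\cdot\|_2$ is the Euclidean norm. $X_T(\beta)=X(T,\beta)$ is the terminal state. The initial and target states $X_0,X_F$ are (non-random) elements of $\mathcal{H}_K$. Steering the stochastic ensemble between states in $\mathcal{H}_K$ by an open-loop control refers to steering its instantaneous expected state $\mathcal{E}X$. $\Phi(t,s,\beta)$ denotes the transition matrix (from time $s$ to time $t$) of the homogeneous system $\dot X(t,\beta)=A(t,\beta)X(t,\beta)$. Ensemble controllable: the family is ensemble controllable on $\mathcal{H}_K$ if for all $\epsilon>0$ and all $X_0,X_F\in\mathcal{H}_K$ there exist $T>0$ and an open-loop piecewise-continuous control $u\in\mathcal{H}_T$ such that, starting from $X(0,\beta)=X_0(\beta)$, the final state $X(T,\beta)=X_T(\beta)$ satisfies $\|\mathcal{E}X_T-X_F\|_K<\epsilon$.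
   Formalization: The minimum value of J_2 is stated as the infimum over all u in H_T (attained by any minimizer), since ensemble controllability is only approximate and a minimizer need not exist; the steering equation is asserted for almost every β in K, as X_0, X_F, A, B are determined only up to null sets. *)

(* Defs.v *)
From HB Require Import structures.
From mathcomp Require Import all_boot all_order all_algebra.
From mathcomp Require Import all_classical all_reals all_analysis.
Set Implicit Arguments.
Unset Strict Implicit.
Unset Printing Implicit Defensive.
Import Order.TTheory GRing.Theory Num.Theory.
Import numFieldNormedType.Exports.
Local Open Scope classical_set_scope.
Local Open Scope ring_scope.

(* R^d with its Borel sigma-algebra. *)
Definition tupleR (R : realType) (d : nat) : measurableType _ :=
  (d.-tuple (measurableTypeR R))%type.

Section lebesgue_tuple.
Context (R : realType).

Definition consR d (z : measurableTypeR R * tupleR R d) : tupleR R d.+1 :=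
  [the d.+1.-tuple (measurableTypeR R) of z.1 :: z.2].

Lemma measurable_consR d : measurable_fun setT (@consR d).
Proof. exact: measurable_cons measurable_fst measurable_snd. Qed.

Lemma measurable_behead d :
  measurable_fun setT
    (fun t : tupleR R d.+1 => [tuple of behead t] : tupleR R d).
Proof.
apply/measurable_fun_tnthP => i /=.
rewrite (_ : _ \o _ = (fun t : tupleR R d.+1 => tnth t (lift ord0 i))).
  exact: measurable_tnth.
by apply/funext => t /=; rewrite tnth_behead; congr tnth; apply/val_inj;
  rewrite /= inordK// ltnS ltn_ord.
Qed.

Section step.
Context d (m : {sigma_finite_measure set (tupleR R d) -> \bar R}).

Definition lebesgue_cons : set (tupleR R d.+1) -> \bar R :=
  pushforward (lebesgue_measure \x m)%E (@consR d).

Let lebesgue_cons_measure : {measure set (tupleR R d.+1) -> \bar R} :=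
  measure_function_pushforward__canonical__measure_function_Measure
    (lebesgue_measure \x m)%E (@measurable_consR d).

HB.instance Definition _ := isMeasure.Build _ _ _ lebesgue_cons
  (measure0 lebesgue_cons_measure) (measure_ge0 lebesgue_cons_measure)
  (@measure_semi_sigma_additive _ _ _ lebesgue_cons_measure).

Lemma sigma_finite_lebesgue_cons : sigma_finite setT lebesgue_cons.
Proof.
pose l : {sigma_finite_measure set (measurableTypeR R) -> \bar R} :=
  lebesgue_measure.
have /sigma_finiteP[F [FT ndF Foo]] := sigma_finiteT l.
have /sigma_finiteP[G [GT ndG Goo]] := sigma_finiteT m.
pose g (t : tupleR R d.+1) : measurableTypeR R * tupleR R d :=
  (tnth t ord0, [tuple of behead t]).
have mg : measurable_fun setT g.
  by apply/measurable_fun_pair; [exact: measurable_tnth|exact: measurable_behead].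
have consRK : cancel (@consR d) g.
  move=> [x t]; rewrite /g /consR /=; congr pair; exact/val_inj.
exists (fun i => g @^-1` (F i `*` G i)).
  apply/esym; rewrite -subTset => t _ /=.
  have [i _ Fi] : (\bigcup_i F i) (g t).1 by rewrite -FT.
  have [j _ Gj] : (\bigcup_i G i) (g t).2 by rewrite -GT.
  exists (maxn i j) => //; split.
    by move: Fi; apply/subsetPset/ndF/leq_maxl.
  by move: Gj; apply/subsetPset/ndG/leq_maxr.
move=> i; have [mF fF] := Foo i; have [mG fG] := Goo i; split.
  by rewrite -[X in measurable X]setTI; apply: mg => //; exact: measurableX.
rewrite /lebesgue_cons /pushforward -comp_preimage.
rewrite (_ : g \o _ = id); last by rewrite funeqE => z /=; rewrite consRK.
rewrite preimage_id product_measure1E//.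
by rewrite lte_mul_pinfty// ge0_fin_numE.
Qed.

HB.instance Definition _ :=
  Measure_isSigmaFinite.Build _ _ _ lebesgue_cons sigma_finite_lebesgue_cons.

End step.

(* Lebesgue measure on R^d, by identifying R^(d+1) with R * R^d. *)
Fixpoint lebesgue_tuple d : {sigma_finite_measure set (tupleR R d) -> \bar R} :=
  match d with
  | 0 => \d_([tuple] : tupleR R 0)
  | d'.+1 => lebesgue_cons (lebesgue_tuple d')
  end.

Lemma lebesgue_tuple_box d (I : 'I_d -> set (measurableTypeR R)) :
  (forall i, measurable (I i)) ->
  lebesgue_tuple d [set t | forall i, I i (tnth t i)] =
  (\prod_(i < d) lebesgue_measure (I i))%E.
Proof.
elim: d I => [|d IHd] I mI /=.
  rewrite big_ord0 diracE mem_set//= => -[]//.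
have mbox : measurable [set t : tupleR R d | forall i, I (lift ord0 i) (tnth t i)].
  rewrite (_ : mkset _ = \bigcap_(i in setT) ((fun t : tupleR R d => tnth t i) @^-1` I (lift ord0 i))); last first.
    by apply/seteqP; split => [t /= h i _|t h i]; [exact: h|exact: h].
  apply: fin_bigcap_measurable; first exact: finite_finset.
  by move=> i _; rewrite -[X in measurable X]setTI; exact: measurable_tnth.
rewrite big_ord_recl -IHd; last by move=> i; exact: mI.
rewrite -product_measure1E// /lebesgue_cons /pushforward; congr product_measure1.
apply/seteqP; split => [[x t] /= h|[x t] /= [h0 h] i].
  split; first by have := h ord0.
  by move=> i; have := h (lift ord0 i); rewrite tnthS.
by case: (unliftP ord0 i) => [j ->|->]; [rewrite tnthS; exact: h|].
Qed.

End lebesgue_tuple.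

Section matrix_valued.
Context (R : realType).

Definition sqnorm p q (M : 'M[R]_(p, q)) : R := \sum_i \sum_j M i j ^+ 2.

Definition enorm p (v : 'cV[R]_p) : R := Num.sqrt (sqnorm v).

(* Functions are honest functions rather than classes modulo a.e. equality;
   only their values on [D] matter. *)
Definition LpOn d (S : measurableType d) (mu : {measure set S -> \bar R})
    (p : \bar R) (D : set S) q r (f : S -> 'M[R]_(q, r)) : Prop :=
  forall i j, ((fun z => f z i j) \_ D) \in Lfun mu p.

Definition mxint (D : set (measurableTypeR R)) q r (f : R -> 'M[R]_(q, r)) :
    'M[R]_(q, r) :=
  \matrix_(i, j) (\int[lebesgue_measure]_(t in D) f t i j).

(* Oriented integral from [a] to [b]: one of the two intervals has measure 0. *)
Definition mxint_from_to (a b : R) q r (f : R -> 'M[R]_(q, r)) : 'M[R]_(q, r) :=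
  mxint `[a, b] f - mxint `[b, a] f.

End matrix_valued.

Section brownian.
Context (R : realType) (dO : measure_display) (Omega : measurableType dO).
Context (P : probability Omega R).

Definition mutually_independent (I : finType) (Z : I -> Omega -> R) : Prop :=
  forall B : I -> set R, (forall i, measurable (B i)) ->
    P (\bigcap_i (Z i @^-1` B i)) = (\prod_(i : I) P (Z i @^-1` B i))%E.

(* [k]-th point of the subdivision 0 = t_0 < t_1 < ... < t_(size s) = t
   encoded by [itv_partition 0 t s]. *)
Definition node (s : seq R) (k : nat) : R := nth 0 (0 :: s) k.

(* Standard [k]-dimensional Brownian motion on [0, T]. Independence of the
   family indexed by (subinterval, coordinate) expresses at once that the
   increments are independent and that the components are independent. *)
Record brownian_motion (T : R) k (W : R -> Omega -> 'cV[R]_k) : Prop := {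
  brownian_measurable : forall t i, 0 <= t <= T ->
    measurable_fun setT (fun w => W t w i 0) ;
  brownian_start : {ae P, forall w, W 0 w = 0} ;
  brownian_normal : forall r t i, 0 <= r -> r < t -> t <= T ->
    forall B : set R, measurable B ->
      P ((fun w => W t w i 0 - W r w i 0) @^-1` B) =
      normal_prob 0 (Num.sqrt (t - r)) B ;
  brownian_independent : forall s, itv_partition 0 T s ->
    mutually_independent (fun (ji : 'I_(size s) * 'I_k) w =>
      W (node s ji.1.+1) w ji.2 0 - W (node s ji.1) w ji.2 0) ;
  brownian_continuous : {ae P, forall w, forall i,
    {within `[0, T], continuous (fun t => W t w i 0)}} }.

Definition step_fun n k (s : seq R) (h : nat -> 'M[R]_(n, k)) (t : R) :
    'M[R]_(n, k) :=
  \sum_(j < size s) \1_(`[node s j, node s j.+1[%classic) t *: h j.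

Definition step_ito n k (W : R -> Omega -> 'cV[R]_k) (s : seq R)
    (h : nat -> 'M[R]_(n, k)) (w : Omega) : 'cV[R]_n :=
  \sum_(j < size s) h j *m (W (node s j.+1) w - W (node s j) w).

(* [Y] is (a version of) the integral of [g] dW over [0, t], [g] deterministic:
   the L2(P)-limit of the integrals of step functions converging to [g] in
   L2([0, t]). *)
Definition is_ito_integral n k (W : R -> Omega -> 'cV[R]_k) (t : R)
    (g : R -> 'M[R]_(n, k)) (Y : Omega -> 'cV[R]_n) : Prop :=
  (forall i, measurable_fun setT (fun w => Y w i 0)) /\
  forall e : R, 0 < e -> exists (s : seq R) (h : nat -> 'M[R]_(n, k)),
    [/\ itv_partition 0 t s,
        (\int[lebesgue_measure]_(r in `[0%R, t])
           (sqnorm (step_fun s h r - g r))%:E < e%:E)%E &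
        ('E_P[fun w => sqnorm (Y w - step_ito W s h w)] < e%:E)%E].

End brownian.

Section ensemble.
Context (R : realType) (d n m k : nat) (T : R) (K : set (tupleR R d)).
Context (dO : measure_display) (Omega : measurableType dO) (P : probability Omega R).

Let muK := @lebesgue_tuple R d.

Definition domain : set (measurableTypeR R * tupleR R d) := `[0, T] `*` K.

Definition in_LD (p : \bar R) q r (F : R -> tupleR R d -> 'M[R]_(q, r)) : Prop :=
  LpOn (lebesgue_measure \x muK)%E p domain (fun z => F z.1 z.2).

Definition in_HT (u : R -> 'cV[R]_m) : Prop :=
  @LpOn R _ (measurableTypeR R) lebesgue_measure 2%:E `[0, T] m 1 u.

Definition in_HK (p : tupleR R d -> 'cV[R]_n) : Prop := LpOn muK 2%:E K p.

Definition normK (p : tupleR R d -> 'cV[R]_n) : \bar R :=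
  'N[muK]_2%:E [EFin \o ((fun b => enorm (p b)) \_ K)]%E.

(* A state process takes (time, parameter, outcome) as arguments. *)
Definition process := R -> tupleR R d -> Omega -> 'cV[R]_n.

(* Integral form of dX = A X dt + B u dt + G dW, X(0) = x0. The coefficients
   being defined up to null sets in the parameter, the equation is required for
   almost every [b]. The drift integral is pathwise; adaptedness of [X] is a
   consequence since all coefficients are deterministic. *)
Definition is_solution (A : R -> tupleR R d -> 'M[R]_n)
    (B : R -> tupleR R d -> 'M[R]_(n, m)) (G : R -> tupleR R d -> 'M[R]_(n, k))
    (W : R -> Omega -> 'cV[R]_k)
    (x0 : tupleR R d -> 'cV[R]_n) (u : R -> 'cV[R]_m) (X : process) : Prop :=
  (forall i, measurable_fun (domain `*` [set: Omega])
     (fun z => X z.1.1 z.1.2 z.2 i 0)) /\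
  {ae muK, forall b, K b ->
    {ae P, forall w, forall i, {within `[0, T], continuous (fun t => X t b w i 0)}} /\
    forall t, 0 <= t <= T ->
      is_ito_integral P W t (fun r => G r b)
        (fun w => X t b w - x0 b
                  - mxint `[0, t] (fun r => A r b *m X r b w)
                  - mxint `[0, t] (fun r => B r b *m u r))}.

(* [Phi t s b] is the transition matrix, from time [s] to time [t] (in either
   order), of dX/dt = A(t, b) X, in the sense of Carathéodory. *)
Definition is_transition (A : R -> tupleR R d -> 'M[R]_n)
    (Phi : R -> R -> tupleR R d -> 'M[R]_n) : Prop :=
  {ae muK, forall b, K b -> forall s, 0 <= s <= T ->
    (forall i j, {within `[0, T], continuous (fun t => Phi t s b i j)}) /\
    forall t, 0 <= t <= T ->
      Phi t s b = 1%:M + mxint_from_to s t (fun r => A r b *m Phi r s b)}.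

Definition covariance_mx (Phi : R -> R -> tupleR R d -> 'M[R]_n)
    (G : R -> tupleR R d -> 'M[R]_(n, k)) (t : R) (b : tupleR R d) : 'M[R]_n :=
  mxint `[0, t]
    (fun s => Phi t s b *m G s b *m (G s b)^T *m (Phi t s b)^T).

Definition mean_state (X : process) (t : R) (b : tupleR R d) : 'cV[R]_n :=
  \col_i fine 'E_P[fun w => X t b w i 0%R]%E.

Definition piecewise_continuous (S : R) (u : R -> 'cV[R]_m) : Prop :=
  exists2 s : seq R, itv_partition 0 S s &
    forall (j : 'I_(size s)) (i : 'I_m),
      [/\ {in `]node s j, node s j.+1[, continuous (fun t => u t i 0)},
          cvg (u t i 0 @[t --> (node s j)^'+]) &
          cvg (u t i 0 @[t --> (node s j.+1)^'-])].

(* [X x0 u] is the state started from [x0] under the control [u]. As the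
   coefficients live on [0, T], so does the steering time [S]. *)
Definition ensemble_controllable
    (X : (tupleR R d -> 'cV[R]_n) -> (R -> 'cV[R]_m) -> process) : Prop :=
  forall (e : R) (x0 xF : tupleR R d -> 'cV[R]_n),
    0 < e -> in_HK x0 -> in_HK xF ->
    exists (S : R) (u : R -> 'cV[R]_m),
      [/\ 0 < S <= T, in_HT u, piecewise_continuous S u &
          (normK (fun b => (mean_state (X x0 u) S b - xF b)%R) < e%:E)%E].

Definition mean_square_error (X : process) (xF : tupleR R d -> 'cV[R]_n) :
    \bar R :=
  (\int[muK]_(b in K) 'E_P[fun w => sqnorm (X T b w - xF b)])%E.

End ensemble.

(* Main.v *)
(* Fix a parameter and let Y be the Ito integral of G. Pathwise, the fluctuation
   of the state around its mean is Phi(t, 0) zeta(t), where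
     zeta(t) = Phi(0, t) Y(t) + int_0^t Phi(0, s) A(s) Y(s) ds,
   so that E[Y(s) Y(t)'] = int_0^min(s, t) G G' and Fubini suffice to show that
   zeta is centred and that the covariance of X(T) is C(T). Hence J_2(u) is the
   sum of int_K |E X(T) - X_F|^2 and of int_K tr C(T), which is finite and does
   not depend on u.
   The first term has infimum 0. Indeed, if u steers X_0 - Phi(0, T) X_F to a
   mean state close to 0 at time S <= T, then by linearity u, extended by 0
   after S, steers X_0 to a mean state at T whose distance to X_F is the image
   of that error under Phi(T, S), and Phi is bounded uniformly in the parameter.
   A minimizer therefore cancels the first term, which by variation of constants
   is the stated integral equation. *)

Require Import Defs.
From HB Require Import structures.
From mathcomp Require Import all_boot all_order all_algebra finmap.
From mathcomp Require Import all_classical all_reals all_analysis.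
From mathcomp Require Import measurable_realfun ess_sup_inf ring lra.
Set Implicit Arguments.
Unset Strict Implicit.
Unset Printing Implicit Defensive.
Import Order.TTheory GRing.Theory Num.Theory.
Import numFieldNormedType.Exports.
Local Open Scope classical_set_scope.
Local Open Scope ring_scope.

(** * Square-integrable functions and iterated integrals *)

(** Integrals dW are specified only as L2(P) limits at a fixed time, which gives no direct handle on
    int Phi(t, s) G(s) dW(s). The process [zeta] is that integral after integration by parts: it
    contains one pathwise Lebesgue integral of Y, and its moments follow from those of Y alone. The
    other obstacle is the regularity of Phi. [is_transition] gives continuity in the first time
    argument and says nothing about measurability in the second one or in the parameter.
    Measurability of Phi(0, s) in s comes from the cofactor formula for the inverse of Phi(s, 0). In
    the parameter, measurability of the means and of a version of Phi(T, 0) is drawn from the joint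
    measurability of X. The function tr C(T, b) is only shown to agree almost everywhere with a
    measurable one, hence the comparison lemmas that ask for measurability on one side. Estimates
    uniform in the parameter rest on a single constant, 2 n exp((2C + 1) T), which Gronwall's
    inequality yields for Phi(t, s) with s <= t and for Phi(0, t). *)

Section square_integrable.
Context d (T : measurableType d) (R : realType).
Context (mu : {measure set T -> \bar R}) (D : set T).
Hypothesis mD : measurable D.
Implicit Types f g : T -> R.

Definition sqintegrable f :=
  measurable_fun D f /\ mu.-integrable D (EFin \o (fun x => f x ^+ 2)).

Lemma sqintegrable_mul f g : sqintegrable f -> sqintegrable g ->
  mu.-integrable D (EFin \o (fun x => f x * g x)).
Proof.
move=> [mf f2] [mg g2].
apply: (@le_integrable _ _ _ mu D mD _
  (EFin \o (fun x => f x ^+ 2 + g x ^+ 2))).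
- by apply/measurable_EFinP; exact: measurable_funM.
- move=> x _ /=; rewrite lee_fin (ger0_norm (addr_ge0 (sqr_ge0 _) (sqr_ge0 _))).
  have := sqr_ge0 (f x - g x); have := sqr_ge0 (f x + g x).
  have := sqr_ge0 (f x); have := sqr_ge0 (g x).
  by rewrite sqrrB sqrrD ler_norml => *; apply/andP; split; lra.
- exact: integrableD f2 g2.
Qed.

Lemma sqintegrableD f g : sqintegrable f -> sqintegrable g ->
  sqintegrable (fun x => f x + g x).
Proof.
move=> [mf f2] [mg g2]; split; first exact: measurable_funD.
apply: (@le_integrable _ _ _ mu D mD _
  (EFin \o (fun x => 2 * f x ^+ 2 + 2 * g x ^+ 2))).
- by apply/measurable_EFinP/measurable_funX; exact: measurable_funD.
- move=> x _ /=; have := sqr_ge0 (f x - g x).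
  have f0 := sqr_ge0 (f x); have g0 := sqr_ge0 (g x).
  rewrite lee_fin (ger0_norm (sqr_ge0 _)) ger0_norm; last lra.
  by rewrite sqrrB sqrrD; lra.
- exact: (integrableD mD (integrableZl mD 2 f2) (integrableZl mD 2 g2)).
Qed.

Lemma sqintegrableZ (c : R) f : sqintegrable f ->
  sqintegrable (fun x => c * f x).
Proof.
move=> [mf f2]; split; first exact: measurable_funM.
apply: eq_integrable (integrableZl mD (c ^+ 2) f2) => // x _ /=.
by rewrite -EFinM exprMn.
Qed.

Lemma sqintegrableN f : sqintegrable f -> sqintegrable (fun x => - f x).
Proof.
move=> /(sqintegrableZ (-1)); congr sqintegrable.
by apply/funext => x; rewrite mulN1r.
Qed.

Lemma sqintegrableB f g : sqintegrable f -> sqintegrable g ->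
  sqintegrable (fun x => f x - g x).
Proof. by move=> sf /sqintegrableN; exact: sqintegrableD. Qed.

Lemma sqintegrable_sum (I : Type) (s : seq I) (P : pred I) (F : I -> T -> R) :
  (forall i, P i -> sqintegrable (F i)) ->
  sqintegrable (fun x => \sum_(i <- s | P i) F i x).
Proof.
move=> sF; elim: s => [|i s IHs].
  rewrite (_ : (fun x => \sum_(i <- [::] | P i) F i x) = cst 0);
    last by apply/funext => x; rewrite big_nil.
  split; first exact: measurable_cst.
  apply: eq_integrable (integrable0 _ _) => // x _ /=.
  by rewrite expr0n.
rewrite (_ : (fun x => \sum_(j <- i :: s | P j) F j x) = (fun x =>
  if P i then F i x + \sum_(j <- s | P j) F j x else
  \sum_(j <- s | P j) F j x)); last by apply/funext => x; rewrite big_cons.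
case: (boolP (P i)) => // Pi; apply: sqintegrableD => //; exact: sF.
Qed.

Lemma eq_sqintegrable f g : {in D, f =1 g} -> sqintegrable f ->
  sqintegrable g.
Proof.
move=> fg [mf f2]; split; first exact: eq_measurable_fun mf.
by apply: eq_integrable f2 => // x xD; rewrite /= fg.
Qed.

(** The integral of (f - x g)^2 is a nonnegative quadratic polynomial in x; its value at the
    minimizer c / b gives the inequality. *)
Lemma cauchy_schwarz f g : sqintegrable f -> sqintegrable g ->
  (\int[mu]_(x in D) (f x * g x)) ^+ 2 <=
  \int[mu]_(x in D) (f x ^+ 2) * \int[mu]_(x in D) (g x ^+ 2).
Proof.
move=> sf sg; have fg := sqintegrable_mul sf sg.
have [mf f2] := sf; have [mg g2] := sg.
set a := \int[mu]_(x in D) (f x ^+ 2); set b := \int[mu]_(x in D) (g x ^+ 2).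
set c := Rintegral _ _ _.
have key x : 0 <= a + x * (x * b) - 2 * x * c.
  have : 0 <= \int[mu]_(y in D) ((f y - x * g y) ^+ 2).
    by apply: Rintegral_ge0 => y _; exact: sqr_ge0.
  rewrite (_ : (fun y => _) =
    (fun y => (f y ^+ 2 + x * (x * g y ^+ 2)) - 2 * x * (f y * g y))); last first.
    by apply/funext => y; ring.
  have xg2 : mu.-integrable D (EFin \o (fun y => x * g y ^+ 2)).
    exact: (integrableZl mD x g2).
  have xxg2 : mu.-integrable D (EFin \o (fun y => x * (x * g y ^+ 2))).
    exact: (integrableZl mD x xg2).
  rewrite RintegralB//.
  - by rewrite RintegralD// !RintegralZl.
  - exact: (integrableD mD f2 xxg2).
  - exact: (integrableZl mD _ fg).
have a0 : 0 <= a by apply: Rintegral_ge0 => y _; exact: sqr_ge0.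
have b0 : 0 <= b by apply: Rintegral_ge0 => y _; exact: sqr_ge0.
have [b_eq0|bn0] := eqVneq b 0.
  rewrite b_eq0 mulr0.
  have [->|c0] := eqVneq c 0; first by rewrite expr0n.
  (* With b = 0 the polynomial is the affine function a - 2 x c; at this x it equals - a - 2 < 0,
     which rules out c <> 0. *)
  have := key ((a + 1) / c); rewrite b_eq0 !mulr0 addr0.
  by rewrite -mulrA divfK//; lra.
have bgt0 : 0 < b by rewrite lt_def bn0.
have := key (c / b); rewrite mulrA.
have -> : a + c / b * (c / b) * b - 2 * (c / b) * c = (a * b - c ^+ 2) / b.
  by field.
by rewrite pmulr_lge0 ?invr_gt0// subr_ge0.
Qed.

(** Write f g - f' g' = f (g - g') + (f - f') g - (f - f') (g - g'), so that the bound involves the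
    norms of the limits f and g but not those of the approximants. This carries isometries from step
    functions to their limits. *)
Lemma sqintegrable_approx f g f' g' (e : R) : 0 <= e ->
  sqintegrable f -> sqintegrable g -> sqintegrable f' -> sqintegrable g' ->
  \int[mu]_(x in D) ((f x - f' x) ^+ 2) <= e ^+ 2 ->
  \int[mu]_(x in D) ((g x - g' x) ^+ 2) <= e ^+ 2 ->
  `|\int[mu]_(x in D) (f x * g x) - \int[mu]_(x in D) (f' x * g' x)| <=
  e * (Num.sqrt (\int[mu]_(x in D) (f x ^+ 2)) +
       Num.sqrt (\int[mu]_(x in D) (g x ^+ 2)) + e).
Proof.
move=> e0 sf sg sf' sg' fe ge.
have sff' := sqintegrableB sf sf'; have sgg' := sqintegrableB sg sg'.
have int_ge0 h : 0 <= \int[mu]_(x in D) (h x ^+ 2).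
  by apply: Rintegral_ge0 => y _; exact: sqr_ge0.
have CS h k : sqintegrable h -> sqintegrable k ->
    `|\int[mu]_(x in D) (h x * k x)| <=
    Num.sqrt (\int[mu]_(x in D) (h x ^+ 2)) *
    Num.sqrt (\int[mu]_(x in D) (k x ^+ 2)).
  move=> sh sk; rewrite -sqrtrM// -sqrtr_sqr ler_sqrt.
    exact: cauchy_schwarz.
  by rewrite mulr_ge0.
have sqe h : \int[mu]_(x in D) (h x ^+ 2) <= e ^+ 2 ->
    Num.sqrt (\int[mu]_(x in D) (h x ^+ 2)) <= e.
  by move=> he; rewrite -(ger0_norm e0) -sqrtr_sqr ler_wsqrtr.
have i1 := sqintegrable_mul sf sgg'; have i2 := sqintegrable_mul sff' sg.
have i3 := sqintegrable_mul sff' sgg'.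
rewrite -RintegralB//; [|exact: sqintegrable_mul|exact: sqintegrable_mul].
rewrite (_ : (fun x => _) = (fun x => f x * (g x - g' x) + (f x - f' x) * g x
  - (f x - f' x) * (g x - g' x))); last by apply/funext => x; ring.
rewrite RintegralB//; last exact: (integrableD mD i1 i2).
rewrite RintegralD//.
have h1 := CS _ _ sf sgg'; have h2 := CS _ _ sff' sg.
have h3 := CS _ _ sff' sgg'.
have k1 := sqe _ fe; have k2 := sqe _ ge.
set A := Num.sqrt (\int[mu]_(x in D) f x ^+ 2) in h1 *.
set B := Num.sqrt (\int[mu]_(x in D) g x ^+ 2) in h2 *.
set E := Num.sqrt _ in h2 h3 k1; set F := Num.sqrt _ in h1 h3 k2.
have A0 : 0 <= A := sqrtr_ge0 _; have B0 : 0 <= B := sqrtr_ge0 _.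
have E0 : 0 <= E := sqrtr_ge0 _; have F0 : 0 <= F := sqrtr_ge0 _.
apply: (le_trans (ler_normB _ _)); apply: (le_trans (lerD (ler_normD _ _) (lexx _))).
have : A * F <= A * e by rewrite ler_wpM2l.
have : E * B <= e * B by rewrite ler_wpM2r.
have : E * F <= e * e by rewrite ler_pM.
nra.
Qed.

End square_integrable.

Section square_integrable_finite.
Context d (T : measurableType d) (R : realType).
Context (mu : {finite_measure set T -> \bar R}) (D : set T).
Hypothesis mD : measurable D.

Lemma sqintegrable_cst (c : R) : sqintegrable mu D (fun=> c).
Proof.
by split => //; exact: (finite_measure_integrable_cst mu (c ^+ 2) mD).
Qed.

Lemma sqintegrable_integrable (f : T -> R) : sqintegrable mu D f ->
  mu.-integrable D (EFin \o f).
Proof.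
move=> sf; have := sqintegrable_mul mD sf (sqintegrable_cst 1).
by apply: eq_integrable => // x _ /=; rewrite mulr1.
Qed.

End square_integrable_finite.

Section ae_eq_integrable.
Context d (T : measurableType d) (R : realType).
Context (mu : {measure set T -> \bar R}) (D : set T).
Hypothesis mD : measurable D.

Lemma ae_eq_integrable (f g : T -> \bar R) : measurable_fun D g ->
  ae_eq mu D f g -> mu.-integrable D f -> mu.-integrable D g.
Proof.
move=> mg fg /integrableP[mf foo]; apply/integrableP; split => //.
apply: le_lt_trans foo; rewrite le_eqVlt; apply/predU1P; left.
apply: ae_eq_integral => //; [exact: measurableT_comp..|].
by apply: filterS fg => x /= fg Dx; rewrite fg.
Qed.

End ae_eq_integrable.

Section fubini_Rintegral.
Context d1 d2 (T1 : measurableType d1) (T2 : measurableType d2) (R : realType).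
Context (m1 : {sigma_finite_measure set T1 -> \bar R}).
Context (m2 : {sigma_finite_measure set T2 -> \bar R}).
Implicit Types (f : T1 -> R) (g : T2 -> R) (h : T1 * T2 -> R).

(** Tonelli applies to the positive and negative parts separately; [fine] gives a default value to
    the sections whose integral is infinite, so integrability of h is not assumed. *)
Lemma measurable_Rintegral_section1 h : measurable_fun setT h ->
  measurable_fun setT (fun x => \int[m2]_y h (x, y)).
Proof.
move=> mh; have mEh : measurable_fun setT (EFin \o h) by exact/measurable_EFinP.
apply: (measurableT_comp (fine_measurable measurableT)).
rewrite (_ : (fun x => \int[m2]_y (h (x, y))%:E)%E = (fun x =>
  \int[m2]_y (EFin \o h)^\+ (x, y) - \int[m2]_y (EFin \o h)^\- (x, y))%E).
  apply: emeasurable_funB; apply: measurable_fun_fubini_tonelli_F => //.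
    exact: measurable_funepos.
  exact: measurable_funeneg.
apply/funext => x; rewrite integralE; congr (_ - _)%E; apply: eq_integral.
  by move=> y _; rewrite !funeposE.
by move=> y _; rewrite !funenegE.
Qed.

Lemma measurable_Rintegral_section2 h : measurable_fun setT h ->
  measurable_fun setT (fun y => \int[m1]_x h (x, y)).
Proof.
move=> mh; have mEh : measurable_fun setT (EFin \o h) by exact/measurable_EFinP.
apply: (measurableT_comp (fine_measurable measurableT)).
rewrite (_ : (fun y => \int[m1]_x (h (x, y))%:E)%E = (fun y =>
  \int[m1]_x (EFin \o h)^\+ (x, y) - \int[m1]_x (EFin \o h)^\- (x, y))%E).
  apply: emeasurable_funB; apply: measurable_fun_fubini_tonelli_G => //.
    exact: measurable_funepos.
  exact: measurable_funeneg.
apply/funext => y; rewrite integralE; congr (_ - _)%E; apply: eq_integral.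
  by move=> x _; rewrite !funeposE.
by move=> x _; rewrite !funenegE.
Qed.

Lemma integrableM_prod f g :
  m1.-integrable setT (EFin \o f) -> m2.-integrable setT (EFin \o g) ->
  (m1 \x m2)%E.-integrable setT (EFin \o (fun z => f z.1 * g z.2)).
Proof.
move=> /[dup] fi /integrableP[/measurable_EFinP mf fi'].
move=> /[dup] gi /integrableP[/measurable_EFinP mg gi'].
apply/integrable12ltyP.
  apply/measurable_EFinP/measurable_funM.
    exact: measurableT_comp mf measurable_fst.
  exact: measurableT_comp mg measurable_snd.
rewrite (_ : (fun x => _) = (fun x => `|(f x)%:E| * \int[m2]_y `|(g y)%:E|)%E).
  rewrite ge0_integralZr//.
    by rewrite lte_mul_pinfty ?integral_ge0// ge0_fin_numE ?integral_ge0.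
  by do 2 apply: measurableT_comp => //.
  exact: integral_ge0.
apply/funext => x; rewrite -ge0_integralZl//.
  by apply: eq_integral => y _; rewrite /= -EFinM normrM.
by do 2 apply: measurableT_comp => //.
Qed.

Section integrable.
Variable h : T1 * T2 -> R.
Hypothesis ih : (m1 \x m2)%E.-integrable setT (EFin \o h).

Let mh : measurable_fun setT h.
Proof. by move/measurable_int : ih => /measurable_EFinP. Qed.

(** Almost every section is integrable, and there the real-valued integral coincides with the
    extended one; this is how Fubini's theorem passes to [Rintegral]. *)
Let sectionE1 : {ae m1, forall x, setT x ->
  (EFin \o (fun x => \int[m2]_y h (x, y))) x = (\int[m2]_y (h (x, y))%:E)%E}.
Proof.
have := ae_integrable1 ih; apply: filterS => x /= ix _.
by rewrite /Rintegral fineK//; exact: integrable_fin_num ix.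
Qed.

Let sectionE2 : {ae m2, forall y, setT y ->
  (EFin \o (fun y => \int[m1]_x h (x, y))) y = (\int[m1]_x (h (x, y))%:E)%E}.
Proof.
have := ae_integrable2 ih; apply: filterS => x /= ix _.
by rewrite /Rintegral fineK//; exact: integrable_fin_num ix.
Qed.

Lemma integrable_Rintegral_section2 :
  m2.-integrable setT (EFin \o (fun y => \int[m1]_x h (x, y))).
Proof.
have mEh : measurable_fun setT (EFin \o h) by exact/measurable_EFinP.
have mF : measurable_fun setT (EFin \o (fun y => \int[m1]_x h (x, y))).
  by apply/measurable_EFinP; exact: measurable_Rintegral_section2.
apply/integrableP; split => //.
apply: le_lt_trans ((integrable21ltyP _ _ mEh).1 ih).
apply: ge0_le_integral => //.
- exact: measurableT_comp.
- apply: (measurable_fun_fubini_tonelli_G (abse \o (EFin \o h))) => /=.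
    exact: measurableT_comp.
  by move=> z; rewrite lee_fin.
move=> y _ /=; rewrite /Rintegral.
have mhy : measurable_fun setT (EFin \o (fun x => h (x, y))).
  by apply/measurable_EFinP; exact: (measurableT_comp mh (pair2_measurable y)).
(* The default value 0 of [fine] on infinities keeps |fine z| <= |z|. *)
apply: le_trans (le_abse_integral _ _ mhy) => //=.
by case: (\int[_]_x _)%E => [r||] /=; rewrite ?lee_fin ?normr0 ?leey.
Qed.

Lemma Rintegral_fubini1 :
  \int[m1]_x (\int[m2]_y h (x, y)) = \int[(m1 \x m2)%E]_z h z.
Proof.
congr fine; rewrite -(integral12_prod_meas1 ih); apply: ae_eq_integral => //.
  by apply/measurable_EFinP; exact: measurable_Rintegral_section1.
exact: (measurable_fubini_F ih).
Qed.

Lemma Rintegral_fubini2 :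
  \int[m2]_y (\int[m1]_x h (x, y)) = \int[(m1 \x m2)%E]_z h z.
Proof.
congr fine; rewrite -(integral21_prod_meas1 ih); apply: ae_eq_integral => //.
  by apply/measurable_EFinP; exact: measurable_Rintegral_section2.
exact: (measurable_fubini_G ih).
Qed.

Lemma Rintegral_fubini :
  \int[m1]_x (\int[m2]_y h (x, y)) = \int[m2]_y (\int[m1]_x h (x, y)).
Proof. by rewrite Rintegral_fubini1 Rintegral_fubini2. Qed.

End integrable.
End fubini_Rintegral.

(** * Integrals of matrix-valued functions *)

Section l1norm.
Context (R : realType).

(** This norm is submultiplicative for rectangular matrices, invariant under transposition, and a
    finite sum of entries, so it integrates termwise. *)
Definition l1norm p q (M : 'M[R]_(p, q)) : R := \sum_i \sum_j `|M i j|.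

Lemma l1norm_ge0 p q (M : 'M[R]_(p, q)) : 0 <= l1norm M.
Proof. by apply: sumr_ge0 => i _; apply: sumr_ge0. Qed.

Lemma l1norm_row p q (M : 'M[R]_(p, q)) i : \sum_j `|M i j| <= l1norm M.
Proof.
rewrite /l1norm (bigD1 i)//= lerDl; apply: sumr_ge0 => k _.
exact: sumr_ge0.
Qed.

Lemma l1norm_entry p q (M : 'M[R]_(p, q)) i j : `|M i j| <= l1norm M.
Proof.
apply: le_trans (l1norm_row M i).
by rewrite (bigD1 j)//= lerDl; apply: sumr_ge0.
Qed.

Lemma l1norm_eq0 p q (M : 'M[R]_(p, q)) : l1norm M <= 0 -> M = 0.
Proof.
move=> M0; apply/matrixP => i j; rewrite mxE; apply/eqP.
by rewrite -normr_le0; exact: le_trans (l1norm_entry _ _ _) M0.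
Qed.

Lemma l1norm0 p q : l1norm (0 : 'M[R]_(p, q)) = 0.
Proof.
by rewrite /l1norm big1// => i _; rewrite big1// => j _; rewrite mxE normr0.
Qed.

Lemma ler_l1normD p q (M N : 'M[R]_(p, q)) :
  l1norm (M + N) <= l1norm M + l1norm N.
Proof.
rewrite /l1norm -big_split; apply: ler_sum => i _; rewrite -big_split.
by apply: ler_sum => j _; rewrite mxE ler_normD.
Qed.

Lemma l1normN p q (M : 'M[R]_(p, q)) : l1norm (- M) = l1norm M.
Proof.
by apply: eq_bigr => i _; apply: eq_bigr => j _; rewrite mxE normrN.
Qed.

Lemma ler_l1normM p q r (M : 'M[R]_(p, q)) (N : 'M[R]_(q, r)) :
  l1norm (M *m N) <= l1norm M * l1norm N.
Proof.
rewrite /l1norm mulr_suml; apply: ler_sum => i _.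
rewrite mulr_suml -/(l1norm N).
apply: (@le_trans _ _ (\sum_k \sum_j `|M i j| * `|N j k|)).
  apply: ler_sum => k _; rewrite mxE; apply: le_trans (ler_norm_sum _ _ _) _.
  by apply: ler_sum => j _; rewrite normrM.
rewrite exchange_big; apply: ler_sum => j _; rewrite -mulr_sumr.
by rewrite ler_wpM2l//; exact: l1norm_row.
Qed.

Lemma l1norm1 p : l1norm (1%:M : 'M[R]_p) = p%:R.
Proof.
rewrite /l1norm (eq_bigr (fun=> 1)) ?sumr_const ?card_ord// => i _.
rewrite (bigD1 i)//= big1 ?addr0 ?mxE ?eqxx ?normr1// => j ji.
by rewrite mxE eq_sym (negbTE ji) normr0.
Qed.

Lemma sqnorm_ge0 p q (M : 'M[R]_(p, q)) : 0 <= sqnorm M.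
Proof. by apply: sumr_ge0 => i _; apply: sumr_ge0 => j _; exact: sqr_ge0. Qed.

Lemma sqnorm_cV p (v : 'cV[R]_p) : sqnorm v = \sum_i v i 0 ^+ 2.
Proof. by apply: eq_bigr => i _; rewrite big_ord1. Qed.

Lemma sqnorm_eq0 p (v : 'cV[R]_p) : sqnorm v = 0 -> v = 0.
Proof.
rewrite sqnorm_cV => v0; apply/matrixP => i j; rewrite (ord1 j) mxE.
apply/eqP; rewrite -sqrf_eq0; apply/eqP.
by apply: (psumr_eq0P _ v0) => // k _; exact: sqr_ge0.
Qed.

(** Each of the p coordinates of M v is at most [l1norm M] times the Euclidean norm of v. The factor
    p is crude, but only some constant depending on the bound of M matters. *)
Lemma sqnorm_mulmx p q (M : 'M[R]_(p, q)) (v : 'cV[R]_q) :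
  sqnorm (M *m v) <= p%:R * l1norm M ^+ 2 * sqnorm v.
Proof.
rewrite sqnorm_cV.
apply: (@le_trans _ _ (\sum_(i < p) l1norm M ^+ 2 * sqnorm v)); last first.
  by rewrite sumr_const card_ord -[leLHS]mulr_natl mulrA.
apply: ler_sum => i _; set s := Num.sqrt (sqnorm v).
have s2 : s ^+ 2 = sqnorm v by rewrite sqr_sqrtr// sqnorm_ge0.
have vs j : `|v j 0| <= s.
  rewrite -sqrtr_sqr ler_wsqrtr// sqnorm_cV (bigD1 j)//= lerDl.
  by apply: sumr_ge0 => k _; exact: sqr_ge0.
rewrite -s2 -exprMn -real_normK ?num_real//.
rewrite ler_pXn2r ?nnegrE ?mulr_ge0 ?l1norm_ge0 ?sqrtr_ge0//.
rewrite mxE; apply: (le_trans (ler_norm_sum _ _ _)).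
apply: (@le_trans _ _ ((\sum_j `|M i j|) * s)); last first.
  by rewrite ler_wpM2r ?sqrtr_ge0// l1norm_row.
by rewrite mulr_suml; apply: ler_sum => j _; rewrite normrM ler_wpM2l.
Qed.

End l1norm.

Section Rintegral_sum.
Context d (T : measurableType d) (R : realType).
Context (mu : {measure set T -> \bar R}) (D : set T).
Hypothesis mD : measurable D.

Lemma eq_Rintegrable (f g : T -> R) : (forall x, D x -> f x = g x) ->
  mu.-integrable D (EFin \o f) -> mu.-integrable D (EFin \o g).
Proof.
by move=> fg; apply: eq_integrable => // x /set_mem Dx /=; rewrite fg.
Qed.

Lemma integrable_RD (f g : T -> R) :
  mu.-integrable D (EFin \o f) -> mu.-integrable D (EFin \o g) ->
  mu.-integrable D (EFin \o (fun x => f x + g x)).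
Proof. by move=> fi gi; exact: (integrableD mD fi gi). Qed.

Lemma integrable_RZ (c : R) (f : T -> R) : mu.-integrable D (EFin \o f) ->
  mu.-integrable D (EFin \o (fun x => c * f x)).
Proof. by move=> fi; exact: (integrableZl mD c fi). Qed.

Lemma integrable_RN (f : T -> R) : mu.-integrable D (EFin \o f) ->
  mu.-integrable D (EFin \o (fun x => - f x)).
Proof. by move=> fi; exact: (integrableN fi). Qed.

Lemma integrable_RB (f g : T -> R) :
  mu.-integrable D (EFin \o f) -> mu.-integrable D (EFin \o g) ->
  mu.-integrable D (EFin \o (fun x => f x - g x)).
Proof. by move=> fi /integrable_RN; exact: integrable_RD. Qed.

Lemma le_Rintegrable (f g : T -> R) : measurable_fun D f ->
  (forall x, D x -> `|f x| <= g x) -> mu.-integrable D (EFin \o g) ->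
  mu.-integrable D (EFin \o f).
Proof.
move=> mf fg; apply: le_integrable => //; first exact/measurable_EFinP.
by move=> x Dx /=; rewrite lee_fin (le_trans (fg _ Dx))// ler_norm.
Qed.

Lemma integrable_Rsum (I : Type) (s : seq I) (P : pred I) (F : I -> T -> R) :
  (forall i, P i -> mu.-integrable D (EFin \o F i)) ->
  mu.-integrable D (EFin \o (fun x => \sum_(i <- s | P i) F i x)).
Proof.
move=> iF; apply: eq_integrable (integrable_sum mD s iF) => // x _.
by rewrite /= sumEFin.
Qed.

Lemma Rintegral_sum (I : Type) (s : seq I) (P : pred I) (F : I -> T -> R) :
  (forall i, P i -> mu.-integrable D (EFin \o F i)) ->
  \int[mu]_(x in D) (\sum_(i <- s | P i) F i x) =
  \sum_(i <- s | P i) \int[mu]_(x in D) F i x.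
Proof.
move=> iF; elim: s => [|i s IHs].
  rewrite big_nil /Rintegral (eq_integral (cst 0%E)) ?integral0// => x _.
  by rewrite big_nil.
rewrite big_cons; case: (boolP (P i)) => Pi; last first.
  by rewrite -IHs; apply: eq_Rintegral => x _; rewrite big_cons (negbTE Pi).
rewrite -IHs -RintegralD//.
- by apply: eq_Rintegral => x _; rewrite big_cons Pi.
- exact: iF.
- exact: integrable_Rsum.
Qed.

End Rintegral_sum.

Section mxint.
Context (R : realType).
Notation mu := (@lebesgue_measure R).

Definition mxintegrable (D : set (measurableTypeR R)) p q (f : R -> 'M[R]_(p, q)) : Prop :=
  forall i j, mu.-integrable D (EFin \o (fun t => f t i j)).

Definition mxmeasurable (D : set (measurableTypeR R)) p q (f : R -> 'M[R]_(p, q)) : Prop :=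
  forall i j, measurable_fun D (fun t => f t i j).

(** The multipliers of [mxintegrable]: continuous functions and primitives on a segment are of this
    kind, whereas the coefficient A is only essentially bounded and is treated as an integrable
    factor. *)
Definition mxbounded (D : set (measurableTypeR R)) p q (f : R -> 'M[R]_(p, q)) : Prop :=
  mxmeasurable D f /\ exists M, forall t, D t -> l1norm (f t) <= M.

Section fixed_domain.
Context (D : set (measurableTypeR R)).
Hypothesis mD : measurable D.

Lemma mxintegrable_measurable p q (f : R -> 'M[R]_(p, q)) :
  mxintegrable D f -> mxmeasurable D f.
Proof. by move=> fi i j; have /measurable_int/measurable_EFinP := fi i j. Qed.

Lemma measurable_l1norm p q (f : R -> 'M[R]_(p, q)) :
  mxmeasurable D f -> measurable_fun D (fun t => l1norm (f t)).
Proof.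
move=> mf; rewrite /l1norm; apply: measurable_sum => i; apply: measurable_sum => j.
exact: measurableT_comp.
Qed.

Lemma mxmeasurable_mul p q r (f : R -> 'M[R]_(p, q)) (g : R -> 'M[R]_(q, r)) :
  mxmeasurable D f -> mxmeasurable D g ->
  mxmeasurable D (fun t => f t *m g t).
Proof.
move=> mf mg i k; under eq_fun do rewrite mxE.
by apply: measurable_sum => j; exact: measurable_funM.
Qed.

Lemma mxintegrable_l1norm p q (f : R -> 'M[R]_(p, q)) : mxintegrable D f ->
  mu.-integrable D (EFin \o (fun t => l1norm (f t))).
Proof.
move=> fi; rewrite /l1norm.
apply: (@integrable_Rsum _ _ _ mu D mD) => i _.
apply: (@integrable_Rsum _ _ _ mu D mD) => j _.
exact: integrable_norm (fi i j).
Qed.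

Lemma le_l1norm_mxint p q (f : R -> 'M[R]_(p, q)) : mxintegrable D f ->
  l1norm (mxint D f) <= \int[mu]_(t in D) l1norm (f t).
Proof.
move=> fi.
have fin i j : mu.-integrable D (EFin \o (fun t => `|f t i j|)).
  exact: integrable_norm (fi i j).
rewrite /l1norm Rintegral_sum//; last first.
  by move=> i _; apply: (@integrable_Rsum _ _ _ mu D mD) => j _; exact: fin.
apply: ler_sum => i _; rewrite Rintegral_sum//; apply: ler_sum => j _.
by rewrite mxE; exact: le_normr_Rintegral.
Qed.

Lemma mxintegrableD p q (f g : R -> 'M[R]_(p, q)) :
  mxintegrable D f -> mxintegrable D g -> mxintegrable D (fun t => f t + g t).
Proof.
move=> fi gi i j; apply: (eq_Rintegrable mD _ (integrable_RD mD (fi i j) (gi i j))).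
by move=> t _; rewrite mxE.
Qed.

Lemma mxintegrableN p q (f : R -> 'M[R]_(p, q)) :
  mxintegrable D f -> mxintegrable D (fun t => - f t).
Proof.
move=> fi i j; apply: (eq_Rintegrable mD _ (integrable_RN (fi i j))).
by move=> t _; rewrite mxE.
Qed.

Lemma mxintegrableB p q (f g : R -> 'M[R]_(p, q)) :
  mxintegrable D f -> mxintegrable D g -> mxintegrable D (fun t => f t - g t).
Proof. by move=> fi gi; apply: mxintegrableD => //; exact: mxintegrableN. Qed.

Lemma mxintegrable_bounded_mul p q r (g : R -> 'M[R]_(p, q))
    (f : R -> 'M[R]_(q, r)) :
  mxbounded D g -> mxintegrable D f -> mxintegrable D (fun t => g t *m f t).
Proof.
move=> [mg [M gM]] fi i k.
apply: (@eq_Rintegrable _ _ _ mu D mD (fun t => \sum_j g t i j * f t j k)).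
  by move=> t _ /=; rewrite mxE.
apply: (@integrable_Rsum _ _ _ mu D mD) => j _.
apply: (le_Rintegrable mD _ _ (integrable_RZ mD M (integrable_norm (fi j k)))).
  apply: measurable_funM; first exact: mg.
  exact: (mxintegrable_measurable fi).
move=> t Dt /=; rewrite normrM ler_wpM2r//.
by rewrite (le_trans (l1norm_entry _ _ _))// gM.
Qed.

Lemma mxintegrable_tr p q (f : R -> 'M[R]_(p, q)) :
  mxintegrable D f -> mxintegrable D (fun t => (f t)^T).
Proof.
move=> fi i j; apply: (eq_Rintegrable mD _ (fi j i)) => t _.
by rewrite mxE.
Qed.

Lemma l1norm_tr p q (M : 'M[R]_(p, q)) : l1norm M^T = l1norm M.
Proof.
rewrite /l1norm exchange_big; apply: eq_bigr => i _; apply: eq_bigr => j _.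
by rewrite mxE.
Qed.

Lemma mxbounded_tr p q (f : R -> 'M[R]_(p, q)) :
  mxbounded D f -> mxbounded D (fun t => (f t)^T).
Proof.
move=> [mf [M fM]]; split.
  by move=> i j; under eq_fun do rewrite mxE; exact: mf.
by exists M => t Dt; rewrite l1norm_tr; exact: fM.
Qed.

Lemma mxintegrable_mul_bounded p q r (f : R -> 'M[R]_(p, q))
    (g : R -> 'M[R]_(q, r)) :
  mxintegrable D f -> mxbounded D g -> mxintegrable D (fun t => f t *m g t).
Proof.
move=> /mxintegrable_tr fi /mxbounded_tr gb.
have := mxintegrable_tr (mxintegrable_bounded_mul gb fi).
by under eq_fun do rewrite trmx_mul !trmxK.
Qed.

Lemma mxbounded_cst p q (M : 'M[R]_(p, q)) : mxbounded D (fun=> M).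
Proof. by split; [move=> i j; exact: measurable_cst|exists (l1norm M)]. Qed.

Lemma mxboundedD p q (f g : R -> 'M[R]_(p, q)) :
  mxbounded D f -> mxbounded D g -> mxbounded D (fun t => f t + g t).
Proof.
move=> [mf [M fM]] [mg [N gN]]; split.
  by move=> i j; under eq_fun do rewrite mxE; exact: measurable_funD.
exists (M + N) => t Dt; apply: le_trans (ler_l1normD _ _) _.
by rewrite lerD// ?fM ?gN.
Qed.

Lemma mxboundedN p q (f : R -> 'M[R]_(p, q)) :
  mxbounded D f -> mxbounded D (fun t => - f t).
Proof.
move=> [mf [M fM]]; split; last by exists M => t Dt; rewrite l1normN fM.
move=> i j; rewrite (_ : (fun t => _) = (fun t => - f t i j)).
  exact: measurableT_comp (mf i j).
by apply/funext => t; rewrite mxE.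
Qed.

Lemma mxboundedB p q (f g : R -> 'M[R]_(p, q)) :
  mxbounded D f -> mxbounded D g -> mxbounded D (fun t => f t - g t).
Proof. by move=> fb /mxboundedN; exact: mxboundedD. Qed.

Lemma mxbounded_mul p q r (f : R -> 'M[R]_(p, q)) (g : R -> 'M[R]_(q, r)) :
  mxbounded D f -> mxbounded D g -> mxbounded D (fun t => f t *m g t).
Proof.
move=> [mf [M fM]] [mg [N gN]]; split; first exact: mxmeasurable_mul.
exists (M * N) => t Dt; apply: le_trans (ler_l1normM _ _) _.
by rewrite ler_pM ?l1norm_ge0// ?fM ?gN.
Qed.

Lemma eq_mxint p q (f g : R -> 'M[R]_(p, q)) :
  (forall t, D t -> f t = g t) -> mxint D f = mxint D g.
Proof.
move=> fg; apply/matrixP => i j; rewrite !mxE; apply: eq_Rintegral => t tD.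
by rewrite fg//; exact: set_mem.
Qed.

Lemma mxintD p q (f g : R -> 'M[R]_(p, q)) :
  mxintegrable D f -> mxintegrable D g ->
  mxint D (fun t => f t + g t) = mxint D f + mxint D g.
Proof.
move=> fi gi; apply/matrixP => i j; rewrite !mxE -RintegralD//.
by apply: eq_Rintegral => t _; rewrite mxE.
Qed.

Lemma mxintB p q (f g : R -> 'M[R]_(p, q)) :
  mxintegrable D f -> mxintegrable D g ->
  mxint D (fun t => f t - g t) = mxint D f - mxint D g.
Proof.
move=> fi gi; apply/matrixP => i j; rewrite !mxE -RintegralB//.
by apply: eq_Rintegral => t _; rewrite !mxE.
Qed.

Lemma mxint_mull p q r (M : 'M[R]_(p, q)) (f : R -> 'M[R]_(q, r)) :
  mxintegrable D f -> mxint D (fun t => M *m f t) = M *m mxint D f.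
Proof.
move=> fi; apply/matrixP => i k; rewrite !mxE.
under eq_Rintegral do rewrite mxE.
rewrite Rintegral_sum//; last by move=> j _; exact: (integrable_RZ mD _ (fi j k)).
by apply: eq_bigr => j _; rewrite mxE RintegralZl.
Qed.

Lemma mxintN p q (f : R -> 'M[R]_(p, q)) : mxintegrable D f ->
  mxint D (fun t => - f t) = - mxint D f.
Proof.
move=> fi; rewrite -[RHS]mul1mx mulmxN -mulNmx -mxint_mull//.
by apply: eq_mxint => t _; rewrite mulNmx mul1mx.
Qed.

Lemma mxint_tr p q (f : R -> 'M[R]_(p, q)) :
  mxint D (fun t => (f t)^T) = (mxint D f)^T.
Proof.
by apply/matrixP => i j; rewrite !mxE; apply: eq_Rintegral => t _; rewrite mxE.
Qed.

Lemma mxint_mulr p q r (f : R -> 'M[R]_(p, q)) (M : 'M[R]_(q, r)) :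
  mxintegrable D f -> mxint D (fun t => f t *m M) = mxint D f *m M.
Proof.
move=> fi; apply: trmx_inj; rewrite trmx_mul -!mxint_tr -mxint_mull.
  by apply: eq_mxint => t _; rewrite trmx_mul.
exact: mxintegrable_tr.
Qed.

End fixed_domain.

Lemma mxintegrableS (D E : set (measurableTypeR R)) p q (f : R -> 'M[R]_(p, q)) :
  measurable D -> measurable E -> E `<=` D ->
  mxintegrable D f -> mxintegrable E f.
Proof. by move=> mD mE ED fi i j; exact: integrableS (fi i j). Qed.

Lemma mxboundedS (D E : set (measurableTypeR R)) p q (f : R -> 'M[R]_(p, q)) :
  measurable D -> E `<=` D -> mxbounded D f -> mxbounded E f.
Proof.
move=> mD ED [mf [M fM]]; split; first by move=> i j; exact: measurable_funS (mf i j).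
by exists M => t /ED; exact: fM.
Qed.

End mxint.

(** * Linear Volterra equations and transition matrices *)

Section primitive_mul.
Context (R : realType).
Notation mu := (@lebesgue_measure R).
Implicit Types (f g : R -> R) (t : R).

Let TR := measurableTypeR R.

Let patch_itv f t x : (f \_ `[0, t]) x = if 0 <= x <= t then f x else 0.
Proof.
rewrite patchE; have [xt|xt] := boolP (0 <= x <= t).
  by rewrite ifT// inE/= in_itv.
by rewrite ifF//; apply/negbTE; apply: contra xt; rewrite inE/= in_itv.
Qed.

(* Both iterated integrals are integrals over the two halves of the square
   [0, t] x [0, t] cut along its diagonal. *)
Lemma Rprimitive_mul f g t :
  mu.-integrable `[0, t] (EFin \o f) -> mu.-integrable `[0, t] (EFin \o g) ->
  (\int[mu]_(s in `[0, t]) f s) * (\int[mu]_(s in `[0, t]) g s) =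
  \int[mu]_(s in `[0, t]) (f s * \int[mu]_(r in `[0, s]) g r) +
  \int[mu]_(s in `[0, t]) ((\int[mu]_(r in `[0, s]) f r) * g s).
Proof.
move=> fi gi; have mI : measurable (`[0, t]%classic : set TR) by [].
pose ft : TR -> R := f \_ `[0, t]; pose gt : TR -> R := g \_ `[0, t].
have fti : mu.-integrable setT (EFin \o ft).
  by have /(integrable_mkcond _ mI) := fi; rewrite restrict_EFin.
have gti : mu.-integrable setT (EFin \o gt).
  by have /(integrable_mkcond _ mI) := gi; rewrite restrict_EFin.
have fgi := integrableM_prod fti gti.
have mfg := fgi; move/measurable_int/measurable_EFinP : mfg => mfg.
pose h1 (z : TR * TR) := if z.2 <= z.1 then ft z.1 * gt z.2 else 0.
pose h2 (z : TR * TR) := if z.2 <= z.1 then 0 else ft z.1 * gt z.2.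
have mle : measurable_fun setT (fun z : TR * TR => z.2 <= z.1).
  exact: measurable_fun_ler measurable_snd measurable_fst.
have h1i : (mu \x mu)%E.-integrable setT (EFin \o h1).
  apply: (le_Rintegrable measurableT _ _ (integrable_norm fgi)).
    exact: measurable_fun_ifT.
  by move=> z _; rewrite /h1; case: ifP => _ //=; rewrite normr0.
have h2i : (mu \x mu)%E.-integrable setT (EFin \o h2).
  apply: (le_Rintegrable measurableT _ _ (integrable_norm fgi)).
    exact: measurable_fun_ifT.
  by move=> z _; rewrite /h2; case: ifP => _ //=; rewrite normr0.
have -> : (\int[mu]_(s in `[0, t]) f s) * (\int[mu]_(s in `[0, t]) g s) =
    \int[(mu \x mu)%E]_z (ft z.1 * gt z.2).
  rewrite [X in X * _ = _]Rintegral_mkcond [X in _ * X = _]Rintegral_mkcond.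
  rewrite -(Rintegral_fubini1 fgi) -RintegralZr//.
  by apply: eq_Rintegral => x _; rewrite /= -RintegralZl.
have -> : \int[(mu \x mu)%E]_z (ft z.1 * gt z.2) =
    \int[(mu \x mu)%E]_z h1 z + \int[(mu \x mu)%E]_z h2 z.
  rewrite -RintegralD//; apply: eq_Rintegral => z _.
  by rewrite /h1 /h2; case: ifP; rewrite ?addr0 ?add0r.
congr (_ + _).
- rewrite -(Rintegral_fubini1 h1i) [RHS]Rintegral_mkcond.
  apply: eq_Rintegral => x _; rewrite patch_itv.
  case: (boolP (0 <= x <= t)) => [xt|/negbTE xt]; last first.
    rewrite /Rintegral (eq_integral (cst 0%E)) ?integral0// => y _.
    by rewrite /h1 /ft /= patch_itv xt mul0r if_same.
  rewrite -RintegralZl//; last first.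
    apply: integrableS gi => //; apply: subset_itvl; rewrite bnd_simp.
    by case/andP: xt.
  rewrite [RHS]Rintegral_mkcond; apply: eq_Rintegral => y _.
  rewrite patch_itv /h1 /= /ft /gt !patch_itv xt.
  case/andP : xt => x0 xt.
  have [yx|xy] := leP y x; last by rewrite andbF.
  by rewrite (le_trans yx xt) !andbT; case: ifP; rewrite ?mulr0.
- rewrite -(Rintegral_fubini2 h2i) [RHS]Rintegral_mkcond.
  apply: eq_Rintegral => y _; rewrite patch_itv.
  case: (boolP (0 <= y <= t)) => [yt|/negbTE yt]; last first.
    rewrite /Rintegral (eq_integral (cst 0%E)) ?integral0// => x _.
    by rewrite /h2 /gt /= patch_itv yt mulr0 if_same.
  have fiy : mu.-integrable `[0, y] (EFin \o f).
    apply: integrableS fi => //; apply: subset_itvl; rewrite bnd_simp.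
    by case/andP: yt.
  have fiy' : mu.-integrable `[0, y[ (EFin \o f).
    by apply: integrableS fiy => //; apply: subset_itvl; rewrite bnd_simp.
  (* [h2] excludes the diagonal, so x ranges over the half-open interval; its missing endpoint has
     measure 0. *)
  rewrite -Rintegral_itv_bndo_bndc//.
  rewrite -RintegralZr//.
  rewrite [RHS]Rintegral_mkcond; apply: eq_Rintegral => x _.
  rewrite /h2 /= /ft /gt !patch_itv yt patchE.
  case/andP : yt => y0 yt.
  have [yx|xy] := leP y x.
    by rewrite ifF//; apply/negbTE; rewrite notin_setE/= in_itv/= ltNge yx andbF.
  rewrite (le_trans (ltW xy) yt) andbT.
  have -> : (x \in (`[0, y[%classic : set R)) = (0 <= x).
    by apply/idP/idP; rewrite inE/= in_itv/= xy andbT.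
  by case: ifP; rewrite ?mul0r.
Qed.

Lemma Rprimitive_continuous f t : mu.-integrable `[0, t] (EFin \o f) ->
  {within `[0, t], continuous (fun s => \int[mu]_(r in `[0, s]) f r)}.
Proof.
have [t0|t0] := leP 0 t; first by move=> fi; exact: parameterized_integral_continuous.
by rewrite set_itv_ge ?bnd_simp -?ltNge//= => _ x; exact: continuous_subspace0.
Qed.

(** The right-hand side does not depend on s: primitives are uniformly bounded, hence admissible
    multipliers. *)
Lemma Rprimitive_bounded f t s :
  mu.-integrable `[0, t] (EFin \o f) -> s <= t ->
  `|\int[mu]_(r in `[0, s]) f r| <= \int[mu]_(r in `[0, t]) `|f r|.
Proof.
move=> fi st; have fis : mu.-integrable `[0, s] (EFin \o f).
  by apply: integrableS fi => //; apply: subset_itvl; rewrite bnd_simp.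
apply: (le_trans (le_normr_Rintegral _ _)) => //.
rewrite [leLHS]Rintegral_mkcond [leRHS]Rintegral_mkcond.
have mI r : measurable (`[0, r]%classic : set TR) by [].
apply: le_Rintegral => //.
- by have /integrable_norm/(integrable_mkcond _ (mI s)) := fis;
    rewrite restrict_EFin.
- by have /integrable_norm/(integrable_mkcond _ (mI t)) := fi;
    rewrite restrict_EFin.
- move=> x _; rewrite (patch_itv (fun r => `|f r|)).
  rewrite (patch_itv (fun r => `|f r|)).
  have [xs|] := boolP (0 <= x <= s); last by case: ifP.
  by case/andP : xs => -> xs; rewrite (le_trans xs st).
Qed.

End primitive_mul.

Section mx_product_rule.
Context (R : realType) (T : R).
Notation mu := (@lebesgue_measure R).

Let subI t : t <= T -> `[0, t]%classic `<=` (`[0, T]%classic : set R).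
Proof. by move=> tT; apply: subset_itvl; rewrite bnd_simp. Qed.

Lemma mxprimitive_bounded0 p q (f : R -> 'M[R]_(p, q)) :
  mxintegrable `[0, T] f -> mxbounded `[0, T] (fun t => mxint `[0, t] f).
Proof.
move=> fi; split=> [i j|].
  rewrite (_ : (fun t => _) = (fun t => \int[mu]_(r in `[0, t]) f r i j)).
    apply: subspace_continuous_measurable_fun => //.
    exact: Rprimitive_continuous (fi i j).
  by apply/funext => t; rewrite mxE.
exists (\sum_i \sum_j \int[mu]_(t in `[0, T]) `|f t i j|) => t.
rewrite /= in_itv/= => /andP[_ tT].
apply: ler_sum => i _; apply: ler_sum => j _; rewrite mxE.
exact: Rprimitive_bounded (fi i j) tT.
Qed.

Lemma mxprimitive_bounded p q (f : R -> 'M[R]_(p, q)) (M : 'M[R]_(p, q)) :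
  mxintegrable `[0, T] f ->
  mxbounded `[0, T] (fun t => M + mxint `[0, t] f).
Proof.
move=> fi; apply: mxboundedD; first exact: mxbounded_cst.
exact: mxprimitive_bounded0.
Qed.

(** The rule (F G)' = F' G + F G' for absolutely continuous F and G, kept in integrated form so that
    nothing is ever differentiated almost everywhere. The entries reduce to [Rprimitive_mul]. *)
Lemma mxprimitive_mul p q r (a : 'M[R]_(p, q)) (b : 'M[R]_(q, r))
    (f : R -> 'M[R]_(p, q)) (g : R -> 'M[R]_(q, r)) t : t <= T ->
  mxintegrable `[0, T] f -> mxintegrable `[0, T] g ->
  (a + mxint `[0, t] f) *m (b + mxint `[0, t] g) =
  a *m b + mxint `[0, t] (fun s => f s *m (b + mxint `[0, s] g) +
                                   (a + mxint `[0, s] f) *m g s).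
Proof.
move=> tT fi' gi'; have mI : measurable (`[0, t]%classic : set (measurableTypeR R)) by [].
have mT : measurable (`[0, T]%classic : set (measurableTypeR R)) by [].
have fi := mxintegrableS mT mI (subI tT) fi'.
have gi := mxintegrableS mT mI (subI tT) gi'.
have fG : mxintegrable `[0, t] (fun s => f s *m mxint `[0, s] g).
  apply: mxintegrable_mul_bounded => //.
  apply: mxboundedS (subI tT) _ => //.
  exact: mxprimitive_bounded0.
have Fg : mxintegrable `[0, t] (fun s => mxint `[0, s] f *m g s).
  apply: mxintegrable_bounded_mul => //.
  apply: mxboundedS (subI tT) _ => //.
  exact: mxprimitive_bounded0.
have fb : mxintegrable `[0, t] (fun s => f s *m b).
  by apply: mxintegrable_mul_bounded => //; exact: mxbounded_cst.
have ag : mxintegrable `[0, t] (fun s => a *m g s).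
  by apply: mxintegrable_bounded_mul => //; exact: mxbounded_cst.
have -> : mxint `[0, t] (fun s => f s *m (b + mxint `[0, s] g) +
                                   (a + mxint `[0, s] f) *m g s) =
    mxint `[0, t] (fun s => (f s *m b + a *m g s) +
       (f s *m mxint `[0, s] g + mxint `[0, s] f *m g s)).
  by apply: eq_mxint => s _; rewrite mulmxDl mulmxDr addrACA.
rewrite mxintD//; [|exact: mxintegrableD..].
rewrite mxintD// (mxint_mulr mI b fi) (mxint_mull mI a gi).
have -> : mxint `[0, t] (fun s => f s *m mxint `[0, s] g + mxint `[0, s] f *m g s)
    = mxint `[0, t] f *m mxint `[0, t] g.
  apply/matrixP => i k; rewrite !mxE.
  under [RHS]eq_bigr => j _ do rewrite !mxE Rprimitive_mul//.
  rewrite big_split/= -!Rintegral_sum//; first last.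
  - move=> j _.
    apply: (le_Rintegrable mI _ _ (integrable_RZ mI
      (\int[mu]_(t in `[0, T]) `|g t j k|) (integrable_norm (fi i j)))).
      apply: measurable_funM; first exact: (mxintegrable_measurable fi).
      apply: (measurable_funS _ (subI tT)) => //.
      apply: subspace_continuous_measurable_fun => //.
      exact: Rprimitive_continuous (gi' j k).
    move=> s /=; rewrite in_itv/= => /andP[_ st].
    rewrite normrM mulrC ler_wpM2r//.
    exact: Rprimitive_bounded (gi' j k) (le_trans st tT).
  - move=> j _.
    apply: (le_Rintegrable mI _ _ (integrable_RZ mI
      (\int[mu]_(t in `[0, T]) `|f t i j|) (integrable_norm (gi j k)))).
      apply: measurable_funM; last exact: (mxintegrable_measurable gi).
      apply: (measurable_funS _ (subI tT)) => //.
      apply: subspace_continuous_measurable_fun => //.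
      exact: Rprimitive_continuous (fi' i j).
    move=> s /=; rewrite in_itv/= => /andP[_ st].
    rewrite normrM ler_wpM2r//.
    exact: Rprimitive_bounded (fi' i j) (le_trans st tT).
  rewrite -RintegralD//; last 2 first.
  - apply: (eq_Rintegrable mI _ (fG i k)) => s _; rewrite mxE.
    by apply: eq_bigr => j _; rewrite mxE.
  - apply: (eq_Rintegrable mI _ (Fg i k)) => s _; rewrite mxE.
    by apply: eq_bigr => j _; rewrite mxE.
  apply: eq_Rintegral => s _; rewrite !mxE; congr (_ + _).
    by apply: eq_bigr => j _; rewrite mxE.
  by apply: eq_bigr => j _; rewrite mxE.
by rewrite mulmxDl !mulmxDr -!addrA; congr (_ + _); rewrite addrCA.
Qed.

End mx_product_rule.

(** * Gronwall's inequality and Volterra equations with an essentially bounded kernel *)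

Section gronwall.
Context (R : realType).
Notation mu := (@lebesgue_measure R).

Lemma Rintegral_expR (l s t : R) : 0 < l -> s <= t ->
  \int[mu]_(r in `[s, t]) expR (l * (r - s)) = (expR (l * (t - s)) - 1) / l.
Proof.
move=> l0; rewrite le_eqVlt => /predU1P[->|st].
  by rewrite set_itv1 Rintegral_set1 subrr mulr0 expR0 subrr mul0r.
pose F : R^o -> R^o := fun r => l^-1 *: expR (l * (r - s)).
have dF (r : R^o) : is_derive r 1 F (expR (l * (r - s))).
  have dl : is_derive r (1 : R^o) (fun r : R^o => l *: (r - s) : R^o) l.
    by apply: is_derive_eq; rewrite subr0 /GRing.scale/= mulr1.
  have dE := @is_derive1_comp R expR (fun r : R^o => l *: (r - s) : R^o) r _ _
    (is_derive_expR (l * (r - s))) dl.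
  have -> : expR (l * (r - s)) = l^-1 *: (expR (l * (r - s)) * l).
    by rewrite /GRing.scale/=; field; rewrite gt_eqF.
  exact: (@is_deriveZ R R^o R^o _ l^-1 r 1 _ dE).
have cF : continuous F by move=> r; apply/differentiable_continuous/derivable1_diffP.
rewrite /Rintegral (@continuous_FTC2 _ _ F)//=.
- by rewrite /F subrr mulr0 expR0 /GRing.scale/=; field; rewrite gt_eqF.
- apply: continuous_subspaceT => r.
  apply: (@continuous_comp _ _ _ (fun r => l * (r - s)) expR).
    apply: cvgM; first exact: cvg_cst.
    by apply: cvgB; [exact: cvg_id|exact: cvg_cst].
  exact: continuous_expR.
- split; first by move=> r _.
  + by apply: cvg_at_right_filter; exact: cF.
  + by apply: cvg_at_left_filter; exact: cF.
- by move=> r _; rewrite derive1E; apply: derive_val.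
Qed.

(* The weighted supremum [N] of [f r * exp (- l (r - s))], with [l = 2C + 1],
   satisfies [N <= a + N / 2]. *)
Lemma gronwall (s t a C : R) (f : R -> R) : 0 <= C ->
  mu.-integrable `[s, t] (EFin \o f) ->
  (exists M, forall r, s <= r <= t -> f r <= M) ->
  (forall r, s <= r <= t -> 0 <= f r) ->
  (forall r, s <= r <= t -> f r <= a + C * \int[mu]_(q in `[s, r]) f q) ->
  forall r, s <= r <= t -> f r <= 2 * a * expR ((2 * C + 1) * (r - s)).
Proof.
move=> C0 fi [M fM] f0 fC r0 sr0t.
set l := 2 * C + 1; have l0 : 0 < l by rewrite /l; lra.
pose g r := f r * expR (- (l * (r - s))).
pose S := [set g r | r in `[s, t]%classic].
have gS r : s <= r <= t -> S (g r) by move=> srt; exists r => //=; rewrite in_itv.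
have expN r : s <= r -> expR (- (l * (r - s))) <= 1.
  move=> sr; rewrite -expR0 ler_expR oppr_le0.
  by apply: mulr_ge0; [exact: ltW|rewrite subr_ge0].
have ubS : has_ubound S.
  exists `|M| => x [r /=]; rewrite in_itv/= => srt <-{x}; rewrite /g.
  rewrite -[leRHS]mulr1 ler_pM ?f0 ?expR_ge0//; last by apply: expN; case/andP: srt.
  by rewrite (le_trans (fM _ srt)) ?ler_norm.
set N := sup S.
have gN r : s <= r <= t -> g r <= N by move=> srt; apply: ub_le_sup => //; exact: gS.
have fN r : s <= r <= t -> f r <= N * expR (l * (r - s)).
  by move=> /gN; rewrite /g expRN ler_pdivrMr// expR_gt0.
have N0 : 0 <= N.
  by apply: le_trans (gN _ sr0t); rewrite mulr_ge0 ?expR_ge0 ?f0.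
have key r : s <= r <= t -> g r <= a + N / 2.
  move=> /[dup] srt /andP[sr rt]; rewrite /g.
  have fir : mu.-integrable `[s, r] (EFin \o f).
    by apply: integrableS fi => //; apply: subset_itvl; rewrite bnd_simp.
  have ei : mu.-integrable `[s, r] (EFin \o (fun q => expR (l * (q - s)))).
    apply: continuous_compact_integrable; first exact: segment_compact.
    apply: continuous_subspaceT => q.
    apply: (@continuous_comp _ _ _ (fun r => l * (r - s)) expR).
      apply: cvgM; first exact: cvg_cst.
      by apply: cvgB; [exact: cvg_id|exact: cvg_cst].
    exact: continuous_expR.
  have intf : \int[mu]_(q in `[s, r]) f q <= N * ((expR (l * (r - s)) - 1) / l).
    rewrite -Rintegral_expR// -RintegralZl//; apply: le_Rintegral => //.
      exact: integrable_RZ.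
    move=> q /=; rewrite in_itv/= => /andP[sq qr]; apply: fN.
    by rewrite sq (le_trans qr).
  rewrite expRN ler_pdivrMr ?expR_gt0//; apply: (le_trans (fC _ srt)).
  have e1 : 1 <= expR (l * (r - s)).
    rewrite -expR0 ler_expR.
    by apply: mulr_ge0; [exact: ltW|rewrite subr_ge0].
  have a0 : 0 <= a + N / 2 \/ a + N / 2 < 0 by case: (leP 0 (a + N / 2)); auto.
  set e := expR _ in e1 intf *.
  (* The choice l = 2C + 1 gives C / l <= 1/2; the summand 1 keeps l positive when C = 0. *)
  have : C * \int[mu]_(q in `[s, r]) f q <= N / 2 * (e - 1).
    apply: (le_trans (ler_wpM2l C0 intf)).
    rewrite mulrCA -(mulrA N) ler_wpM2l// mulrCA mulrC ler_wpM2r ?subr_ge0//.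
    by rewrite ler_pdivrMr// /l; lra.
  (* At r = s the integral is over a point, so 0 <= f s <= a. *)
  have aa : 0 <= a.
    have := fC s; rewrite lexx (le_trans sr rt) set_itv1 Rintegral_set1 mulr0 addr0.
    by move=> /(_ isT); apply: le_trans; apply: f0; rewrite lexx (le_trans sr rt).
  nra.
have : N <= a + N / 2.
  apply: ge_sup => [|x [r /=]]; first by exists (g r0); exact: gS.
  by rewrite in_itv/= => srt <-{x}; exact: key.
move=> N2a; apply: (le_trans (fN _ sr0t)); rewrite ler_wpM2r ?expR_ge0//; lra.
Qed.

End gronwall.

Section ae_monotony.
Context d (T : measurableType d) (R : realType).
Context (mu : {measure set T -> \bar R}).
Implicit Types P Q S : T -> Prop.

Lemma aeS P Q : (forall x, P x -> Q x) ->
  {ae mu, forall x, P x} -> {ae mu, forall x, Q x}.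
Proof. by move=> PQ; apply: filterS. Qed.

Lemma aeS2 P Q S : (forall x, P x -> Q x -> S x) ->
  {ae mu, forall x, P x} -> {ae mu, forall x, Q x} -> {ae mu, forall x, S x}.
Proof. by move=> PQ; apply: filterS2. Qed.

End ae_monotony.

Section ae_le_Rintegral.
Context d (T : measurableType d) (R : realType).
Context (mu : {measure set T -> \bar R}) (D : set T).
Hypothesis mD : measurable D.

Lemma ae_le_Rintegral (f g : T -> R) :
  mu.-integrable D (EFin \o f) -> mu.-integrable D (EFin \o g) ->
  (forall x, D x -> 0 <= f x) -> (forall x, D x -> 0 <= g x) ->
  {ae mu, forall x, D x -> f x <= g x} ->
  \int[mu]_(x in D) f x <= \int[mu]_(x in D) g x.
Proof.
move=> fi gi f0 g0 fg; apply: fine_le; [exact: integrable_fin_num..|].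
apply: ae_ge0_le_integral => //.
- exact: measurable_int fi.
- exact: measurable_int gi.
Qed.

End ae_le_Rintegral.

Lemma bounded_itv_integrable (R : realType) (T : R) (D : set (measurableTypeR R))
    (f : R -> R) (M : R) :
  measurable D -> D `<=` `[0, T] -> measurable_fun D f ->
  (forall t, D t -> `|f t| <= M) -> lebesgue_measure.-integrable D (EFin \o f).
Proof.
move=> mD DT mf fM; apply: (le_Rintegrable mD mf fM).
have mT : measurable (`[0, T]%classic : set (measurableTypeR R)) by [].
apply: (integrableS mT mD DT).
apply/integrableP; split; first exact/measurable_EFinP/measurable_cst.
rewrite (eq_integral (cst `|M|%:E))// integral_cst//. 
rewrite /= lebesgue_measure_itv/=.
by case: ifPn => _; rewrite ?mule0// -EFinB -EFinM ltry.
Qed.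

Section volterra.
Context (R : realType) (T : R) (n : nat) (A : R -> 'M[R]_n) (C : R).
Notation mu := (@lebesgue_measure R).
Hypothesis C0 : 0 <= C.
Hypothesis Ai : mxintegrable `[0, T] A.
Hypothesis AC : {ae mu, forall t, `[0, T]%classic t -> l1norm (A t) <= C}.

Let mitv a b : measurable (`[a, b]%classic : set (measurableTypeR R)).
Proof. by []. Qed.

Lemma l1norm_mxint_mulmx p (phi : R -> 'M[R]_(n, p)) a b : 0 <= a -> b <= T ->
  mxbounded `[a, b] phi ->
  l1norm (mxint `[a, b] (fun r => A r *m phi r)) <=
  C * \int[mu]_(r in `[a, b]) l1norm (phi r).
Proof.
move=> a0 bT phib.
have sub : `[a, b]%classic `<=` (`[0, T]%classic : set R).
  by apply: subset_itv; rewrite bnd_simp.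
have Aiab := mxintegrableS (mitv 0 T) (mitv a b) sub Ai.
have Aphi : mxintegrable `[a, b] (fun r => A r *m phi r).
  exact: mxintegrable_mul_bounded.
have phii : mu.-integrable `[a, b] (EFin \o (fun r => l1norm (phi r))).
  have [mphi [M phiM]] := phib.
  apply: (@bounded_itv_integrable R T _ _ M) => //; first exact: measurable_l1norm.
  by move=> t abt; rewrite ger0_norm ?l1norm_ge0// phiM.
apply: (le_trans (le_l1norm_mxint (mitv a b) Aphi)).
rewrite -RintegralZl//; apply: ae_le_Rintegral => //.
- exact: mxintegrable_l1norm.
- exact: integrable_RZ.
- by move=> t _; exact: l1norm_ge0.
- by move=> t _; rewrite mulr_ge0 ?l1norm_ge0.
apply: aeS AC => t At abt; apply: (le_trans (ler_l1normM _ _)).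
by rewrite ler_wpM2r ?l1norm_ge0// At//; exact: sub.
Qed.

(** The norm of a solution satisfies [gronwall] with a = l1norm V. The elapsed time t - s is then
    replaced by T to get a bound independent of s and t. *)
Lemma volterra_bound p (V : 'M[R]_(n, p)) (phi : R -> 'M[R]_(n, p)) s :
  0 <= s -> mxbounded `[s, T] phi ->
  (forall t, s <= t <= T -> phi t = V + mxint `[s, t] (fun r => A r *m phi r)) ->
  forall t, s <= t <= T ->
  l1norm (phi t) <= 2 * l1norm V * expR ((2 * C + 1) * T).
Proof.
move=> s0 phib phiE t stT; have [mphi [M phiM]] := phib.
have phii : mu.-integrable `[s, T] (EFin \o (fun r => l1norm (phi r))).
  apply: (@bounded_itv_integrable R T _ _ M) => //.
  - by apply: subset_itvr; rewrite bnd_simp.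
  - exact: measurable_l1norm.
  - by move=> r sTr; rewrite ger0_norm ?l1norm_ge0// phiM.
apply: (@le_trans _ _ (2 * l1norm V * expR ((2 * C + 1) * (t - s)))).
  apply: (@gronwall _ s T _ _ (fun r => l1norm (phi r))) => //.
  - by exists M => r srT; apply: phiM; rewrite /= in_itv.
  - by move=> r _; exact: l1norm_ge0.
  - move=> r srT; rewrite {1}phiE//; apply: (le_trans (ler_l1normD _ _)).
    rewrite lerD2l; apply: l1norm_mxint_mulmx => //; first by case/andP: srT.
    apply: mxboundedS phib => //; apply: subset_itvl; rewrite bnd_simp.
    by case/andP: srT.
rewrite ler_wpM2l ?mulr_ge0 ?l1norm_ge0// ler_expR ler_wpM2l//; first by have := C0; lra.
by case/andP: stT => *; lra.
Qed.

(** The difference solves the equation with V = 0, for which [volterra_bound] gives the bound 0. *)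
Lemma volterra_unique p (V : 'M[R]_(n, p)) (phi psi : R -> 'M[R]_(n, p)) :
  mxbounded `[0, T] phi -> mxbounded `[0, T] psi ->
  (forall t, 0 <= t <= T -> phi t = V + mxint `[0, t] (fun r => A r *m phi r)) ->
  (forall t, 0 <= t <= T -> psi t = V + mxint `[0, t] (fun r => A r *m psi r)) ->
  forall t, 0 <= t <= T -> phi t = psi t.
Proof.
move=> phib psib phiE psiE t tT; apply/eqP; rewrite -subr_eq0; apply/eqP.
apply: l1norm_eq0; rewrite -[leRHS](mul0r (expR ((2 * C + 1) * T))).
rewrite -(mulr0 2) -(@l1norm0 R n p).
apply: (@volterra_bound p 0 (fun t => phi t - psi t) 0) => //.
  exact: mxboundedB.
move=> r /[dup] rT /andP[r0 rleT].
have sub : `[0, r]%classic `<=` (`[0, T]%classic : set R).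
  by apply: subset_itvl; rewrite bnd_simp.
rewrite phiE// psiE// opprD addrACA subrr -mxintB//; last 2 first.
- apply: (mxintegrableS (mitv 0 T) (mitv 0 r) sub).
  exact: mxintegrable_mul_bounded.
- apply: (mxintegrableS (mitv 0 T) (mitv 0 r) sub).
  exact: mxintegrable_mul_bounded.
by congr (_ + _); apply: eq_mxint => s _; rewrite mulmxBr.
Qed.

End volterra.

Section volterra_right.
Context (R : realType) (T : R) (n : nat) (A : R -> 'M[R]_n) (C : R).
Notation mu := (@lebesgue_measure R).
Hypothesis C0 : 0 <= C.
Hypothesis Ai : mxintegrable `[0, T] A.
Hypothesis AC : {ae mu, forall t, `[0, T]%classic t -> l1norm (A t) <= C}.

(** Transposition exchanges left and right multiplication and preserves [l1norm]. The right-hand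
    form is the equation satisfied by the inverse of a fundamental matrix. *)
Lemma volterra_bound_right p (V : 'M[R]_(p, n)) (phi : R -> 'M[R]_(p, n)) :
  mxbounded `[0, T] phi ->
  (forall t, 0 <= t <= T -> phi t = V + mxint `[0, t] (fun r => phi r *m A r)) ->
  forall t, 0 <= t <= T ->
  l1norm (phi t) <= 2 * l1norm V * expR ((2 * C + 1) * T).
Proof.
move=> phib phiE t tT; rewrite -l1norm_tr -(l1norm_tr V).
apply: (@volterra_bound R T n (fun t => (A t)^T) C C0 _ _ _ V^T
  (fun t => (phi t)^T) 0) => //.
- exact: mxintegrable_tr.
- by apply: aeS AC => s As sT; rewrite l1norm_tr As.
- exact: mxbounded_tr.
move=> r rT; rewrite {1}phiE// linearD/= -mxint_tr; congr (_ + _).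
by apply: eq_mxint => s _; rewrite trmx_mul.
Qed.

End volterra_right.

(** * Measurable dependence of the inverse matrix *)

Section measurable_inverse.
Context d (T : measurableType d) (R : realType) (D : set T).
Hypothesis mD : measurable D.

Lemma measurable_det n (f : T -> 'M[R]_n) :
  (forall i j, measurable_fun D (fun x => f x i j)) ->
  measurable_fun D (fun x => \det (f x)).
Proof.
move=> mf; apply: measurable_sum => s; apply: measurable_funM => //.
by apply: measurable_prod => i _; exact: mf.
Qed.

(** Inversion is continuous off 0 only, so the line is split into the point 0 and its open
    complement. *)
Lemma measurable_invr (f : T -> R) : measurable_fun D f ->
  measurable_fun D (fun x => (f x)^-1).
Proof.
move=> mf; apply: (measurableT_comp _ mf).
have m1 : measurable ([set 0] : set (measurableTypeR R)).
  exact: measurable_set1.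
have mC : measurable (~` [set 0] : set (measurableTypeR R)).
  exact: measurableC.
rewrite (_ : setT = [set 0] `|` ~` [set 0 : measurableTypeR R]); last by rewrite setUv.
apply/(measurable_funU _ m1 mC); split; first exact: measurable_fun_set1.
apply: open_continuous_measurable_fun.
  by rewrite openC; exact: closed_eq.
by move=> x /set_mem/= /eqP x0; exact: inv_continuous.
Qed.

(** On invertible matrices this is the inverse. Without the case distinction of [invmx], its entries
    are polynomials in the entries of M times the inverse of the determinant, hence visibly
    measurable. *)
Definition cofactor_inv n (M : 'M[R]_n) : 'M[R]_n := (\det M)^-1 *: \adj M.

Lemma cofactor_invE n (M N : 'M[R]_n) : M *m N = 1%:M -> cofactor_inv M = N.
Proof.
move=> MN; have [uM _] := mulmx1_unit MN.
by rewrite -[N](mulKmx uM) MN mulmx1 /invmx uM.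
Qed.

Lemma measurable_cofactor_inv n (f : T -> 'M[R]_n) :
  (forall i j, measurable_fun D (fun x => f x i j)) ->
  forall i j, measurable_fun D (fun x => cofactor_inv (f x) i j).
Proof.
move=> mf i j; rewrite (_ : (fun x => _) =
  (fun x => (\det (f x))^-1 * ((-1) ^+ (j + i) * \det (row' j (col' i (f x))))));
  last by apply/funext => x; rewrite !mxE.
apply: measurable_funM; first exact/measurable_invr/measurable_det.
apply: measurable_funM => //; apply: measurable_det => k l.
by rewrite (_ : (fun x => _) = (fun x => f x (lift j k) (lift i l)));
  [exact: mf|apply/funext => x; rewrite !mxE].
Qed.

End measurable_inverse.

(** * Transition matrices, their inverses and variation of constants *)

Section transition.
Context (R : realType) (T : R) (n : nat) (A : R -> 'M[R]_n) (C : R).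
Context (Phi : R -> R -> 'M[R]_n).
Notation mu := (@lebesgue_measure R).
Hypothesis T0 : 0 <= T.
Hypothesis C0 : 0 <= C.
Hypothesis Ai : mxintegrable `[0, T] A.
Hypothesis AC : {ae mu, forall t, `[0, T]%classic t -> l1norm (A t) <= C}.
Hypothesis PhiE : forall s, 0 <= s <= T ->
  (forall i j, {within `[0, T], continuous (fun t => Phi t s i j)}) /\
  forall t, 0 <= t <= T ->
    Phi t s = 1%:M + mxint_from_to s t (fun r => A r *m Phi r s).

Let mitv a b : measurable (`[a, b]%classic : set (measurableTypeR R)).
Proof. by []. Qed.

(** The bound of [volterra_bound] for the initial value V = 1, whose [l1norm] is n. *)
Definition transition_bound : R := 2 * n%:R * expR ((2 * C + 1) * T).

Lemma transition_bound_ge0 : 0 <= transition_bound.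
Proof. by rewrite /transition_bound !mulr_ge0 ?expR_ge0. Qed.

Lemma continuous_mxbounded p q (f : R -> 'M[R]_(p, q)) :
  (forall i j, {within `[0, T], continuous (fun t => f t i j)}) ->
  mxbounded `[0, T] f.
Proof.
move=> cf; split=> [i j|]; first (apply: subspace_continuous_measurable_fun; [|exact: cf]; by []).
have bnd i j : exists M, forall t, `[0, T]%classic t -> `|f t i j| <= M.
  have cptf : compact [set (f t i j : R^o) | t in `[0, T]%classic].
    by apply: continuous_compact (cf i j) _; exact: segment_compact.
  have [M [_ fM]] := compact_bounded cptf.
  exists (M + 1) => t Tt; apply: (fM (M + 1)); first by rewrite ltrDl.
  by exists t.
have /choice[N fN] : forall ij : 'I_p * 'I_q,
    exists M, forall t, `[0, T]%classic t -> `|f t ij.1 ij.2| <= M.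
  by move=> ij; exact: bnd.
exists (\sum_i \sum_j N (i, j)) => t tT.
by apply: ler_sum => i _; apply: ler_sum => j _; exact: (fN (i, j)).
Qed.

Lemma transition_mxbounded s : 0 <= s <= T -> mxbounded `[0, T] (fun t => Phi t s).
Proof. by move=> /PhiE[cPhi _]; exact: continuous_mxbounded. Qed.

Lemma integrable_mulA p (f : R -> 'M[R]_(n, p)) : mxbounded `[0, T] f ->
  mxintegrable `[0, T] (fun r => A r *m f r).
Proof. by move=> fb; exact: mxintegrable_mul_bounded. Qed.

Lemma mxint_split p q (f : R -> 'M[R]_(p, q)) s t :
  mxintegrable `[0, T] f -> 0 <= s -> s <= t -> t <= T ->
  mxint `[0, t] f = mxint `[0, s] f + mxint `[s, t] f.
Proof.
move=> fi s0 st tT; apply/matrixP => i j; rewrite !mxE.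
have fit : mu.-integrable `[0, t] (EFin \o (fun r => f r i j)).
  by apply: integrableS (fi i j) => //; apply: subset_itvl; rewrite bnd_simp.
have fist : mu.-integrable `]s, t] (EFin \o (fun r => f r i j)).
  by apply: integrableS fit => //; apply: subset_itvr; rewrite bnd_simp.
have := @Rintegral_itvB _ _ _ _ s fit; rewrite !bnd_simp => /(_ s0 st).
by rewrite Rintegral_itv_obnd_cbnd// => <-; rewrite addrC subrK.
Qed.

(** Of the two intervals of the oriented integral, one is empty or reduced to a point; the other is
    a difference of integrals from 0. *)
Lemma mxint_from_toE p q (f : R -> 'M[R]_(p, q)) s t :
  mxintegrable `[0, T] f -> 0 <= s <= T -> 0 <= t <= T ->
  mxint_from_to s t f = mxint `[0, t] f - mxint `[0, s] f.
Proof.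
move=> fi /andP[s0 sT] /andP[t0 tT].
have itv1 a b : b <= a -> mxint `[a, b] f = 0.
  move=> ba; apply/matrixP => i j; rewrite !mxE.
  rewrite /Rintegral (@integral_Sset1 _ _ _ a)// => x /=.
  by rewrite in_itv/= => /andP[ax xb]; apply/eqP; rewrite eq_le ax (le_trans xb).
rewrite /mxint_from_to; have [st|/ltW ts] := leP s t.
  by rewrite (mxint_split fi s0 st tT) (itv1 t s)// subr0 addrC addKr.
by rewrite (mxint_split fi t0 ts sT) (itv1 s t)// sub0r opprD addNKr.
Qed.

(** Restricted to s <= t because the Volterra estimate runs forward from time s. The backward case
    from t to 0 is [transition_inv_bound]. *)
Lemma transition_fwd_bound s t : 0 <= s -> s <= t -> t <= T ->
  l1norm (Phi t s) <= transition_bound.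
Proof.
move=> s0 st tT; have sT : 0 <= s <= T by rewrite s0 (le_trans st).
rewrite /transition_bound -(@l1norm1 R n).
have Phib := transition_mxbounded sT.
apply: (@volterra_bound R T n A C C0 Ai AC n 1%:M (fun t => Phi t s) s) => //.
- by apply: mxboundedS Phib => //; apply: subset_itvr; rewrite bnd_simp.
- move=> r /andP[sr rT]; have [_ PE] := PhiE sT.
  have APi := integrable_mulA Phib.
  have r0T : 0 <= r <= T by rewrite rT (le_trans s0).
  rewrite PE// mxint_from_toE//.
  by congr (_ + _); rewrite (mxint_split APi s0 sr rT) addrC addKr.
- by apply/andP; split.
Qed.

Lemma transition_id s : 0 <= s <= T -> Phi s s = 1%:M.
Proof.
move=> sT; have [_ ->//] := PhiE sT.
by rewrite /mxint_from_to subrr addr0.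
Qed.

(** Moves the origin of the equation from s to 0, where [volterra_unique] applies on all of
    [[0, T]]. *)
Lemma transition_from s t : 0 <= s <= T -> 0 <= t <= T ->
  Phi t s = Phi 0 s + mxint `[0, t] (fun r => A r *m Phi r s).
Proof.
move=> sT tT; have [_ PE] := PhiE sT.
have APi := integrable_mulA (transition_mxbounded sT).
have z0 : 0 <= (0 : R) <= T by apply/andP; split.
rewrite (PE 0)// (PE t)// !mxint_from_toE//.
have -> : mxint `[0, 0] (fun r => A r *m Phi r s) = 0.
  apply/matrixP => i j; rewrite !mxE.
  by rewrite /Rintegral set_itv1 integral_set1.
by rewrite sub0r addrAC addrA.
Qed.

(** As functions of t, both sides solve the same Volterra equation with value Phi(0, s) at time
    0. *)
Lemma transition_mul s t : 0 <= s <= T -> 0 <= t <= T ->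
  Phi t s = Phi t 0 *m Phi 0 s.
Proof.
move=> sT tT; have z0 : 0 <= (0 : R) <= T by apply/andP; split.
apply: (@volterra_unique R T n A C C0 Ai AC n (Phi 0 s) (fun t => Phi t s)
  (fun t => Phi t 0 *m Phi 0 s)) => //.
- exact: transition_mxbounded.
- apply: mxbounded_mul => //; first exact: transition_mxbounded.
  exact: mxbounded_cst.
- by move=> r rT; exact: transition_from.
move=> r rT; rewrite {1}transition_from// transition_id// mulmxDl mul1mx.
rewrite -mxint_mulr//.
  by congr (_ + _); apply: eq_mxint => q _; rewrite mulmxA.
apply: (mxintegrableS (mitv 0 T) (mitv 0 r)).
  by apply: subset_itvl; rewrite bnd_simp; case/andP: rT.
exact: integrable_mulA (transition_mxbounded _).
Qed.

Lemma transition_mulV s : 0 <= s <= T -> Phi s 0 *m Phi 0 s = 1%:M.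
Proof. by move=> sT; rewrite -transition_mul// transition_id. Qed.

Lemma transition_mulVV s : 0 <= s <= T -> Phi 0 s *m Phi s 0 = 1%:M.
Proof. by move=> sT; apply/mulmx1C/transition_mulV. Qed.

(** Here the time varies in the second argument of Phi, about which [PhiE] says nothing directly.
    Measurability comes from inverting Phi(t, 0) by cofactors, boundedness from Phi(0, t) = Phi(0,
    T) Phi(T, t). The bound still contains Phi(0, T); [transition_inv_bound] improves it to a
    uniform one. *)
Lemma transition_inv_mxbounded : mxbounded `[0, T] (Phi 0).
Proof.
have z0 : 0 <= (0 : R) <= T by apply/andP; split.
split=> [i j|].
  apply: (eq_measurable_fun (fun t => cofactor_inv (Phi t 0) i j)).
    by move=> t; rewrite inE/= in_itv/= => tT; rewrite (cofactor_invE (transition_mulV tT)).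
  apply: measurable_cofactor_inv => // k l.
  have [mP _] := transition_mxbounded z0; exact: mP.
exists (l1norm (Phi 0 T) * transition_bound) => t; rewrite /= in_itv/= => tT.
have TT : 0 <= T <= T by apply/andP; split.
have -> : Phi 0 t = Phi 0 T *m Phi T t.
  by rewrite (transition_mul tT TT) mulmxA transition_mulVV// mul1mx.
apply: le_trans (ler_l1normM _ _) _; rewrite ler_wpM2l ?l1norm_ge0//.
by apply: transition_fwd_bound => //; case/andP: tT.
Qed.

Lemma integrable_inv_mul p (f : R -> 'M[R]_(n, p)) : mxintegrable `[0, T] f ->
  mxintegrable `[0, T] (fun r => Phi 0 r *m f r).
Proof.
by apply: mxintegrable_bounded_mul => //; exact: transition_inv_mxbounded.
Qed.

(* [E t], the error in the claimed equation multiplied by [Phi t 0], solves a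
   homogeneous linear Volterra equation. *)
Lemma transition_inv_eq t : 0 <= t <= T ->
  Phi 0 t = 1%:M - mxint `[0, t] (fun r => Phi 0 r *m A r).
Proof.
have z0 : 0 <= (0 : R) <= T by apply/andP; split.
have Psib := transition_mxbounded z0; have Lb := transition_inv_mxbounded.
have LAi := integrable_inv_mul Ai.
pose NA r := - (Phi 0 r *m A r).
have NAi : mxintegrable `[0, T] NA by exact: mxintegrableN.
pose L' t := 1%:M + mxint `[0, t] NA.
have L'b : mxbounded `[0, T] L' by exact: mxprimitive_bounded.
pose E t := (L' t - Phi 0 t) *m Phi t 0.
have Eb : mxbounded `[0, T] E by apply: mxbounded_mul => //; exact: mxboundedB.
have sub r : 0 <= r <= T -> `[0, r]%classic `<=` (`[0, T]%classic : set R).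
  by case/andP => _ rT; apply: subset_itvl; rewrite bnd_simp.
(* Since E = L' Phi(., 0) - 1, formally E' = (L' - Phi(0, .)) A Phi(., 0) = E A' with A' the
   conjugate of A by Phi. *)
pose A' r := Phi 0 r *m A r *m Phi r 0.
have A'i : mxintegrable `[0, T] A' by exact: mxintegrable_mul_bounded.
have EE r : 0 <= r <= T -> E r = 0 + mxint `[0, r] (fun q => E q *m A' q).
  move=> rT; rewrite /E mulmxBl transition_mulVV//.
  rewrite {1}(transition_from z0 rT) transition_id//.
  have rleT : r <= T by case/andP: rT.
  rewrite (mxprimitive_mul _ _ rleT NAi (integrable_mulA Psib)) mulmx1.
  rewrite addrC addKr add0r; apply: eq_mxint => q qr.
  have qT : 0 <= q <= T.
    move: qr; rewrite /= in_itv/= => /andP[q0 qr].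
    by apply/andP; split=> //; exact: le_trans qr rleT.
  rewrite -{1}(transition_id z0) -transition_from//.
  rewrite /A' -!mulmxA (mulmxA (Phi q 0)) transition_mulV// mul1mx.
  by rewrite mulNmx mulmxBl -!mulmxA addrC.
have [[_ [M LM]] [_ [N PsiN]]] := (Lb, Psib).
have mem0 : `[0, T]%classic 0 by rewrite /= in_itv.
have M0 : 0 <= M by apply: le_trans (LM _ mem0); exact: l1norm_ge0.
have N0 : 0 <= N by apply: le_trans (PsiN _ mem0); exact: l1norm_ge0.
have MCN : 0 <= M * C * N by rewrite !mulr_ge0.
(* Any finite bound of A' serves, because the initial value of E is 0. *)
have A'M : {ae mu, forall t, `[0, T]%classic t -> l1norm (A' t) <= M * C * N}.
  apply: aeS AC => r Ar rT; apply: le_trans (ler_l1normM _ _) _.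
  rewrite ler_pM ?l1norm_ge0// ?PsiN//; apply: le_trans (ler_l1normM _ _) _.
  by rewrite ler_pM ?l1norm_ge0// ?LM// Ar.
move=> tT; have E0 : E t = 0.
  apply: l1norm_eq0.
  have := volterra_bound_right MCN A'i A'M Eb EE tT.
  by rewrite l1norm0 mulr0 mul0r.
have L'L : L' t - Phi 0 t = 0.
  by rewrite -[LHS]mulmx1 -(transition_mulV tT) mulmxA -/(E t) E0 mul0mx.
have /eqP := L'L; rewrite subr_eq0 => /eqP <-; rewrite /L' mxintN//.
case/andP: tT => t0 tT; apply: (mxintegrableS (mitv 0 T) (mitv 0 t)) LAi.
by apply: subset_itvl; rewrite bnd_simp.
Qed.

(** By [transition_inv_eq], Phi(0, t) solves a right Volterra equation with kernel - A and initial
    value 1, so the constant is that of the forward bound, uniform in the parameter. *)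
Lemma transition_inv_bound t : 0 <= t <= T -> l1norm (Phi 0 t) <= transition_bound.
Proof.
move=> tT; rewrite /transition_bound -(@l1norm1 R n).
have NAi : mxintegrable `[0, T] (fun r => - A r) by exact: mxintegrableN.
have NAC : {ae mu, forall t, `[0, T]%classic t -> l1norm (- A t) <= C}.
  by apply: aeS AC => r Ar rT; rewrite l1normN Ar.
apply: (@volterra_bound_right R T n _ C C0 NAi NAC n 1%:M (Phi 0)) => //.
  exact: transition_inv_mxbounded.
move=> r /[dup] r0T /andP[_ rT]; rewrite {1}transition_inv_eq// -mxintN//.
  by congr (_ + _); apply: eq_mxint => q _; rewrite mulmxN.
apply: (mxintegrableS (mitv 0 T) (mitv 0 r)); last exact: integrable_inv_mul.
by apply: subset_itvl; rewrite bnd_simp.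
Qed.

Let sub t : 0 <= t <= T -> `[0, t]%classic `<=` (`[0, T]%classic : set R).
Proof. by case/andP => _ rT; apply: subset_itvl; rewrite bnd_simp. Qed.

Let primitive_inv t : 0 <= t <= T ->
  Phi 0 t = 1%:M + mxint `[0, t] (fun r => - (Phi 0 r *m A r)).
Proof.
move=> tT; rewrite transition_inv_eq// mxintN//.
by apply: (mxintegrableS (mitv 0 T) (mitv 0 t) (sub tT)); exact: integrable_inv_mul.
Qed.

Let inv_mulAN : mxintegrable `[0, T] (fun r => - (Phi 0 r *m A r)).
Proof. by apply: mxintegrableN => //; exact: integrable_inv_mul. Qed.

Let in_segment t r : 0 <= t <= T -> `[0, t]%classic r -> 0 <= r <= T.
Proof. by move=> tT rt; have := sub tT rt; rewrite /= in_itv. Qed.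

Lemma transition_inv_mul_primitive p (x : 'M[R]_(n, p)) (f : R -> 'M[R]_(n, p)) t :
  mxintegrable `[0, T] f -> 0 <= t <= T ->
  Phi 0 t *m (x + mxint `[0, t] f) =
  x + mxint `[0, t] (fun s => Phi 0 s *m f s -
                              Phi 0 s *m A s *m (x + mxint `[0, s] f)).
Proof.
move=> fi tT; rewrite {1}primitive_inv//.
rewrite (mxprimitive_mul _ _ _ inv_mulAN fi); last by case/andP: tT.
rewrite mul1mx; congr (_ + _); apply: eq_mxint => s st.
by rewrite -primitive_inv ?(in_segment tT st)// addrC mulNmx.
Qed.

(** The path Y need not be differentiable: V = X - Y is a primitive of A X + g, and the product rule
    for Phi(0, .) V leaves the integrand Phi(0, .) g + Phi(0, .) A (X - V), where X - V = Y. *)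
Lemma variation_of_constants p (x : 'M[R]_(n, p)) (X g Y : R -> 'M[R]_(n, p)) t :
  mxbounded `[0, T] X -> mxintegrable `[0, T] g ->
  (forall t, 0 <= t <= T -> Y t =
    X t - x - mxint `[0, t] (fun r => A r *m X r) - mxint `[0, t] g) ->
  0 <= t <= T ->
  Phi 0 t *m X t = x + mxint `[0, t] (fun r => Phi 0 r *m g r) +
    (Phi 0 t *m Y t + mxint `[0, t] (fun r => Phi 0 r *m A r *m Y r)).
Proof.
move=> Xb gi YE tT; have AXi := integrable_mulA Xb.
have fi := mxintegrableD (mitv 0 T) AXi gi.
have XE s : 0 <= s <= T ->
    X s = x + mxint `[0, s] (fun r => A r *m X r + g r) + Y s.
  move=> sT; have S := mxintegrableS (mitv 0 T) (mitv 0 s) (sub sT).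
  rewrite YE// mxintD//; [|exact: S|exact: S].
  set a := mxint _ _; set c := mxint _ _.
  have -> : X s - x - a - c = X s - (x + (a + c)) by rewrite !opprD !addrA.
  by rewrite addrC subrK.
have LYb : mxintegrable `[0, T] (fun r => Phi 0 r *m A r *m Y r).
  apply: mxintegrable_mul_bounded; [by []|exact: integrable_inv_mul|].
  have Vb := mxprimitive_bounded x fi.
  have [mXV [M XVM]] := mxboundedB Xb Vb.
  (* Y inherits measurability and boundedness on [[0, T]] from the difference of X and a
     primitive. *)
  have YE' s : `[0, T]%classic s -> (X s - (x + mxint `[0, s] (fun r => A r *m X r + g r))) = Y s.
    by rewrite /= in_itv/= => sT; rewrite (XE s sT) addrC addKr.
  split; last by exists M => s sT; rewrite -YE'//; exact: XVM.
  move=> i j; apply: eq_measurable_fun (mXV i j) => s /set_mem sT.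
  by rewrite YE'.
have S p' q' f := @mxintegrableS R _ _ p' q' f (mitv 0 T) (mitv 0 t) (sub tT).
rewrite {1}(XE t tT) mulmxDr transition_inv_mul_primitive//.
have -> : mxint `[0, t] (fun s => Phi 0 s *m (A s *m X s + g s) -
      Phi 0 s *m A s *m (x + mxint `[0, s] (fun r => A r *m X r + g r))) =
    mxint `[0, t] (fun r => Phi 0 r *m g r) +
    mxint `[0, t] (fun r => Phi 0 r *m A r *m Y r).
  rewrite -mxintD//; [|exact/S/integrable_inv_mul|exact: S].
  apply: eq_mxint => s st; rewrite mulmxDr mulmxA.
  rewrite {1}(XE s (in_segment tT st)) mulmxDr.
  by rewrite addrAC [X in X - _]addrC addrK addrC.
by rewrite -!addrA; congr (_ + (_ + _)); rewrite addrC.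
Qed.

(** The left side is what E[zeta(T) Y(t)'] becomes once E[Y(s) Y(t)'] is known to be the integral of
    S over [[0, min s t]]. After time t that integral is constant and Phi(0, .) A integrates to
    Phi(0, t) - Phi(0, T); before t the product rule applies. *)
Lemma mxint_min_primitive (S : R -> 'M[R]_n) t : mxintegrable `[0, T] S ->
  0 <= t <= T ->
  Phi 0 T *m mxint `[0, t] S +
  mxint `[0, T] (fun s => Phi 0 s *m A s *m mxint `[0, Num.min s t] S) =
  mxint `[0, t] (fun s => Phi 0 s *m S s).
Proof.
move=> Si /[dup] tT /andP[t0 tleT].
have TT : 0 <= T <= T by apply/andP; split.
have LAi := integrable_inv_mul Ai; have Qb := mxprimitive_bounded0 Si.
have LAQi := mxintegrable_mul_bounded (mitv 0 T) LAi Qb.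
have minb : mxbounded `[0, T] (fun s => mxint `[0, Num.min s t] S).
  split=> [i j|]; last first.
    case: Qb => _ [M QM]; exists M => s; rewrite /= in_itv/= => /andP[s0 sT].
    by apply: QM; rewrite /= in_itv/= le_min s0 t0 ge_min sT.
  have cQ := Rprimitive_continuous (Si i j).
  (* The primitive is known to be measurable on [[0, T]] only; its extension by 0 is measurable
     everywhere and can be composed with [Num.min]. *)
  pose Q' : R -> R := (fun s => \int[mu]_(r in `[0, s]) S r i j) \_ `[0, T].
  have mQ' : measurable_fun setT Q'.
    apply/(measurable_restrictT _ (mitv 0 T)).
    by apply: subspace_continuous_measurable_fun cQ.
  apply: (eq_measurable_fun (fun s : R => Q' (Num.min s t))).
    move=> s; rewrite inE/= in_itv/= => /andP[s0 sT].
    by rewrite /Q' patchE mem_set/= ?mxE// in_itv/= le_min s0 t0 ge_min sT.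
  apply: measurable_funTS; apply: measurableT_comp mQ' _.
  by apply: measurable_minr.
rewrite (mxint_split _ t0 tleT (lexx T)); last exact: mxintegrable_mul_bounded.
have -> : mxint `[0, t] (fun s => Phi 0 s *m A s *m mxint `[0, Num.min s t] S) =
    mxint `[0, t] (fun s => Phi 0 s *m A s *m mxint `[0, s] S).
  by apply: eq_mxint => s; rewrite /= in_itv/= => /andP[_ st]; rewrite min_l.
have -> : mxint `[t, T] (fun s => Phi 0 s *m A s *m mxint `[0, Num.min s t] S) =
    (Phi 0 t - Phi 0 T) *m mxint `[0, t] S.
  rewrite (transition_inv_eq tT) (transition_inv_eq TT).
  rewrite opprB addrC addrA subrK (mxint_split LAi t0 tleT (lexx T)) addrC addKr.
  have subt : `[t, T]%classic `<=` (`[0, T]%classic : set R).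
    by apply: subset_itvr; rewrite bnd_simp.
  have LAit := mxintegrableS (mitv 0 T) (mitv t T) subt LAi.
  rewrite -(mxint_mulr (mitv t T) (mxint `[0, t] S) LAit).
  by apply: eq_mxint => s; rewrite /= in_itv/= => /andP[ts _]; rewrite min_r.
rewrite addrCA -mulmxDl [X in X *m _]addrC subrK.
have := transition_inv_mul_primitive 0 Si tT; rewrite !add0r => ->.
have res p' q' f := @mxintegrableS R _ _ p' q' f (mitv 0 T) (mitv 0 t) (sub tT).
have LSi := integrable_inv_mul Si.
rewrite -(mxintD (mitv 0 t) (res _ _ _ LAQi)); last first.
  apply: res; apply: (mxintegrableB (mitv 0 T) LSi).
  by under [X in mxintegrable _ X]eq_fun do rewrite add0r.
by apply: eq_mxint => s _; rewrite add0r addrC subrK.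
Qed.

(** Integration by parts for P(s) = int_0^s Phi(0, r) S(r) dr against Phi(0, s)', whose derivative
    is - (Phi(0, s) A(s))'. It turns the covariance of zeta(T) with itself into a single
    integral. *)
Lemma mxint_covariance (S : R -> 'M[R]_n) : mxintegrable `[0, T] S ->
  mxint `[0, T] (fun s => Phi 0 s *m S s) *m (Phi 0 T)^T +
  mxint `[0, T] (fun s => mxint `[0, s] (fun r => Phi 0 r *m S r) *m
                          (Phi 0 s *m A s)^T) =
  mxint `[0, T] (fun s => Phi 0 s *m S s *m (Phi 0 s)^T).
Proof.
move=> Si; have TT : 0 <= T <= T by apply/andP; split.
have LSi := integrable_inv_mul Si; have Pb := mxprimitive_bounded0 LSi.
have LA'i := mxintegrable_tr (mitv 0 T) inv_mulAN.
have LE t : 0 <= t <= T ->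
    (Phi 0 t)^T = 1%:M + mxint `[0, t] (fun r => (- (Phi 0 r *m A r))^T).
  by move=> tT; rewrite mxint_tr -[1%:M]trmx1 -linearD/= -primitive_inv.
have N'i : mxintegrable `[0, T] (fun s => (Phi 0 s *m A s)^T).
  exact (mxintegrable_tr (mitv 0 T) (integrable_inv_mul Ai)).
have PNi := mxintegrable_bounded_mul (mitv 0 T) Pb N'i.
have P0b := mxprimitive_bounded 0 LSi.
have L1b := mxprimitive_bounded 1%:M LA'i.
have i1 := mxintegrable_mul_bounded (mitv 0 T) LSi L1b.
have i2 := mxintegrable_bounded_mul (mitv 0 T) P0b LA'i.
rewrite {1}(LE T TT) -[X in X *m _]add0r.
rewrite (mxprimitive_mul _ _ (lexx T) LSi LA'i) mul0mx add0r.
rewrite -(mxintD (mitv 0 T) (mxintegrableD (mitv 0 T) i1 i2) PNi).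
apply: eq_mxint => s sT; rewrite -LE ?(in_segment TT sT)// add0r.
by rewrite -addrA -mulmxDr linearN addNr mulmx0 addr0.
Qed.

End transition.

(** * Covariance of Brownian increments *)

Section normal_moments.
Context (R : realType).
Notation mu := (@lebesgue_measure R).

(** The Radon-Nikodym derivative of the normal law and the density have the same integral over every
    measurable set, so they agree almost everywhere. *)
Lemma ge0_integral_normal_prob (m s : R) (f : R -> \bar R) :
  (forall x, (0 <= f x)%E) -> measurable_fun setT f ->
  (\int[normal_prob m s]_x f x =
   \int[mu]_x (f x * (normal_pdf m s x)%:E))%E.
Proof.
move=> f0 mf; have dom := @normal_prob_dominates R m s.
rewrite -(Radon_Nikodym_SigmaFinite.change_of_variables dom f0 measurableT mf).
have RNi := Radon_Nikodym_SigmaFinite.f_integrable dom.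
have mRN := measurable_int _ RNi.
have mpdf : measurable_fun setT (fun x => (normal_pdf m s x)%:E).
  by apply/measurable_EFinP; exact: measurable_normal_pdf.
apply: ae_eq_integral => //; [exact: emeasurable_funM..|].
apply: ae_eqe_mul2l; apply: integral_ae_eq => // E _ mE.
by rewrite -(Radon_Nikodym_SigmaFinite.f_integral dom).
Qed.

Context (s : R).
Hypothesis s0 : 0 < s.
Let e := normal_pdf 0 s.

Let sN0 : s != 0. Proof. by rewrite gt_eqF. Qed.

Let eE x : e x = normal_peak s * expR (- x ^+ 2 / (s ^+ 2 *+ 2)).
Proof. by rewrite /e normal_pdfE// /normal_fun subr0. Qed.

Let e_even x : e (- x) = e x.
Proof. by rewrite !eE sqrrN. Qed.

Let e_ge0 x : 0 <= e x. Proof. exact: normal_pdf_ge0. Qed.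

Let ce : continuous e. Proof. exact: continuous_normal_pdf. Qed.

Let de (x : R^o) : is_derive x 1 (e : R^o -> R^o) (- (x / s ^+ 2) * e x).
Proof.
pose c : R := - (s ^+ 2 *+ 2)^-1.
have dq : is_derive x (1 : R^o) (fun x : R^o => c *: x ^+ 2 : R^o) (c * (2 * x)).
  by apply: is_derive_eq; rewrite /GRing.scale/=; ring.
have dE := @is_derive1_comp R expR (fun x : R^o => c *: x ^+ 2 : R^o) x _ _
  (is_derive_expR _) dq.
have -> : (e : R^o -> R^o) =
    normal_peak s \*: ((expR : R^o -> R^o) \o (fun x : R^o => c *: x ^+ 2 : R^o)).
  apply/funext => y; rewrite eE /= /GRing.scale/=; congr (_ * expR _).
  by rewrite /c; field.
rewrite (_ : - _ * _ = normal_peak s *: (expR (c *: x ^+ 2) * (c * (2 * x)))).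
  exact: (@is_deriveZ R R^o R^o _ (normal_peak s) x 1 _ dE).
rewrite /= /GRing.scale/=; by set E := expR _; rewrite /c; field.
Qed.

(** An explicit primitive of x^2 e - s^2 e: over an interval the two terms have the same integral up
    to a boundary term. *)
Let dH (x : R^o) : is_derive x 1 (fun x : R^o => - s ^+ 2 * (x * e x) : R^o)
  (x ^+ 2 * e x - s ^+ 2 * e x).
Proof.
have d1 := @is_deriveM R R^o id e x 1 _ _ (is_derive_id _ _) (de x).
have d2 := @is_deriveZ R R^o R^o _ (- s ^+ 2) x 1 _ d1.
by apply: is_derive_eq d2 _; rewrite /GRing.scale/=; field.
Qed.

Let sqr_integral n : (0 < n)%N ->
  (\int[mu]_(x in `[0%R, n%:R]) (x ^+ 2 * e x)%:E =
   (s ^+ 2)%:E * \int[mu]_(x in `[0%R, n%:R]) (e x)%:E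
   - (s ^+ 2 * (n%:R * e n%:R))%:E)%E.
Proof.
move=> n0; pose H (x : R^o) : R^o := - s ^+ 2 * (x * e x).
have n0R : 0 < n%:R :> R by rewrite ltr0n.
have ce' : {within `[0, n%:R], continuous e} by exact: continuous_subspaceT.
have cx2e : continuous (fun x : R => x ^+ 2 * e x).
  by move=> x; apply: cvgM; [exact: sqr_continuous|exact: ce].
have cs2e : continuous (fun x : R => s ^+ 2 * e x).
  by move=> x; apply: cvgM; [exact: cvg_cst|exact: ce].
have dHx (x : R^o) : is_derive x 1 H (x ^+ 2 * e x - s ^+ 2 * e x) by exact: dH.
have cH : continuous H.
  by move=> x; apply/differentiable_continuous/derivable1_diffP.
have itI (f : R -> R) : continuous f -> mu.-integrable `[0, n%:R] (EFin \o f).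
  move=> cf; apply: continuous_compact_integrable; first exact: segment_compact.
  exact: continuous_subspaceT.
have := @continuous_FTC2 R (fun x : R => x ^+ 2 * e x - s ^+ 2 * e x) H 0 n%:R n0R.
have H0 : H 0 = 0 by rewrite /H mul0r mulr0.
have Hn : H n%:R = - (s ^+ 2 * (n%:R * e n%:R)) by rewrite /H mulNr.
rewrite H0 Hn sube0 => FTC.
have : (\int[mu]_(x in `[0%R, n%:R]) (x ^+ 2 * e x - s ^+ 2 * e x)%:E =
    - (s ^+ 2 * (n%:R * e n%:R))%:E)%E.
  apply: FTC.
  - by apply: continuous_subspaceT => x; apply: cvgB; [exact: cx2e|exact: cs2e].
  - split; first by move=> x _.
    + by apply: cvg_at_right_filter; exact: cH.
    + by apply: cvg_at_left_filter; exact: cH.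
  - by move=> x _; rewrite derive1E; apply: derive_val.
under eq_integral do rewrite EFinB.
rewrite integralB_EFin//; [|exact: itI..].
under [X in (_ - X)%E = _ -> _]eq_integral do rewrite EFinM.
rewrite integralZl//; last exact: itI.
move=> /(congr1 (fun x => x + (s ^+ 2)%:E * \int[mu]_(x in `[0%R, n%:R]) (e x)%:E)%E).
rewrite subeK; first by rewrite addeC.
by apply: fin_numM => //; apply: integrable_fin_num => //; exact: itI.
Qed.

(** The boundary term at n vanishes: with y = n^2 / (2 s^2), exp(- y) <= 1 / y makes it of order 1 /
    n. *)
Let cvg_xe : (s ^+ 2 * (n%:R * e n%:R))%:E @[n --> \oo] --> (0 : \bar R).
Proof.
apply: cvg_EFin; first exact: nearW.
apply: (@squeeze_cvgr _ _ _ _ (fun=> 0)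
  (fun n => (normal_peak s * s ^+ 4 *+ 2) * n%:R^-1)).
- near=> n; have n0 : 0 < n%:R :> R by rewrite ltr0n; near: n; exact: nbhs_infty_gt.
  have np : normal_peak s >= 0 by exact: normal_peak_ge0.
  have s2 : 0 < s ^+ 2 by rewrite exprn_gt0.
  apply/andP; split.
    by apply: mulr_ge0; [exact: sqr_ge0|apply: mulr_ge0 => //; exact: ltW].
  set y := n%:R ^+ 2 / (s ^+ 2 *+ 2).
  have y0 : 0 < y by rewrite divr_gt0 ?exprn_gt0// pmulrn_lgt0.
  have ey : expR (- y) <= y^-1.
    rewrite expRN lef_pV2 ?posrE ?expR_gt0//.
    by apply: le_trans (expR_ge1Dx _); rewrite lerDr.
  rewrite /= eE mulNr -/y.
  have -> : normal_peak s * s ^+ 4 *+ 2 * n%:R^-1 =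
      s ^+ 2 * (n%:R * (normal_peak s * y^-1)).
    by rewrite /y; field; rewrite sN0 gt_eqF.
  by rewrite ler_wpM2l ?sqr_ge0// ler_wpM2l// ler_wpM2l.
- exact: cvg_cst.
- rewrite -[0](mulr0 (normal_peak s * s ^+ 4 *+ 2)).
  apply: cvgM; first exact: cvg_cst.
  have h : (n%:R^-1 : R) @[n --> \oo] --> (0 : R).
    by rewrite -cvg_shiftS; exact: cvg_harmonic.
  exact: h.
Unshelve. all: by end_near. Qed.

Let integral_sqr_half :
  (\int[mu]_(x in `[0%R, +oo[) (x ^+ 2 * e x)%:E =
   (s ^+ 2)%:E * \int[mu]_(x in `[0%R, +oo[) (e x)%:E)%E.
Proof.
have me : measurable_fun setT e by exact: measurable_normal_pdf.
have h1 := @ge0_cvgn_integral R mu e e_ge0 me.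
have h2 : (\int[mu]_(x in `[0%R, n%:R]) (x ^+ 2 * e x)%:E @[n --> \oo] -->
    \int[mu]_(x in `[0%R, +oo[) (x ^+ 2 * e x)%:E)%E.
  apply: ge0_cvgn_integral => [x|]; first by rewrite mulr_ge0 ?sqr_ge0.
  by apply: measurable_funM => //; exact: exprn_measurable.
have ei : mu.-integrable `[0, +oo[ (EFin \o e).
  by apply: integrableS (integrable_normal_pdf 0 s).
have h3 : ((s ^+ 2)%:E * \int[mu]_(x in `[0%R, n%:R]) (e x)%:E
   - (s ^+ 2 * (n%:R * e n%:R))%:E @[n --> \oo] -->
   (s ^+ 2)%:E * \int[mu]_(x in `[0%R, +oo[) (e x)%:E - 0)%E.
  apply: cvgeB; last exact: cvg_xe.
    by rewrite fin_num_adde_defl.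
  by apply: cvgeZl.
rewrite sube0 in h3; apply: cvg_unique h2 _ => //.
apply: cvg_trans h3; apply: near_eq_cvg; near=> n.
by rewrite sqr_integral//; near: n; exact: nbhs_infty_gt.
Unshelve. all: by end_near. Qed.

(** Evenness reduces both the second moment and the total mass to the half-line, where
    [integral_sqr_half] makes them proportional with ratio s^2. *)
Lemma normal_second_moment :
  (\int[mu]_x (x ^+ 2 * normal_pdf 0 s x)%:E = (s ^+ 2)%:E)%E.
Proof.
rewrite -/e ge0_symfun_integralT; first last.
- by move=> x; rewrite /= sqrrN e_even.
- by move=> x; apply: cvgM; [exact: sqr_continuous|exact: ce].
- by move=> x; rewrite mulr_ge0 ?sqr_ge0.
rewrite -set_itvcy integral_sqr_half muleCA.
have := integral_normal_pdf (0 : R) s.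
rewrite -/e ge0_symfun_integralT -?set_itvcy => [->||//|]; rewrite ?mule1//.
by move=> x; rewrite /= e_even.
Qed.

Lemma integrable_normal_first_moment :
  mu.-integrable setT (EFin \o (fun x => x * normal_pdf 0 s x)).
Proof.
have me : measurable_fun setT e by exact: measurable_normal_pdf.
have x2i : mu.-integrable setT (EFin \o (fun x => x ^+ 2 * e x)).
  apply/integrableP; split.
    apply/measurable_EFinP; apply: measurable_funM me.
    exact: exprn_measurable.
  rewrite (@eq_integral _ _ _ mu setT (fun x : R => (x ^+ 2 * e x)%:E)).
    by have := normal_second_moment; rewrite -/e => ->; rewrite ltry.
  by move=> x _; rewrite /= ger0_norm// mulr_ge0 ?sqr_ge0.
apply: (le_Rintegrable measurableT _ _
  (integrable_RD measurableT x2i (integrable_normal_pdf 0 s))).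
  exact: measurable_funM.
move=> x _; rewrite normrM (ger0_norm (e_ge0 x)) -[X in _ + X]mul1r -mulrDl.
rewrite ler_wpM2r// -[in leRHS]real_normK ?num_real//.
have := sqr_ge0 (`|x| - 1); have := normr_ge0 x; nra.
Qed.

(** Lebesgue measure is invariant under x -> - x and the integrand is odd, so the integral equals
    its opposite. *)
Lemma normal_first_moment :
  \int[mu]_x (x * normal_pdf 0 s x) = 0.
Proof.
have := integrable_normal_first_moment; rewrite -/e => ei.
set I := Rintegral _ _ _.
suff : I = - I by lra.
have mN : measurable_fun setT (-%R : measurableTypeR R -> measurableTypeR R).
  exact: oppr_measurable.
pose nu := pushforward mu (-%R : measurableTypeR R -> measurableTypeR R).
rewrite /I -[RHS]mulN1r -RintegralZl//; congr fine.
rewrite -[LHS](@eq_measure_integral _ _ _ _ _ nu); last first.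
  by move=> A mA _; rewrite /= lebesgue_measureN.
rewrite integral_pushforward//=.
- by rewrite preimage_setT; apply: eq_integral => x _ /=; rewrite e_even mulN1r mulNr.
- exact: measurable_int ei.
- rewrite preimage_setT; apply: (eq_Rintegrable _ _ (integrable_RN ei)) => //.
  by move=> x _; rewrite /= e_even mulNr.
Qed.
End normal_moments.

Section normal_law.
Context d (Omega : measurableType d) (R : realType) (P : probability Omega R).
Context (X : Omega -> R) (s : R).
Hypothesis mX : measurable_fun setT X.
Hypothesis s0 : 0 < s.
Hypothesis lawX : forall B : set R, measurable B ->
  P (X @^-1` B) = normal_prob 0 s B.

Let mXR : measurable_fun setT (X : Omega -> measurableTypeR R).
Proof. exact: mX. Qed.

Let transfer (f : R -> \bar R) : (forall x, (0 <= f x)%E) ->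
  measurable_fun setT f ->
  (\int[P]_w f (X w) = \int[lebesgue_measure]_x (f x * (normal_pdf 0 s x)%:E))%E.
Proof.
move=> f0 mf; rewrite -ge0_integral_normal_prob//.
transitivity (\int[pushforward P (X : Omega -> measurableTypeR R)]_x f x)%E.
  by rewrite ge0_integral_pushforward.
by apply: eq_measure_integral => A mA _; exact: lawX.
Qed.

Lemma normal_law_second_moment : (\int[P]_w (X w ^+ 2)%:E = (s ^+ 2)%:E)%E.
Proof.
rewrite -normal_second_moment// (transfer (f := fun x => (x ^+ 2)%:E)).
- by under [RHS]eq_integral do rewrite EFinM.
- by move=> x; rewrite lee_fin sqr_ge0.
- by apply/measurable_EFinP; exact: exprn_measurable.
Qed.

Lemma normal_law_sqintegrable : sqintegrable P setT X.
Proof.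
split => //; apply/integrableP; split.
  by apply/measurable_EFinP; exact: measurable_funX.
rewrite (eq_integral (fun w => (X w ^+ 2)%:E)).
  by rewrite normal_law_second_moment ltry.
by move=> w _; rewrite /= ger0_norm ?sqr_ge0.
Qed.

(** [transfer] holds for nonnegative functions, so the positive and negative parts of X are
    transferred separately. *)
Lemma normal_law_first_moment : \int[P]_w X w = 0.
Proof.
rewrite -(normal_first_moment s0); congr fine; rewrite integralE [RHS]integralE.
have e0 := normal_pdf_ge0 (0 : R) s.
congr (_ - _)%E.
- transitivity (\int[P]_w (Num.max (X w) 0)%:E)%E.
    by apply: eq_integral => w _; rewrite funeposE EFin_max.
  rewrite (transfer (f := fun x => (Num.max x 0)%:E)).
  + apply: eq_integral => x _; rewrite funeposE -EFin_max; congr EFin.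
    by rewrite maxr_pMl// mul0r.
  + by move=> x; rewrite lee_fin le_max lexx orbT.
  + by apply/measurable_EFinP; exact: measurable_maxr.
- transitivity (\int[P]_w (Num.max (- X w) 0)%:E)%E.
    by apply: eq_integral => w _; rewrite funenegE EFin_max EFinN.
  rewrite (transfer (f := fun x => (Num.max (- x) 0)%:E)).
  + apply: eq_integral => x _; rewrite funenegE -EFinN -EFin_max; congr EFin.
    by rewrite maxr_pMl// mul0r mulNr.
  + by move=> x; rewrite lee_fin le_max lexx orbT.
  + apply/measurable_EFinP; apply: measurable_maxr => //.
Qed.

End normal_law.

Section independent_product.
Context d (Omega : measurableType d) (R : realType) (P : probability Omega R).
Context (X Y : Omega -> R).
Hypothesis sX : sqintegrable P setT X.
Hypothesis sY : sqintegrable P setT Y.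
Hypothesis indXY : forall B C : set R, measurable B -> measurable C ->
  P (X @^-1` B `&` Y @^-1` C) = (P (X @^-1` B) * P (Y @^-1` C))%E.

Let mX : measurable_fun setT X. Proof. by case: sX. Qed.
Let mY : measurable_fun setT Y. Proof. by case: sY. Qed.

#[local] HB.instance Definition _ := @isMeasurableFun.Build _ _ Omega R X mX.
#[local] HB.instance Definition _ := @isMeasurableFun.Build _ _ Omega R Y mY.

(** Independence says that the law of (X, Y) and the product of the two laws agree on rectangles;
    they are then equal, and Fubini factors the integral of the product of the coordinates. *)
Lemma Rintegral_independent_mul :
  \int[P]_w (X w * Y w) = (\int[P]_w X w) * (\int[P]_w Y w).
Proof.
pose Z w := (X w, Y w).
have mZ : measurable_fun setT Z by apply/measurable_fun_pair.
pose PX := distribution P X; pose PY := distribution P Y.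
have XYi := sqintegrable_mul measurableT sX sY.
have Xi := sqintegrable_integrable measurableT sX.
have Yi := sqintegrable_integrable measurableT sY.
have mid : measurable_fun setT (EFin \o (@id R)) by exact/measurable_EFinP.
have PXi : PX.-integrable setT (EFin \o id) by exact: integrable_pushforward.
have PYi : PY.-integrable setT (EFin \o id) by exact: integrable_pushforward.
have prodi := integrableM_prod PXi PYi.
have <- : \int[PX]_x x = \int[P]_w X w.
  by congr fine; rewrite integral_pushforward.
have <- : \int[PY]_x x = \int[P]_w Y w.
  by congr fine; rewrite integral_pushforward.
rewrite -RintegralZr//.
transitivity (\int[(PX \x PY)%E]_z (z.1 * z.2)); last first.
  by rewrite -(Rintegral_fubini1 prodi); apply: eq_Rintegral => x _; rewrite /= RintegralZl.
have mprod : measurable_fun setT (fun z : R * R => (z.1 * z.2)%:E).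
  by apply/measurable_EFinP/measurable_funM.
congr fine; transitivity (\int[pushforward P Z]_z (z.1 * z.2)%:E)%E.
  by rewrite integral_pushforward.
apply: eq_measure_integral => A mA _; apply/esym.
by apply: product_measure_unique => // B C mB mC; rewrite -indXY.
Qed.

End independent_product.

Lemma mutually_independent_pair (R : realType) d (Omega : measurableType d)
    (P : probability Omega R) (I : finType) (Z : I -> Omega -> R) (i j : I) :
  i != j -> mutually_independent P Z ->
  forall B C : set R, measurable B -> measurable C ->
    P (Z i @^-1` B `&` Z j @^-1` C) = (P (Z i @^-1` B) * P (Z j @^-1` C))%E.
Proof.
move=> ij indZ B C mB mC.
pose D k := if k == i then B else if k == j then C else setT.
have := indZ D; rewrite (bigD1 i)// (bigD1 j)/=; last by rewrite eq_sym.
rewrite big1 ?mule1 => [|k /andP[/negbTE ki /negbTE kj]]; last first.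
  by rewrite /D ki kj preimage_setT probability_setT.
have -> : D i = B by rewrite /D eqxx.
have -> : D j = C by rewrite /D eq_sym (negbTE ij) eqxx.
move=> <-; last by move=> k; rewrite /D; case: ifP => // _; case: ifP.
congr (P _); apply/seteqP; split=> [w [Bw Cw] k _|w Dw].
  rewrite /D /preimage /=; case: eqVneq => [->//|_].
  by case: eqVneq => [->|_].
have := Dw i Logic.I; have := Dw j Logic.I.
by rewrite /D /preimage /= eqxx eq_sym (negbTE ij) eqxx.
Qed.

Section partition_nodes.
Context (R : realType) (t : R) (s : seq R).
Hypothesis st : itv_partition 0 t s.

Lemma node_ltn i j : (i < j <= size s)%N -> node s i < node s j.
Proof.
move=> /andP[ij js]; case: st => pst _.
by rewrite /node lt_sorted_ltn_nth//= inE/= ltnS// (leq_trans (ltnW ij)).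
Qed.

Lemma node_leq i j : (i <= j <= size s)%N -> node s i <= node s j.
Proof.
by move=> /andP[]; rewrite leq_eqVlt => /predU1P[->//|ij] js;
  rewrite ltW// node_ltn// ij.
Qed.

Lemma node_size : node s (size s) = t.
Proof. by case: st => _ /eqP <-; rewrite /node -last_nth. Qed.

Lemma node_itv i : (i <= size s)%N -> 0 <= node s i <= t.
Proof.
move=> ins; apply/andP; split.
  by rewrite (_ : 0 = node s 0)// node_leq ?ins.
by rewrite -[leRHS]node_size node_leq ?ins ?leqnn.
Qed.

End partition_nodes.

Section Rintegral_mul_sum.
Context d (T : measurableType d) (R : realType).
Context (mu : {measure set T -> \bar R}) (D : set T).
Hypothesis mD : measurable D.

Lemma Rintegral_mul_sum (I J : finType) (F : I -> T -> R) (G : J -> T -> R) :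
  (forall i, sqintegrable mu D (F i)) -> (forall j, sqintegrable mu D (G j)) ->
  \int[mu]_(x in D) ((\sum_i F i x) * (\sum_j G j x)) =
  \sum_i \sum_j \int[mu]_(x in D) (F i x * G j x).
Proof.
move=> sF sG.
under eq_Rintegral do rewrite big_distrlr/=.
have FG i j := sqintegrable_mul mD (sF i) (sG j).
rewrite Rintegral_sum//; last by move=> i _; apply: integrable_Rsum => // j _.
by apply: eq_bigr => i _; rewrite Rintegral_sum.
Qed.

End Rintegral_mul_sum.

(** The image of W(b) - W(0) under the isometry into L2. Every increment, and every indicator of a
    subdivision interval, is a difference of two such terms. *)
Definition indic_upto (R : realType) (b : R) : R -> R := \1_(`[0, b[%classic).

Lemma indic_uptoE (R : realType) (b r : R) : indic_upto b r = (0 <= r < b)%R%:R.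
Proof.
rewrite /indic_upto indicE (_ : (r \in _) = (0 <= r < b))//.
by apply/idP/idP; rewrite inE/= in_itv.
Qed.

Lemma measurable_indic_upto (R : realType) (b : R) : measurable_fun setT (indic_upto b).
Proof. by apply: measurable_indic. Qed.

Section brownian_increments.
Context (R : realType) (dO : measure_display) (Omega : measurableType dO).
Context (P : probability Omega R) (T : R) (k : nat) (W : R -> Omega -> 'cV[R]_k).
Hypothesis bW : brownian_motion P T W.
Notation mu := (@lebesgue_measure R).

Let measurable_increment r t i : 0 <= r <= T -> 0 <= t <= T ->
  measurable_fun setT (fun w => W t w i 0 - W r w i 0).
Proof.
by move=> rT tT; apply: measurable_funB; exact: (brownian_measurable bW).
Qed.

Let increment_law r t i : 0 <= r -> r < t -> t <= T ->
  [/\ sqintegrable P setT (fun w => W t w i 0 - W r w i 0),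
      \int[P]_w (W t w i 0 - W r w i 0) = 0 &
      \int[P]_w ((W t w i 0 - W r w i 0) ^+ 2) = t - r].
Proof.
move=> r0 rt tT; have rT : 0 <= r <= T by rewrite r0 (le_trans (ltW rt)).
have tT' : 0 <= t <= T by rewrite tT (le_trans r0 (ltW rt)).
have mX := measurable_increment i rT tT'.
have s0 : 0 < Num.sqrt (t - r) by rewrite sqrtr_gt0 subr_gt0.
have law B mB := @brownian_normal _ _ _ _ _ _ _ bW r t i r0 rt tT B mB.
split.
- exact: normal_law_sqintegrable mX s0 law.
- exact: normal_law_first_moment mX s0 law.
- have := normal_law_second_moment mX s0 law.
  by rewrite /Rintegral => ->; rewrite /= sqr_sqrtr// subr_ge0 ltW.
Qed.

Let increment0 t : t = 0 -> forall i, (fun w => W t w i 0 - W 0 w i 0) = cst 0.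
Proof. by move=> -> i; apply/funext => w; rewrite subrr. Qed.

(** W(0) is subtracted because it vanishes only almost surely; t = 0 is separate since the law of an
    increment is given for r < t. *)
Lemma increment_sqintegrable t i : 0 <= t <= T ->
  sqintegrable P setT (fun w => W t w i 0 - W 0 w i 0).
Proof.
move=> /andP[]; rewrite le_eqVlt => /predU1P[<-|t0] tT.
  by rewrite increment0//; exact: sqintegrable_cst.
by case: (increment_law i (lexx 0) t0 tT).
Qed.

Lemma increment_mean t i : 0 <= t <= T ->
  \int[P]_w (W t w i 0 - W 0 w i 0) = 0.
Proof.
move=> /andP[]; rewrite le_eqVlt => /predU1P[<-|t0] tT.
  by under eq_Rintegral do rewrite subrr; rewrite Rintegral_cst// mul0r.
by case: (increment_law i (lexx 0) t0 tT).
Qed.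

Let partition_uncorrelated s (a b : 'I_(size s)) i j : itv_partition 0 T s ->
  (a, i) != (b, j) ->
  \int[P]_w ((W (node s a.+1) w i 0 - W (node s a) w i 0) *
             (W (node s b.+1) w j 0 - W (node s b) w j 0)) = 0.
Proof.
move=> sT aibj.
have h (c : 'I_(size s)) l : sqintegrable P setT
      (fun w => W (node s c.+1) w l 0 - W (node s c) w l 0) /\
    \int[P]_w (W (node s c.+1) w l 0 - W (node s c) w l 0) = 0.
  have c1 := node_itv sT (ltn_ord c); have c0 := node_itv sT (ltnW (ltn_ord c)).
  have cc : node s c < node s c.+1 by rewrite (node_ltn sT) ?ltnSn ?ltn_ord.
  case/andP: c0 => c0 _; case/andP: c1 => _ c1.
  by case: (increment_law l c0 cc c1).
have [sX X0] := h a i; have [sY Y0] := h b j.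
rewrite (Rintegral_independent_mul sX sY) ?X0 ?mul0r//.
exact: (mutually_independent_pair aibj (brownian_independent bW sT)).
Qed.

(** Write W(t) - W(0) = (W(t) - W(s)) + (W(s) - W(0)); the first increment is independent of every
    component of W(s) - W(0). *)
Let cov_le s t i j : 0 <= s -> s <= t -> t <= T ->
  \int[P]_w ((W s w i 0 - W 0 w i 0) * (W t w j 0 - W 0 w j 0)) =
  (i == j)%:R * s.
Proof.
rewrite le_eqVlt => /predU1P[<-|s0] st tT.
  by under eq_Rintegral do rewrite subrr mul0r; rewrite Rintegral_cst// mul0r mulr0.
have sT := le_trans st tT.
have sT' : 0 <= s <= T by rewrite sT ltW.
have diag : \int[P]_w ((W s w i 0 - W 0 w i 0) * (W s w j 0 - W 0 w j 0)) =
    (i == j)%:R * s.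
  have [<-|ij] := eqVneq i j.
    by case: (increment_law i (lexx 0) s0 sT) => _ _; rewrite subr0 mul1r.
  (* Independence is stated for strictly increasing subdivisions ending at T, so T is appended
     unless the last time already equals it. *)
  rewrite mul0r; have [sT1|sT1] := eqVneq s T.
    have p : itv_partition 0 T [:: s] by split; rewrite /= ?s0 ?sT1.
    by apply: (@partition_uncorrelated [:: s] ord0 ord0 _ _ p); rewrite xpair_eqE eqxx.
  have sltT : s < T by rewrite lt_def eq_sym sT1.
  have p : itv_partition 0 T [:: s; T] by split; rewrite /= ?s0 ?sltT.
  by apply: (@partition_uncorrelated [:: s; T] ord0 ord0 _ _ p); rewrite xpair_eqE eqxx.
move: st; rewrite le_eqVlt => /predU1P[<-//|st].
have off : \int[P]_w ((W s w i 0 - W 0 w i 0) * (W t w j 0 - W s w j 0)) = 0.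
  have [tT1|tT1] := eqVneq t T.
    have p : itv_partition 0 T [:: s; t] by split; rewrite /= ?s0 ?st ?tT1.
    exact: (@partition_uncorrelated [:: s; t] ord0 (lift ord0 ord0) _ _ p).
  have tltT : t < T by rewrite lt_def eq_sym tT1.
  have p : itv_partition 0 T [:: s; t; T] by split; rewrite /= ?s0 ?st ?tltT.
  exact: (@partition_uncorrelated [:: s; t; T] ord0 (lift ord0 ord0) _ _ p).
have [sW _ _] := increment_law j (ltW s0) st tT.
transitivity (\int[P]_w ((W s w i 0 - W 0 w i 0) * (W t w j 0 - W s w j 0)) +
  \int[P]_w ((W s w i 0 - W 0 w i 0) * (W s w j 0 - W 0 w j 0))); last first.
  by rewrite off diag add0r.
rewrite -RintegralD//.
- by apply: eq_Rintegral => w _; ring.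
- by apply: sqintegrable_mul sW => //; exact: increment_sqintegrable.
- by apply: sqintegrable_mul => //; exact: increment_sqintegrable.
Qed.

(** Writing min(s, t) as an inner product of indicators makes both sides bilinear in the increments,
    which is the form that extends to step functions. *)
Lemma increment_covariance s t i j : 0 <= s <= T -> 0 <= t <= T ->
  \int[P]_w ((W s w i 0 - W 0 w i 0) * (W t w j 0 - W 0 w j 0)) =
  (i == j)%:R * \int[mu]_(r in `[0, T]) (indic_upto s r * indic_upto t r).
Proof.
wlog st : s t i j / s <= t => [hwlog sT tT|].
  have [st|/ltW ts] := leP s t; first exact: hwlog.
  rewrite eq_sym; under [X in _ * X]eq_Rintegral do rewrite mulrC.
  by rewrite -hwlog//; apply: eq_Rintegral => w _; rewrite mulrC.
move=> /andP[s0 sT] /andP[t0 tT]; rewrite cov_le//; congr (_ * _).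
rewrite (_ : (fun r => indic_upto s r * indic_upto t r) = indic_upto s); last first.
  apply/funext => r; rewrite !indic_uptoE.
  have [r0|_] := leP 0 r; last by rewrite mul0r.
  by have [rs|_] := ltP r s; rewrite ?mul0r// (lt_le_trans rs st) mulr1.
rewrite /Rintegral integral_indic//= (_ : _ `&` _ = `[0, s[%classic).
  rewrite lebesgue_measure_itv/= lte_fin; case: ltP => [_|s_le0]; rewrite /= ?subr0//.
  by apply/le_anti/andP; split.
apply/seteqP; split=> [r []//|r /=]; rewrite !in_itv/= => /andP[r0 rs].
by rewrite r0 rs (le_trans (ltW rs) sT).
Qed.

End brownian_increments.

(** * The Ito isometry *)

Section Rintegral_mul_sub.
Context d (T : measurableType d) (R : realType).
Context (mu : {measure set T -> \bar R}) (D : set T).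
Hypothesis mD : measurable D.

Lemma Rintegral_mulBB (a b c e : T -> R) : sqintegrable mu D a ->
  sqintegrable mu D b -> sqintegrable mu D c -> sqintegrable mu D e ->
  \int[mu]_(x in D) ((a x - b x) * (c x - e x)) =
  \int[mu]_(x in D) (a x * c x) - \int[mu]_(x in D) (a x * e x)
  - (\int[mu]_(x in D) (b x * c x) - \int[mu]_(x in D) (b x * e x)).
Proof.
move=> sa sb sc se.
have ac := sqintegrable_mul mD sa sc; have ae := sqintegrable_mul mD sa se.
have bc := sqintegrable_mul mD sb sc; have be := sqintegrable_mul mD sb se.
rewrite -!RintegralB//; [|exact: integrable_RB..].
by apply: eq_Rintegral => x _; ring.
Qed.

End Rintegral_mul_sub.

Lemma eq0_of_le_mul (R : realType) (x M : R) : 0 <= M ->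
  (forall e, 0 < e <= 1 -> `|x| <= e * M) -> x = 0.
Proof.
move=> M0 xM; apply/eqP; rewrite -normr_le0 leNgt; apply/negP => x0.
(* This e makes e * M at most |x| / 2, which contradicts |x| <= e * M when x <> 0. *)
pose e := Num.min 1 (`|x| / (2 * (M + 1))).
have M1 : 0 < 2 * (M + 1) by rewrite mulr_gt0// ltr_wpDl.
have e0 : 0 < e <= 1 by rewrite lt_min ltr01 divr_gt0//= ge_min lexx.
have := xM e e0; have : e * M <= `|x| / (2 * (M + 1)) * M.
  by rewrite ler_wpM2r// ge_min lexx orbT.
have : `|x| / (2 * (M + 1)) * M <= `|x| / 2.
  have M1' : 0 < M + 1 by rewrite ltr_wpDl.
  rewrite (_ : _ * M = `|x| / 2 * (M / (M + 1))); last first.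
    by field; rewrite gt_eqF.
  by rewrite ler_piMr ?divr_ge0// ler_pdivrMr// mul1r lerDl.
lra.
Qed.


Section step_isometry.
Context (R : realType) (dO : measure_display) (Omega : measurableType dO).
Context (P : probability Omega R) (T : R) (k : nat) (W : R -> Omega -> 'cV[R]_k).
Hypothesis bW : brownian_motion P T W.
Notation mu := (@lebesgue_measure R).

Let mT : measurable (`[0, T]%classic : set (measurableTypeR R)).
Proof. by []. Qed.

Let xi (s : seq R) (j : nat) (l : 'I_k) w := W (node s j.+1) w l 0 - W (node s j) w l 0.
Let psi (s : seq R) (j : nat) : R -> R := \1_(`[node s j, node s j.+1[%classic).

Let xiE s j l w : xi s j l w = (W (node s j.+1) w l 0 - W 0 w l 0) -
  (W (node s j) w l 0 - W 0 w l 0).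
Proof. by rewrite /xi opprB addrA subrK. Qed.

Let psiE s t j r : itv_partition 0 t s -> (j < size s)%N ->
  psi s j r = indic_upto (node s j.+1) r - indic_upto (node s j) r.
Proof.
move=> st js; rewrite /psi indicE !indic_uptoE.
have /andP[n0 _] := node_itv st (ltnW js).
have nn : node s j < node s j.+1 by rewrite (node_ltn st)// ltnSn.
have -> : (r \in (`[node s j, node s j.+1[%classic : set R)) =
    (node s j <= r < node s j.+1).
  by apply/idP/idP; rewrite inE/= in_itv.
have [nr|rn] := leP (node s j) r.
  by rewrite (le_trans n0 nr)/= subr0.
by rewrite (lt_trans rn nn) !andbT subrr.
Qed.

Let sindic b : sqintegrable mu `[0, T] (indic_upto b).
Proof.
have mi : measurable_fun `[0, T] (indic_upto b).
  by apply: measurable_funTS; exact: measurable_indic_upto.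
split => //.
apply: (@bounded_itv_integrable R T _ _ 1) => //.
  exact: measurable_funX.
move=> r _; rewrite indic_uptoE ger0_norm ?sqr_ge0//.
by case: (0 <= r < b); rewrite ?expr1n ?expr0n.
Qed.

Let spsi s t j : itv_partition 0 t s -> (j < size s)%N ->
  sqintegrable mu `[0, T] (psi s j).
Proof.
move=> st js; apply: (eq_sqintegrable mT _ (sqintegrableB mT (sindic (node s j.+1))
  (sindic (node s j)))) => r _.
by rewrite (psiE _ st js).
Qed.

Let node_itvT s t j : t <= T -> itv_partition 0 t s -> (j <= size s)%N ->
  0 <= node s j <= T.
Proof.
by move=> tT st js; have /andP[-> /le_trans->] := node_itv st js.
Qed.

Let sxi s t j l : t <= T -> itv_partition 0 t s -> (j < size s)%N ->
  sqintegrable P setT (xi s j l).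
Proof.
move=> tT st js; have n1 := node_itvT tT st js; have n0 := node_itvT tT st (ltnW js).
apply: (eq_sqintegrable measurableT _ (sqintegrableB measurableT
  (increment_sqintegrable bW l n1) (increment_sqintegrable bW l n0))) => w _.
by rewrite xiE.
Qed.

(** Increments and indicators are the same differences of terms based at 0, so the covariance
    formula is expanded bilinearly. The two subdivisions may overlap arbitrarily, and no common
    refinement is formed. *)
Let xi_covariance s s' t t' j j' l l' : t <= T -> t' <= T ->
  itv_partition 0 t s -> itv_partition 0 t' s' ->
  (j < size s)%N -> (j' < size s')%N ->
  \int[P]_w (xi s j l w * xi s' j' l' w) =
  (l == l')%:R * \int[mu]_(r in `[0, T]) (psi s j r * psi s' j' r).
Proof.
move=> tT tT' st st' js js'.
under eq_Rintegral do rewrite !xiE.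
under [X in _ * X]eq_Rintegral do rewrite (psiE _ st js) (psiE _ st' js').
have n1 := node_itvT tT st js; have n0 := node_itvT tT st (ltnW js).
have n1' := node_itvT tT' st' js'; have n0' := node_itvT tT' st' (ltnW js').
rewrite [LHS]Rintegral_mulBB//; [|exact: (increment_sqintegrable bW)..].
rewrite [in RHS]Rintegral_mulBB//; [|exact: sindic..].
by rewrite !(increment_covariance bW)// -!mulrBr.
Qed.

Context (n : nat).
Implicit Types h : nat -> 'M[R]_(n, k).

Let step_itoE s h w i : step_ito W s h w i 0 =
  \sum_(p : 'I_(size s) * 'I_k) h p.1 i p.2 * xi s p.1 p.2 w.
Proof.
rewrite /step_ito summxE (eq_bigr (fun j : 'I_(size s) =>
  \sum_(l < k) h j i l * xi s j l w)).
  by rewrite pair_bigA.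
by move=> j _; rewrite mxE; apply: eq_bigr => l _; rewrite !mxE.
Qed.

Let step_funE s h r i l : step_fun s h r i l =
  \sum_(j < size s) h j i l * psi s j r.
Proof.
by rewrite /step_fun summxE; apply: eq_bigr => j _; rewrite mxE mulrC.
Qed.

Lemma step_ito_sqintegrable s h t i : t <= T -> itv_partition 0 t s ->
  sqintegrable P setT (fun w => step_ito W s h w i 0).
Proof.
move=> tT st; rewrite (_ : (fun w => _) = (fun w =>
  \sum_(p : 'I_(size s) * 'I_k) h p.1 i p.2 * xi s p.1 p.2 w)); last first.
  by apply/funext => w; rewrite step_itoE.
by apply: sqintegrable_sum => // -[j l] _; apply: sqintegrableZ => //=; exact: sxi tT st _.
Qed.

Lemma step_fun_sqintegrable s h t i l : itv_partition 0 t s ->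
  sqintegrable mu `[0, T] (fun r => step_fun s h r i l).
Proof.
move=> st; rewrite (_ : (fun r => _) = (fun r =>
  \sum_(j < size s) h j i l * psi s j r)); last first.
  by apply/funext => w; rewrite step_funE.
by apply: sqintegrable_sum => // j _; apply: sqintegrableZ => //=; exact: spsi st _.
Qed.

Lemma step_ito_mean s h t i : t <= T -> itv_partition 0 t s ->
  \int[P]_w step_ito W s h w i 0 = 0.
Proof.
move=> tT st; under eq_Rintegral do rewrite step_itoE.
have xii (j : 'I_(size s)) l := sqintegrable_integrable measurableT (sxi l tT st (ltn_ord j)).
rewrite Rintegral_sum//; last by move=> [j l] _; exact: integrable_RZ.
rewrite big1// => -[j l] _; rewrite RintegralZl//.
under eq_Rintegral do rewrite xiE.
have n1 := node_itvT tT st (ltn_ord j); have n0 := node_itvT tT st (ltnW (ltn_ord j)).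
rewrite RintegralB//; last 2 first.
- exact: sqintegrable_integrable (increment_sqintegrable bW l n1).
- exact: sqintegrable_integrable (increment_sqintegrable bW l n0).
by rewrite !(increment_mean bW)// subrr mulr0.
Qed.

(** Double sums over (interval, coordinate) on both sides; the Kronecker symbol of [xi_covariance]
    leaves a single sum over the coordinates of W. *)
Lemma step_isometry s h t i s' h' t' i' : t <= T -> t' <= T ->
  itv_partition 0 t s -> itv_partition 0 t' s' ->
  \int[P]_w (step_ito W s h w i 0 * step_ito W s' h' w i' 0) =
  \sum_(l < k) \int[mu]_(r in `[0, T])
    (step_fun s h r i l * step_fun s' h' r i' l).
Proof.
move=> tT tT' st st'.
under eq_Rintegral do rewrite !step_itoE.
rewrite Rintegral_mul_sum//; last 2 first.
- by move=> [j l]; apply: sqintegrableZ => //=; exact: sxi tT st _.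
- by move=> [j l]; apply: sqintegrableZ => //=; exact: sxi tT' st' _.
pose c (j : 'I_(size s)) (j' : 'I_(size s')) l :=
  h j i l * h' j' i' l * \int[mu]_(r in `[0, T]) (psi s j r * psi s' j' r).
transitivity (\sum_(j < size s) \sum_l \sum_(j' < size s') c j j' l).
  rewrite [RHS]pair_bigA/=; apply: eq_bigr => -[j l] _ /=.
  transitivity (\sum_(j' < size s') \sum_(l' < k) (l == l')%:R *
      (h j i l * h' j' i' l' * \int[mu]_(r in `[0, T]) (psi s j r * psi s' j' r))).
    rewrite [RHS]pair_bigA/=; apply: eq_bigr => -[j' l'] _ /=.
    have xx := sqintegrable_mul measurableT (sxi l tT st (ltn_ord j))
      (sxi l' tT' st' (ltn_ord j')).
    transitivity (h j i l * h' j' i' l' * \int[P]_w (xi s j l w * xi s' j' l' w)).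
      by rewrite -RintegralZl//; apply: eq_Rintegral => w _; ring.
    by rewrite (xi_covariance _ _ tT tT' st st')//; ring.
  apply: eq_bigr => j' _; rewrite (bigD1 l)//= eqxx mul1r big1 ?addr0// => l' l'l.
  by rewrite eq_sym (negbTE l'l) mul0r.
rewrite exchange_big; apply: eq_bigr => l _.
under [RHS]eq_Rintegral do rewrite !step_funE.
rewrite Rintegral_mul_sum//; last 2 first.
- by move=> j; apply: sqintegrableZ => //=; exact: spsi st _.
- by move=> j; apply: sqintegrableZ => //=; exact: spsi st' _.
apply: eq_bigr => j _; apply: eq_bigr => j' _.
have pp := sqintegrable_mul mT (spsi st (ltn_ord j)) (spsi st' (ltn_ord j')).
by rewrite /c -RintegralZl//; apply: eq_Rintegral => r _; ring.
Qed.

End step_isometry.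

Section sqnorm_integral.
Context d (T : measurableType d) (R : realType).
Context (mu : {measure set T -> \bar R}) (D : set T).
Hypothesis mD : measurable D.

Lemma sqintegrable_entry p q (f : T -> 'M[R]_(p, q)) (e : R) i j :
  (forall i j, measurable_fun D (fun x => f x i j)) ->
  (\int[mu]_(x in D) (sqnorm (f x))%:E < e%:E)%E ->
  sqintegrable mu D (fun x => f x i j) /\ \int[mu]_(x in D) (f x i j ^+ 2) <= e.
Proof.
move=> mf fe.
have msq : measurable_fun D (fun x => sqnorm (f x)).
  rewrite /sqnorm; apply: measurable_sum => k; apply: measurable_sum => l.
  by apply: measurable_funX; exact: mf.
have sqi : mu.-integrable D (EFin \o (fun x => sqnorm (f x))).
  apply/integrableP; split; first exact/measurable_EFinP.
  rewrite (eq_integral (fun x => (sqnorm (f x))%:E)).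
    by rewrite (lt_trans fe) ?ltry.
  by move=> x _; rewrite /= ger0_norm ?sqnorm_ge0.
have fsq x : f x i j ^+ 2 <= sqnorm (f x).
  rewrite /sqnorm (bigD1 i)//= (bigD1 j)//= -addrA lerDl.
  by rewrite addr_ge0//; apply: sumr_ge0 => k _; rewrite ?sqr_ge0//;
    apply: sumr_ge0 => l _; exact: sqr_ge0.
have f2i : mu.-integrable D (EFin \o (fun x => f x i j ^+ 2)).
  apply: (le_Rintegrable mD _ _ sqi); first exact: measurable_funX.
  by move=> x _; rewrite ger0_norm ?sqr_ge0.
split; first by split.
apply: (@le_trans _ _ (\int[mu]_(x in D) sqnorm (f x))); first exact: le_Rintegral.
rewrite -lee_fin fineK; first exact: ltW.
exact: integrable_fin_num sqi.
Qed.

End sqnorm_integral.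

Section ito_isometry.
Context (R : realType) (dO : measure_display) (Omega : measurableType dO).
Context (P : probability Omega R) (T : R) (k n : nat) (W : R -> Omega -> 'cV[R]_k).
Hypothesis bW : brownian_motion P T W.
Notation mu := (@lebesgue_measure R).
Implicit Types (g : R -> 'M[R]_(n, k)) (Y : Omega -> 'cV[R]_n).

Let mT : measurable (`[0, T]%classic : set (measurableTypeR R)).
Proof. by []. Qed.

(** Extension by 0 beyond t, so that integrands belonging to different times are compared in one
    space, L2 of [[0, T]]. *)
Let ind g t i l : R -> R := (fun r => g r i l) \_ `[0, t].

Let sind g t i l : t <= T -> sqintegrable mu `[0, T] (fun r => g r i l) ->
  sqintegrable mu `[0, T] (ind g t i l).
Proof.
move=> tT [mg gi]; have mt : measurable (`[0, t]%classic : set (measurableTypeR R)) by [].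
have sub : `[0, t]%classic `<=` (`[0, T]%classic : set (measurableTypeR R)).
  by apply: subset_itvl; rewrite bnd_simp.
have mind : measurable_fun `[0, T] (ind g t i l).
  apply: measurable_funTS; apply/(measurable_restrictT _ mt).
  exact: measurable_funS mg.
split => //; apply: (le_Rintegrable mT _ _ gi); first exact: measurable_funX.
move=> r _; rewrite /ind patchE ger0_norm ?sqr_ge0//.
by case: ifP => _; rewrite ?expr0n/= ?sqr_ge0.
Qed.

(** The definition of the integral is used with tolerance e^2, so that e bounds the L2 norms, as
    [sqintegrable_approx] requires. *)
Let approx t g Y (e : R) : 0 < e -> 0 <= t <= T ->
  (forall i l, sqintegrable mu `[0, T] (fun r => g r i l)) ->
  is_ito_integral P W t g Y ->
  exists (S : Omega -> 'cV[R]_n) (s : seq R) (h : nat -> 'M[R]_(n, k)),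
  [/\ itv_partition 0 t s, S = step_ito W s h,
   forall i, sqintegrable P setT (fun w => Y w i 0),
   forall i, \int[P]_w ((Y w i 0 - S w i 0) ^+ 2) <= e ^+ 2 &
   forall i l, \int[mu]_(r in `[0, T]) ((ind g t i l r - step_fun s h r i l) ^+ 2) <= e ^+ 2].
Proof.
move=> e0 /andP[t0 tT] sg [mY itoY].
have e20 : 0 < e ^+ 2 by rewrite exprn_gt0.
have [s [h [st ge Ye]]] := itoY _ e20.
exists (step_ito W s h), s, h.
have sS i := step_ito_sqintegrable bW h i tT st.
have YS i j : sqintegrable P setT (fun w => (Y w - step_ito W s h w) i j) /\
    \int[P]_w ((Y w - step_ito W s h w) i j ^+ 2) <= e ^+ 2.
  apply: (sqintegrable_entry _ _ _ _) => //; last by rewrite unlock in Ye.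
  move=> {}i {}j; rewrite (ord1 j) (_ : (fun w => _) =
    (fun w => Y w i 0 - step_ito W s h w i 0)).
    by apply: measurable_funB; [exact: mY|case: (sS i)].
  by apply/funext => w; rewrite !mxE.
have YSE i w : (Y w - step_ito W s h w) i 0 = Y w i 0 - step_ito W s h w i 0.
  by rewrite !mxE.
split => //.
- move=> i; have [YSi _] := YS i 0.
  apply: (eq_sqintegrable measurableT _ (sqintegrableD measurableT YSi (sS i))) => w _.
  by rewrite YSE subrK.
- by move=> i; have [_] := YS i 0; under eq_Rintegral do rewrite YSE.
move=> i l.
have mt : measurable (`[0, t]%classic : set (measurableTypeR R)) by [].
have sub : `[0, t]%classic `<=` (`[0, T]%classic : set (measurableTypeR R)).
  by apply: subset_itvl; rewrite bnd_simp.
have [] := @sqintegrable_entry _ _ _ mu `[0, t] mt n k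
  (fun r => step_fun s h r - g r) (e ^+ 2) i l.
- move=> {}i {}l; rewrite (_ : (fun r => _) = (fun r => step_fun s h r i l - g r i l)).
    apply: measurable_funB.
      by apply: measurable_funS sub _ => //; have [] := step_fun_sqintegrable T h i l st.
    by apply: measurable_funS sub _ => //; have [] := sg i l.
  by apply/funext => r; rewrite !mxE.
- exact: ge.
move=> _; apply: le_trans; rewrite le_eqVlt; apply/predU1P; left.
rewrite [LHS]Rintegral_mkcond [RHS]Rintegral_mkcond; apply: eq_Rintegral => r _.
rewrite !patchE.
case: (boolP (r \in `[0, t]%classic)) => rt.
  by rewrite mem_set; [rewrite /ind patchE rt !mxE -sqrrN opprB|exact: sub (set_mem rt)].
(* Outside [[0, t]] both functions vanish, since all nodes of the subdivision lie in [[0, t]]. *)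
case: ifP => // rT; rewrite /ind patchE (negbTE rt) /step_fun summxE big1 ?subrr ?expr0n//.
move=> j _; rewrite mxE indicE memNset ?mul0r//= in_itv/= => /andP[jr rj].
move: rt; rewrite notin_setE/= in_itv/=; apply.
have /andP[n0 _] := node_itv st (ltnW (ltn_ord j)).
have /andP[_ n1] := node_itv st (ltn_ord j).
by rewrite (le_trans n0 jr) (le_trans (ltW rj)).
Qed.

Lemma ito_sqintegrable t g Y i : 0 <= t <= T ->
  (forall i l, sqintegrable mu `[0, T] (fun r => g r i l)) ->
  is_ito_integral P W t g Y -> sqintegrable P setT (fun w => Y w i 0).
Proof. by move=> tT sg itoY; have [S [s [h []]]] := approx ltr01 tT sg itoY. Qed.

(** The mean is the inner product of Y with the constant 1; the approximating step integrals are
    centred, and 1 is approximated by itself. *)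
Lemma ito_mean t g Y i : 0 <= t <= T ->
  (forall i l, sqintegrable mu `[0, T] (fun r => g r i l)) ->
  is_ito_integral P W t g Y -> \int[P]_w Y w i 0 = 0.
Proof.
move=> tT sg itoY; have s1 := @sqintegrable_cst _ _ _ P setT measurableT 1.
pose M := Num.sqrt (\int[P]_w (Y w i 0 ^+ 2)) + Num.sqrt (\int[P]_w (1 ^+ 2)) + 1.
apply: (@eq0_of_le_mul _ _ M); first by rewrite !addr_ge0 ?sqrtr_ge0.
move=> e /andP[e0 e1].
have [S [s [h [st SE sY YS _]]]] := approx e0 tT sg itoY.
have tT' : t <= T by case/andP: tT.
have sS : sqintegrable P setT (fun w => S w i 0).
  by rewrite SE; exact (step_ito_sqintegrable bW h i tT' st).
have mS : \int[P]_w S w i 0 = 0 by rewrite SE; exact (step_ito_mean bW h i tT' st).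
have z : \int[P]_(w in setT) (((1 : R) - 1) ^+ 2) <= e ^+ 2.
  by rewrite subrr expr0n/= Rintegral_cst// mul0r sqr_ge0.
have := sqintegrable_approx measurableT (ltW e0) (sY i) s1 sS s1 (YS i) z.
under [X in `|X - _|]eq_Rintegral do rewrite mulr1.
under [X in `|_ - X|]eq_Rintegral do rewrite mulr1.
rewrite mS subr0 => h1; apply: (le_trans h1).
by rewrite ler_wpM2l ?(ltW e0)// /M lerD2l.
Qed.

(** Both covariances, under P and in L2 of [[0, T]], are within e times a constant of their step
    analogues, which are equal by [step_isometry]. Restricting to e <= 1 lets the constant be
    independent of e. *)
Lemma ito_covariance t g Y t' g' Y' i i' : 0 <= t <= T -> 0 <= t' <= T ->
  (forall i l, sqintegrable mu `[0, T] (fun r => g r i l)) ->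
  (forall i l, sqintegrable mu `[0, T] (fun r => g' r i l)) ->
  is_ito_integral P W t g Y -> is_ito_integral P W t' g' Y' ->
  \int[P]_w (Y w i 0 * Y' w i' 0) =
  \sum_(l < k) \int[mu]_(r in `[0, Num.min t t']) (g r i l * g' r i' l).
Proof.
move=> tT tT' sg sg' itoY itoY'.
have sY := ito_sqintegrable i tT sg itoY; have sY' := ito_sqintegrable i' tT' sg' itoY'.
have tleT : t <= T by case/andP: tT.
have tleT' : t' <= T by case/andP: tT'.
transitivity (\sum_(l < k) \int[mu]_(r in `[0, T]) (ind g t i l r * ind g' t' i' l r)).
  apply/eqP; rewrite -subr_eq0; apply/eqP.
  pose M1 := Num.sqrt (\int[P]_w (Y w i 0 ^+ 2)) + Num.sqrt (\int[P]_w (Y' w i' 0 ^+ 2)).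
  pose M2 l := Num.sqrt (\int[mu]_(r in `[0, T]) (ind g t i l r ^+ 2)) +
    Num.sqrt (\int[mu]_(r in `[0, T]) (ind g' t' i' l r ^+ 2)).
  have M20 l : 0 <= M2 l + 1 by rewrite !addr_ge0 ?sqrtr_ge0.
  apply: (@eq0_of_le_mul _ _ ((M1 + 1) + \sum_(l < k) (M2 l + 1))).
    by rewrite !addr_ge0 ?sqrtr_ge0// sumr_ge0.
  move=> e /andP[e0 e1].
  have [S [s [h [st SE _ YS gh]]]] := approx e0 tT sg itoY.
  have [S' [s' [h' [st' SE' _ YS' gh']]]] := approx e0 tT' sg' itoY'.
  have sS : sqintegrable P setT (fun w => S w i 0).
    by rewrite SE; exact (step_ito_sqintegrable bW h i tleT st).
  have sS' : sqintegrable P setT (fun w => S' w i' 0).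
    by rewrite SE'; exact (step_ito_sqintegrable bW h' i' tleT' st').
  have A1 := sqintegrable_approx measurableT (ltW e0) sY sY' sS sS' (YS i) (YS' i').
  have A2 l := sqintegrable_approx mT (ltW e0) (sind tleT (sg i l)) (sind tleT' (sg' i' l))
    (step_fun_sqintegrable T h i l st) (step_fun_sqintegrable T h' i' l st') (gh i l) (gh' i' l).
  have iso : \int[P]_w (S w i 0 * S' w i' 0) = \sum_(l < k) \int[mu]_(r in `[0, T])
      (step_fun s h r i l * step_fun s' h' r i' l).
    by rewrite SE SE'; exact (step_isometry bW h i h' i' tleT tleT' st st').
  set a := Rintegral P _ _ in A1 *; set b := Rintegral P _ _ in A1 iso.
  rewrite (_ : _ - _ = (a - b) + \sum_(l < k)
    (\int[mu]_(r in `[0, T]) (step_fun s h r i l * step_fun s' h' r i' l) -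
     \int[mu]_(r in `[0, T]) (ind g t i l r * ind g' t' i' l r))); last first.
    by rewrite sumrB -iso addrA subrK.
  rewrite mulrDr mulr_sumr; apply: (le_trans (ler_normD _ _)); apply: lerD.
    by apply: (le_trans A1); rewrite ler_wpM2l ?(ltW e0)// lerD2l.
  apply: (le_trans (ler_norm_sum _ _ _)); apply: ler_sum => l _.
  rewrite distrC; apply: (le_trans (A2 l)).
  by rewrite ler_wpM2l ?(ltW e0)// lerD2l.
(* The product of the two extensions by 0 is supported in [[0, min t t']]. *)
apply: eq_bigr => l _; rewrite [LHS]Rintegral_mkcond [RHS]Rintegral_mkcond.
apply: eq_Rintegral => r _; rewrite !patchE /ind !patchE.
have inE' (b : R) : (r \in (`[0, b]%classic : set R)) = (0 <= r <= b).
  by apply/idP/idP; rewrite inE/= in_itv.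
rewrite !inE' le_min; have [r0|_] := leP 0 r => //=.
have [rT|Tr] := leP r T; last first.
  by rewrite (lt_geF (le_lt_trans tleT Tr)).
by case: (r <= t); case: (r <= t'); rewrite ?mul0r ?mulr0.
Qed.

End ito_isometry.

(** * Mean and covariance of the state for a fixed parameter *)

Section process_integral.
Context (R : realType) (dO : measure_display) (Omega : measurableType dO).
Context (P : probability Omega R) (T : R).
Notation mu := (@lebesgue_measure R).
Let TR := measurableTypeR R.
Let D : set (TR * Omega) := `[0, T]%classic `*` setT.

Let mT : measurable (`[0, T]%classic : set TR).
Proof. by []. Qed.

Let mD : measurable D.
Proof. exact: measurableX. Qed.

Let patchD (h : TR * Omega -> R) s w :
  (h \_ D) (s, w) = ((fun s => h (s, w)) \_ `[0, T]) s.
Proof.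
rewrite !patchE; have [sT|sT] := boolP (s \in `[0, T]%classic).
  by rewrite mem_set//; split => //; exact: set_mem.
by rewrite memNset// => -[/= sT' _]; move/negP: sT; apply; exact: mem_set.
Qed.

Let integrable_patchD (h : TR * Omega -> R) :
  (mu \x P)%E.-integrable D (EFin \o h) <->
  (mu \x P)%E.-integrable setT (EFin \o (h \_ D)).
Proof.
by split => [/(integrable_mkcond _ mD)|hi]; [|apply/(integrable_mkcond _ mD)];
  rewrite restrict_EFin.
Qed.

Lemma measurable_section_process (h : TR * Omega -> R) s : measurable_fun D h ->
  `[0, T]%classic s -> measurable_fun setT (fun w => h (s, w)).
Proof.
move=> mh sT; have /(measurable_restrictT _ mD) mhD := mh.
rewrite (_ : (fun w => _) = (fun w => (h \_ D) (s, w))).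
  exact: (measurableT_comp mhD (pair1_measurable s)).
by apply/funext => w; rewrite patchD patchE mem_set.
Qed.

Lemma measurable_section_path (h : TR * Omega -> R) w : measurable_fun D h ->
  measurable_fun `[0, T] (fun s => h (s, w)).
Proof.
move=> mh; have /(measurable_restrictT _ mD) mhD := mh.
apply/(measurable_restrictT _ mT).
rewrite (_ : _ \_ _ = (fun s => (h \_ D) (s, w))).
  exact: (measurableT_comp mhD (pair2_measurable w)).
by apply/funext => s; rewrite patchD.
Qed.

(** By Tonelli, the integral of (f y)^2 is the integral of f^2 times the second moment of y at each
    time, hence at most M times the integral of f^2. *)
Lemma sqintegrable_process (f : TR -> R) (y : TR * Omega -> R) (M : R) :
  sqintegrable mu `[0, T] f -> measurable_fun D y ->
  (forall s, `[0, T]%classic s -> sqintegrable P setT (fun w => y (s, w)) /\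
     \int[P]_w (y (s, w) ^+ 2) <= M) ->
  sqintegrable (mu \x P)%E D (fun z => f z.1 * y z).
Proof.
move=> [mf f2] my yM.
have mf1 : measurable_fun D (fun z => f z.1).
  apply/(measurable_restrictT _ mD); rewrite (_ : _ \_ _ = (f \_ `[0, T]) \o fst).
    by apply: measurableT_comp measurable_fst; apply/(measurable_restrictT _ mT).
  by apply/funext => -[s w]; rewrite patchD/= !patchE.
have mfy : measurable_fun D (fun z => f z.1 * y z) by exact: measurable_funM.
have mfy2 : measurable_fun D (fun z => (f z.1 * y z) ^+ 2) by exact: measurable_funX.
split => //; apply/integrable_patchD.
have mh : measurable_fun setT (EFin \o ((fun z => (f z.1 * y z) ^+ 2) \_ D)).
  by apply/measurable_EFinP/(measurable_restrictT _ mD).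
apply/integrable12ltyP => //.
have [_] := integrableP _ _ _ (integrable_RZ mT M f2); apply: le_lt_trans.
rewrite [leRHS]integral_mkcond; apply: ge0_le_integral => //.
- by move=> s _; exact: integral_ge0.
- apply: (measurable_fun_fubini_tonelli_F
    (abse \o (EFin \o ((fun z => (f z.1 * y z) ^+ 2) \_ D)))) => /=.
    exact: measurableT_comp.
  by move=> z; rewrite lee_fin.
- apply/(measurable_restrictT _ mT).
  by apply: measurableT_comp => //; apply/measurable_EFinP;
    apply: measurable_funM => //; exact: measurable_funX.
move=> s _; rewrite [leRHS]patchE.
have [sT|sT] := boolP (s \in `[0, T]%classic); last first.
  rewrite (eq_integral (cst 0%E)) ?integral0// => w _ /=.
  by rewrite patchD patchE (negbTE sT) normr0.
have [[my' y2] yM'] := yM s (set_mem sT).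
have y0 : 0 <= \int[P]_w (y (s, w) ^+ 2) by apply: Rintegral_ge0 => w _; exact: sqr_ge0.
have M0 : 0 <= M := le_trans y0 yM'.
rewrite (eq_integral (fun w => (f s ^+ 2)%:E * (y (s, w) ^+ 2)%:E)%E); last first.
  by move=> w _ /=; rewrite patchD patchE sT ger0_norm ?sqr_ge0// exprMn EFinM.
rewrite integralZl//= -[X in (_ * X)%E]fineK; last exact: integrable_fin_num y2.
have Mf : `|M * f s ^+ 2| = M * f s ^+ 2 by rewrite ger0_norm// mulr_ge0 ?sqr_ge0.
rewrite -EFinM /= Mf lee_fin mulrC.
by apply: ler_wpM2r; [exact: sqr_ge0|exact: yM'].
Qed.

Section fubini.
Variable h : TR * Omega -> R.
Hypothesis sh : sqintegrable (mu \x P)%E D h.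

Let mh : measurable_fun D h. Proof. by case: sh. Qed.

Lemma process_ae_sqintegrable :
  {ae P, forall w, sqintegrable mu `[0, T] (fun s => h (s, w))}.
Proof.
have [_ /integrable_patchD h2] := sh.
have := ae_integrable2 h2; apply: aeS => w iw; split.
  exact: measurable_section_path.
apply/(integrable_mkcond _ mT); rewrite restrict_EFin.
by apply: (eq_Rintegrable _ _ iw) => // s _; rewrite patchD.
Qed.

(** Cauchy-Schwarz against the constant 1. The absolute value of T covers a negative T, for which
    the interval is empty. *)
Let finT (f : TR -> R) : sqintegrable mu `[0, T] f ->
  mu.-integrable `[0, T] (EFin \o f) /\
  (\int[mu]_(s in `[0, T]) f s) ^+ 2 <=
  `|T| * \int[mu]_(s in `[0, T]) (f s ^+ 2).
Proof.
move=> sf; have s1 : sqintegrable mu `[0, T] (fun=> 1).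
  split => //; apply: (@bounded_itv_integrable R T _ _ 1) => //.
  by move=> s _; rewrite expr1n normr1.
have := cauchy_schwarz mT s1 sf; have := sqintegrable_mul mT s1 sf.
move=> f1 CS; split; first by apply: (eq_Rintegrable mT _ f1) => s _; rewrite mul1r.
move: CS; under eq_Rintegral do rewrite mul1r.
move=> CS; apply: (le_trans CS); rewrite ler_wpM2r//.
  by apply: Rintegral_ge0 => s _; exact: sqr_ge0.
rewrite expr1n Rintegral_cst// mul1r /= lebesgue_measure_itv/= lte_fin.
by case: ifP => T0; rewrite /= ?subr0 ?ler_norm.
Qed.

Let Rint_patch w : \int[mu]_(s in `[0, T]) h (s, w) = \int[mu]_s (h \_ D) (s, w).
Proof. by rewrite Rintegral_mkcond; apply: eq_Rintegral => s _; rewrite patchD. Qed.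

Lemma sqintegrable_process_integral :
  sqintegrable P setT (fun w => \int[mu]_(s in `[0, T]) h (s, w)).
Proof.
have mhD : measurable_fun setT (h \_ D) by apply/(measurable_restrictT _ mD).
have mI : measurable_fun setT (fun w => \int[mu]_(s in `[0, T]) h (s, w)).
  under eq_fun do rewrite Rint_patch.
  exact: measurable_Rintegral_section2.
split => //; have [_ /integrable_patchD h2] := sh.
have i2 := integrable_RZ measurableT `|T| (integrable_Rintegral_section2 h2).
apply/integrableP; split; first by apply/measurable_EFinP; exact: measurable_funX.
have /integrableP[_] := i2; apply: le_lt_trans; apply: ae_ge0_le_integral => //.
- by apply: measurableT_comp => //; apply/measurable_EFinP; exact: measurable_funX.
- by apply: measurableT_comp => //; case/integrableP: i2.
apply: aeS process_ae_sqintegrable => w hw _.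
have [_ le2] := finT hw; rewrite /= lee_fin ger0_norm ?sqr_ge0//.
apply: (le_trans le2); rewrite (le_trans _ (ler_norm _))//.
rewrite le_eqVlt; apply/predU1P; left; congr (_ * _).
by rewrite Rintegral_mkcond; apply: eq_Rintegral => s _; rewrite patchD.
Qed.

(** Fubini for xi(w) h(s, w). On the null set of paths with a non-integrable section, xi cannot be
    moved under the integral sign, so the first equality holds almost everywhere only. *)
Lemma process_integral_mul (xi : Omega -> R) : sqintegrable P setT xi ->
  \int[P]_w (xi w * \int[mu]_(s in `[0, T]) h (s, w)) =
  \int[mu]_(s in `[0, T]) \int[P]_w (xi w * h (s, w)).
Proof.
move=> sxi; have s1 : sqintegrable mu `[0, T] (fun=> 1).
  split => //; apply: (@bounded_itv_integrable R T _ _ 1) => //.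
  by move=> s _; rewrite expr1n normr1.
have sxi1 : sqintegrable (mu \x P)%E D (fun z => 1 * xi z.2).
  apply: (@sqintegrable_process _ (fun z => xi z.2) (\int[P]_w (xi w ^+ 2)) s1) => //.
  apply: measurable_funTS; apply: measurableT_comp measurable_snd.
  by case: sxi.
have xhi := sqintegrable_mul mD sxi1 sh.
have {xhi}xhi : (mu \x P)%E.-integrable setT (EFin \o ((fun z => xi z.2 * h z) \_ D)).
  apply/integrable_patchD; apply: (eq_Rintegrable mD _ xhi) => z _.
  by rewrite mul1r.
transitivity (\int[P]_w (\int[mu]_s (((fun z => xi z.2 * h z) \_ D) (s, w)))).
  congr fine; apply: ae_eq_integral => //.
  - apply/measurable_EFinP; apply: measurable_funM; first by case: sxi.
    by case: sqintegrable_process_integral.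
  - by case/integrableP: (integrable_Rintegral_section2 xhi).
  apply: aeS process_ae_sqintegrable => w hw _; congr EFin.
  have [hi _] := finT hw.
  rewrite -RintegralZl// Rintegral_mkcond; apply: eq_Rintegral => s _.
  by rewrite patchD.
rewrite -(Rintegral_fubini xhi) [RHS]Rintegral_mkcond; apply: eq_Rintegral => s _.
rewrite patchE; have [sT|sT] := boolP (s \in `[0, T]%classic).
  by apply: eq_Rintegral => w _; rewrite patchD patchE sT.
rewrite /Rintegral (eq_integral (cst 0%E)) ?integral0// => w _ /=.
by rewrite patchD patchE (negbTE sT).
Qed.

End fubini.
End process_integral.

Lemma Rintegral_probability_cst (R : realType) (dO : measure_display)
    (Omega : measurableType dO) (P : probability Omega R) (c : R) :
  \int[P]_w c = c.
Proof. by have := expectation_cst P c; rewrite unlock /Rintegral => ->. Qed.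

Section state_moments.
Context (R : realType) (dO : measure_display) (Omega : measurableType dO).
Context (P : probability Omega R) (T : R) (k n : nat) (W : R -> Omega -> 'cV[R]_k).
Context (A : R -> 'M[R]_n) (C : R) (Phi : R -> R -> 'M[R]_n).
Context (G : R -> 'M[R]_(n, k)) (g : R -> 'cV[R]_n) (x : 'cV[R]_n).
Context (X : R -> Omega -> 'cV[R]_n).
Notation mu := (@lebesgue_measure R).
Let TR := measurableTypeR R.
Hypothesis T0 : 0 <= T.
Hypothesis bW : brownian_motion P T W.
Hypothesis C0 : 0 <= C.
Hypothesis Ai : mxintegrable `[0, T] A.
Hypothesis AC : {ae mu, forall t, `[0, T]%classic t -> l1norm (A t) <= C}.
Hypothesis PhiE : forall s, 0 <= s <= T ->
  (forall i j, {within `[0, T], continuous (fun t => Phi t s i j)}) /\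
  forall t, 0 <= t <= T ->
    Phi t s = 1%:M + mxint_from_to s t (fun r => A r *m Phi r s).
Hypothesis sG : forall i l, sqintegrable mu `[0, T] (fun r => G r i l).
Hypothesis gi : mxintegrable `[0, T] g.
Hypothesis mX : forall i, measurable_fun (`[0, T]%classic `*` setT : set (TR * Omega))
  (fun z => X z.1 z.2 i 0).
Hypothesis cX : {ae P, forall w, forall i,
  {within `[0, T], continuous (fun t => X t w i 0)}}.
Context (Y : R -> Omega -> 'cV[R]_n).
Hypothesis YE : forall t w,
  Y t w = X t w - x - mxint `[0, t] (fun r => A r *m X r w) - mxint `[0, t] g.
Hypothesis itoY : forall t, 0 <= t <= T -> is_ito_integral P W t G (Y t).

Let mitv a b : measurable (`[a, b]%classic : set TR).
Proof. by []. Qed.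

Let mD t : measurable (`[0, t]%classic `*` setT : set (TR * Omega)).
Proof. exact: measurableX. Qed.

(** The variable upper bound becomes a condition on the integrand: [H] is jointly measurable in (t,
    w, r), and its integral over r is measurable in (t, w). *)
Let measurable_drift i : measurable_fun (`[0, T]%classic `*` setT : set (TR * Omega))
  (fun z => (mxint `[0, z.1] (fun r => A r *m X r z.2)) i 0).
Proof.
pose D : set (TR * Omega) := `[0, T]%classic `*` setT.
pose At j : TR -> R := (fun r => A r i j) \_ `[0, T].
pose Xt j : TR * Omega -> R := (fun z => X z.1 z.2 j 0) \_ D.
have mAt j : measurable_fun setT (At j).
  apply/(measurable_restrictT _ (mitv 0 T)).
  exact: (mxintegrable_measurable Ai).
have mXt j : measurable_fun setT (Xt j) by apply/(measurable_restrictT _ (mD T)).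
pose H (z : (TR * Omega) * TR) : R :=
  if (0 <= z.2) && (z.2 <= z.1.1) then \sum_j At j z.2 * Xt j (z.2, z.1.2) else 0.
have mH : measurable_fun setT H.
  apply: measurable_fun_ifT => //.
  - apply: measurable_and.
      exact: measurable_fun_ler (measurable_cst _) measurable_snd.
    apply: measurable_fun_ler measurable_snd _.
    exact: measurableT_comp measurable_fst measurable_fst.
  - apply: measurable_sum => j; apply: measurable_funM.
      exact: measurableT_comp (mAt j) measurable_snd.
    apply: measurableT_comp (mXt j) _; apply/measurable_fun_pair.
      exact: measurable_snd.
    exact: measurableT_comp measurable_snd measurable_fst.
apply: (eq_measurable_fun (fun z : TR * Omega => \int[mu]_r H (z, r))); last first.
  by apply: measurable_funTS; exact: measurable_Rintegral_section1.
move=> [t w] /set_mem[/= tT _]; rewrite mxE [RHS]Rintegral_mkcond.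
apply: eq_Rintegral => r _; rewrite /H patchE /=.
have -> : (r \in `[0, t]%classic) = (0 <= r) && (r <= t).
  by apply/idP/idP; rewrite inE/= in_itv.
case: ifP => // /andP[r0 rt]; rewrite mxE; apply: eq_bigr => j _.
have rT : `[0, T]%classic r.
  by move: tT; rewrite /= !in_itv/= r0 => /andP[_ tT]; exact: le_trans rt tT.
by rewrite /At /Xt !patchE mem_set//= mem_set.
Qed.

Let measurable_noise i : measurable_fun (`[0, T]%classic `*` setT : set (TR * Omega))
  (fun z => Y z.1 z.2 i 0).
Proof.
have mg : measurable_fun (`[0, T]%classic `*` setT : set (TR * Omega))
    (fun z => (mxint `[0, z.1] g) i 0).
  have [/(_ i 0) mg _] := mxprimitive_bounded0 gi.
  apply/(measurable_restrictT _ (mD T)).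
  rewrite (_ : _ \_ _ = ((fun t => (mxint `[0, t] g) i 0) \_ `[0, T]) \o fst).
    by apply: measurableT_comp measurable_fst; apply/(measurable_restrictT _ (mitv 0 T)).
  apply/funext => -[s w]; rewrite /= !patchE.
  have [sT|sT] := boolP (s \in `[0, T]%classic).
    by rewrite mem_set//; split => //; exact: set_mem.
  by rewrite memNset// => -[/= sT' _]; move/negP: sT; apply; exact: mem_set.
rewrite (_ : (fun z => _) = (fun z : TR * Omega => X z.1 z.2 i 0 - x i 0
  - (mxint `[0, z.1] (fun r => A r *m X r z.2)) i 0 - (mxint `[0, z.1] g) i 0)).
  apply: measurable_funB => //; apply: measurable_funB; last exact: measurable_drift.
  exact: measurable_funB.
by apply/funext => z; rewrite YE !mxE.
Qed.

Let S r := G r *m (G r)^T.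

Let Si : mxintegrable `[0, T] S.
Proof.
move=> i j; apply: (@eq_Rintegrable _ _ _ mu _ (mitv 0 T)
  (fun r => \sum_l G r i l * G r j l)).
  by move=> r _; rewrite mxE; apply: eq_bigr => l _; rewrite mxE.
apply: (@integrable_Rsum _ _ _ mu _ (mitv 0 T)) => l _.
exact: (sqintegrable_mul (mitv 0 T) (sG i l) (sG j l)).
Qed.

Let sY t i : 0 <= t <= T -> sqintegrable P setT (fun w => Y t w i 0).
Proof. by move=> tT; exact (ito_sqintegrable bW i tT sG (itoY tT)). Qed.

Let mean_noise t i : 0 <= t <= T -> \int[P]_w Y t w i 0 = 0.
Proof. by move=> tT; exact (ito_mean bW i tT sG (itoY tT)). Qed.

Let cov_noise s t i j : 0 <= s <= T -> 0 <= t <= T ->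
  \int[P]_w (Y s w i 0 * Y t w j 0) = (mxint `[0, Num.min s t] S) i j.
Proof.
move=> sT tT.
have minT : Num.min s t <= T by rewrite ge_min; case/andP: sT => _ ->.
have sub : `[0, Num.min s t]%classic `<=` (`[0, T]%classic : set TR).
  by apply: subset_itvl; rewrite bnd_simp.
rewrite (ito_covariance bW i j sT tT sG sG (itoY sT) (itoY tT)) mxE.
rewrite -(Rintegral_sum (mitv 0 (Num.min s t))); last first.
  move=> l _; apply: (integrableS (mitv 0 T) (mitv 0 (Num.min s t)) sub).
  exact: (sqintegrable_mul (mitv 0 T) (sG i l) (sG j l)).
apply: eq_Rintegral => r _; rewrite mxE; apply: eq_bigr => l _.
by rewrite mxE.
Qed.

Let N s := Phi 0 s *m A s.

Let Ni : mxintegrable `[0, T] N.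
Proof. exact (integrable_inv_mul T0 C0 Ai AC PhiE Ai). Qed.

(** Phi(0, .) is bounded and A is essentially bounded, so N is essentially bounded on a segment of
    finite measure. *)
Let sN i j : sqintegrable mu `[0, T] (fun s => N s i j).
Proof.
have [_ [M LM]] := transition_inv_mxbounded T0 C0 Ai AC PhiE.
have mN : measurable_fun `[0, T] (fun s => N s i j) by exact: (mxintegrable_measurable Ni).
split => //; apply/integrableP; split.
  by apply/measurable_EFinP; exact: measurable_funX.
apply: (@le_lt_trans _ _ (((M * C) ^+ 2)%:E * mu `[0%R, T])%E); last first.
  rewrite lebesgue_measure_itv/=; case: ifPn => _; rewrite ?mule0//.
  by rewrite -EFinB -EFinM ltry.
apply: integral_le_bound => //.
- by apply/measurable_EFinP; exact: measurable_funX.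
- by rewrite lee_fin sqr_ge0.
apply: aeS AC => s As sT; rewrite /= lee_fin ger0_norm ?sqr_ge0//.
have NMC : `|N s i j| <= M * C.
  apply: (le_trans (l1norm_entry _ _ _)); apply: (le_trans (ler_l1normM _ _)).
  by rewrite ler_pM ?l1norm_ge0 ?LM ?As.
by rewrite -(real_normK (num_real (N s i j))) ler_pXn2r ?nnegrE// (le_trans _ NMC).
Qed.

Let zeta t w : 'cV[R]_n := Phi 0 t *m Y t w + mxint `[0, t] (fun s => N s *m Y s w).

Let segment_le t : 0 <= t <= T -> `[0, t]%classic `<=` (`[0, T]%classic : set TR).
Proof. by case/andP => _ tT; apply: subset_itvl; rewrite bnd_simp. Qed.

(** The second moment of the j-th coordinate of Y(s) is the integral of S_jj over [[0, s]], bounded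
    uniformly in s by the integral of |S_jj| over [[0, T]]. *)
Let sNY t i : 0 <= t <= T ->
  sqintegrable (mu \x P)%E (`[0, t]%classic `*` setT : set (TR * Omega))
    (fun z => (N z.1 *m Y z.1 z.2) i 0).
Proof.
move=> tT; have sub := segment_le tT.
apply: (eq_sqintegrable (mD t) (f := fun z => \sum_j N z.1 i j * Y z.1 z.2 j 0)).
  by move=> z _; rewrite mxE.
apply: sqintegrable_sum => // j _.
have [mN N2] := sN i j.
apply: (@sqintegrable_process R _ Omega P t (fun s => N s i j) (fun z => Y z.1 z.2 j 0)
  (\int[mu]_(s in `[0, T]) `|S s j j|)).
- split; first exact: measurable_funS mN.
  exact: integrableS N2.
- apply: measurable_funS (measurable_noise j) => //.
  by move=> z [/= zt _]; split => //; exact: sub.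
move=> s st; have sT : 0 <= s <= T by have := sub _ st; rewrite /= in_itv.
split; first exact: sY.
under eq_Rintegral do rewrite expr2.
rewrite cov_noise// minxx mxE; apply: le_trans (ler_norm _) _.
by apply: (Rprimitive_bounded (Si j j)); case/andP: sT.
Qed.

Let szeta t i : 0 <= t <= T -> sqintegrable P setT (fun w => zeta t w i 0).
Proof.
move=> tT; have sI := sqintegrable_process_integral (sNY i tT).
apply: (eq_sqintegrable measurableT (f := fun w => \sum_j Phi 0 t i j * Y t w j 0 +
    \int[mu]_(s in `[0, t]) (N s *m Y s w) i 0)).
  by move=> w _; rewrite !mxE.
apply: sqintegrableD => //; apply: sqintegrable_sum => // j _.
by apply: sqintegrableZ => //; exact: sY.
Qed.

(** Reads off E[xi zeta(t)] from the correlations e(s) of xi with the noise. It is applied with xi =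
    1 for the mean, xi = Y(s) for the mixed covariance, and xi a coordinate of zeta(T) for the
    covariance itself. *)
Let zeta_mul t (xi : Omega -> R) (e : R -> 'cV[R]_n) i : 0 <= t <= T ->
  sqintegrable P setT xi ->
  (forall s j, 0 <= s <= T -> \int[P]_w (xi w * Y s w j 0) = e s j 0) ->
  \int[P]_w (xi w * zeta t w i 0) =
  (Phi 0 t *m e t + mxint `[0, t] (fun s => N s *m e s)) i 0.
Proof.
move=> tT sxi eE; have sub := segment_le tT.
have sI := sqintegrable_process_integral (sNY i tT).
have xY s j : 0 <= s <= T -> P.-integrable setT (EFin \o (fun w => xi w * Y s w j 0)).
  by move=> sT; apply: (sqintegrable_mul measurableT sxi); exact: sY.
have lin (a : 'I_n -> R) s : 0 <= s <= T ->
    P.-integrable setT (EFin \o (fun w => \sum_j a j * (xi w * Y s w j 0))) /\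
    \int[P]_w (\sum_j a j * (xi w * Y s w j 0)) = \sum_j a j * e s j 0.
  move=> sT; split.
    by apply: integrable_Rsum => // j _; apply: integrable_RZ => //; exact: xY.
  rewrite Rintegral_sum//; last by move=> j _; apply: integrable_RZ => //; exact: xY.
  by apply: eq_bigr => j _; rewrite -eE// RintegralZl//; exact: xY.
have [i1 E1] := lin (Phi 0 t i) t tT.
transitivity (\int[P]_w (\sum_j Phi 0 t i j * (xi w * Y t w j 0) +
    xi w * \int[mu]_(s in `[0, t]) (N s *m Y s w) i 0)).
  apply: eq_Rintegral => w _; rewrite !mxE mulrDr mulr_sumr; congr (_ + _).
  by apply: eq_bigr => j _; ring.
rewrite RintegralD//; last exact (sqintegrable_mul measurableT sxi sI).
rewrite E1 (process_integral_mul (sNY i tT) sxi) !mxE; congr (_ + _).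
apply: eq_Rintegral => s /set_mem st; rewrite mxE.
have sT : 0 <= s <= T by have := sub _ st; rewrite /= in_itv.
have [_ <-] := lin (N s i) s sT; apply: eq_Rintegral => w _.
by rewrite mxE mulr_sumr; apply: eq_bigr => j _; rewrite mulrCA.
Qed.

Let mean_zeta t i : 0 <= t <= T -> \int[P]_w zeta t w i 0 = 0.
Proof.
move=> tT; transitivity (\int[P]_w (1 * zeta t w i 0)).
  by apply: eq_Rintegral => w _; rewrite mul1r.
rewrite (@zeta_mul t (fun=> 1) (fun=> 0) i tT (sqintegrable_cst P measurableT 1)).
  rewrite mulmx0 add0r mxE /Rintegral (eq_integral (cst 0%E)) ?integral0// => s _.
  by rewrite mulmx0 mxE.
move=> s j sT; rewrite mxE -[RHS](mean_noise j sT).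
by apply: eq_Rintegral => w _; rewrite mul1r.
Qed.

Let TT : 0 <= T <= T. Proof. by apply/andP; split. Qed.

(** The correlations of Y(s) with the noise are integrals of S up to min(r, s), and
    [mxint_min_primitive] evaluates their combination. *)
Let noise_zeta s j i : 0 <= s <= T ->
  \int[P]_w (Y s w j 0 * zeta T w i 0) =
  (mxint `[0, s] (fun r => Phi 0 r *m S r)) i j.
Proof.
move=> sT; rewrite (@zeta_mul T _ (fun r => col j (mxint `[0, Num.min r s] S)) i TT (sY j sT)).
  rewrite -(mxint_min_primitive T0 C0 Ai AC PhiE Si sT).
  rewrite min_r; last by case/andP: sT.
  rewrite mxE [RHS]mxE; congr (_ + _).
    by rewrite mxE [RHS]mxE; apply: eq_bigr => l _; congr (_ * _); rewrite mxE.
  rewrite mxE [RHS]mxE; apply: eq_Rintegral => r _.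
  by rewrite mxE [RHS]mxE; apply: eq_bigr => l _; congr (_ * _); rewrite mxE.
move=> r l rT; rewrite [RHS]mxE -(cov_noise l j rT sT).
by apply: eq_Rintegral => w _; rewrite mulrC.
Qed.

(** The mixed covariances just computed serve as the function e of [zeta_mul], and
    [mxint_covariance] closes the computation. *)
Let cov_zeta i j :
  \int[P]_w (zeta T w i 0 * zeta T w j 0) =
  (mxint `[0, T] (fun r => Phi 0 r *m S r *m (Phi 0 r)^T)) i j.
Proof.
pose Pm s := mxint `[0, s] (fun r => Phi 0 r *m S r).
rewrite (@zeta_mul T _ (fun r => \col_l Pm r i l) j TT (szeta i TT)); last first.
  move=> r l rT; rewrite [RHS]mxE -(noise_zeta l i rT).
  by apply: eq_Rintegral => w _; rewrite mulrC.
rewrite -(mxint_covariance T0 C0 Ai AC PhiE Si) mxE [RHS]mxE; congr (_ + _).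
  by rewrite mxE [RHS]mxE; apply: eq_bigr => l _; rewrite [RHS]mulrC; congr (_ * _);
    [rewrite [RHS]mxE|rewrite [LHS]mxE].
rewrite mxE [RHS]mxE; apply: eq_Rintegral => r _.
by rewrite mxE [RHS]mxE; apply: eq_bigr => l _; rewrite [RHS]mulrC; congr (_ * _);
    [rewrite [RHS]mxE|rewrite [LHS]mxE].
Qed.

Let mean t := Phi t 0 *m (x + mxint `[0, t] (fun r => Phi 0 r *m g r)).

(** [variation_of_constants] is applied to each continuous path and multiplied by Phi(t, 0). The
    exceptional null set is common to all times. *)
Let state_decomposition :
  {ae P, forall w, forall t, 0 <= t <= T -> X t w = mean t + Phi t 0 *m zeta t w}.
Proof.
apply: aeS cX => w cXw t tT.
have Xb : mxbounded `[0, T] (fun t => X t w).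
  by apply: continuous_mxbounded => i j; rewrite (ord1 j); exact: cXw.
have := variation_of_constants T0 C0 Ai AC PhiE Xb gi (fun t _ => YE t w) tT.
move=> /(congr1 (mulmx (Phi t 0))).
by rewrite mulmxA (transition_mulV T0 C0 Ai AC PhiE)// mul1mx mulmxDr => ->.
Qed.

Let sum_Phi_zeta_sqintegrable t i : 0 <= t <= T ->
  sqintegrable P setT (fun w => (Phi t 0 *m zeta t w) i 0).
Proof.
move=> tT; apply: (eq_sqintegrable measurableT
  (f := fun w => \sum_j Phi t 0 i j * zeta t w j 0)).
  by move=> w _; rewrite mxE.
by apply: sqintegrable_sum => // j _; apply: sqintegrableZ => //; exact: szeta.
Qed.

Let mean_Phi_zeta t i : 0 <= t <= T -> \int[P]_w (Phi t 0 *m zeta t w) i 0 = 0.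
Proof.
move=> tT; under eq_Rintegral do rewrite mxE.
have zi j := sqintegrable_integrable measurableT (szeta j tT).
rewrite Rintegral_sum//; last by move=> j _; exact: integrable_RZ.
by rewrite big1// => j _; rewrite RintegralZl// mean_zeta// mulr0.
Qed.

Let mXt t i : 0 <= t <= T -> measurable_fun setT (fun w => X t w i 0).
Proof.
move=> tT; apply: (measurable_section_process (T := T) (h := fun z => X z.1 z.2 i 0)).
  exact: mX.
by rewrite /= in_itv.
Qed.

Lemma mean_stateE t i : 0 <= t <= T ->
  P.-integrable setT (EFin \o (fun w => X t w i 0)) /\
  \int[P]_w X t w i 0 =
  (Phi t 0 *m (x + mxint `[0, t] (fun r => Phi 0 r *m g r))) i 0.
Proof.
move=> tT; rewrite -/(mean t); have sz := sum_Phi_zeta_sqintegrable i tT.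
have ci : P.-integrable setT (EFin \o (fun=> mean t i 0)).
  exact: finite_measure_integrable_cst.
have zi := sqintegrable_integrable measurableT sz.
have mzi := integrable_RD measurableT ci zi.
have XE : {ae P, forall w, setT w ->
    (mean t i 0 + (Phi t 0 *m zeta t w) i 0)%:E = (X t w i 0)%:E}.
  by apply: aeS state_decomposition => w Xw _; rewrite Xw// [in RHS]mxE.
have mXE : measurable_fun setT (EFin \o (fun w => X t w i 0)).
  by apply/measurable_EFinP; exact: mXt.
split; first exact: ae_eq_integrable mXE XE mzi.
transitivity (\int[P]_w (mean t i 0 + (Phi t 0 *m zeta t w) i 0)).
  congr fine; apply/esym/ae_eq_integral => //; exact: measurable_int mzi.
rewrite RintegralD// mean_Phi_zeta// addr0.
exact: Rintegral_probability_cst.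
Qed.

(** Bias-variance decomposition: the cross terms are multiples of the mean of Phi(T, 0) zeta(T),
    which is 0, and the square term gives the trace of its covariance. *)
Lemma mean_square_stateE (v : 'cV[R]_n) :
  (\int[P]_w (sqnorm (X T w - v))%:E =
   (sqnorm (Phi T 0 *m (x + mxint `[0, T] (fun r => Phi 0 r *m g r)) - v) +
    \tr (mxint `[0, T] (fun s => Phi T s *m G s *m (G s)^T *m (Phi T s)^T)))%:E)%E.
Proof.
rewrite -/(mean T).
pose Z w := Phi T 0 *m zeta T w.
have sZ i : sqintegrable P setT (fun w => Z w i 0) by exact: sum_Phi_zeta_sqintegrable.
have Zi i := sqintegrable_integrable measurableT (sZ i).
pose f w := \sum_i ((mean T - v) i 0 ^+ 2 + 2 * (mean T - v) i 0 * Z w i 0 + Z w i 0 ^+ 2).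
have t1 i : P.-integrable setT (EFin \o (fun=> (mean T - v) i 0 ^+ 2)).
  exact: finite_measure_integrable_cst.
have t2 i : P.-integrable setT (EFin \o (fun w => 2 * (mean T - v) i 0 * Z w i 0)).
  exact: integrable_RZ.
have t3 i : P.-integrable setT (EFin \o (fun w => Z w i 0 ^+ 2)) by case: (sZ i).
have t12 i := integrable_RD measurableT (t1 i) (t2 i).
have t123 i := integrable_RD measurableT (t12 i) (t3 i).
have fi : P.-integrable setT (EFin \o f) by exact: integrable_Rsum.
transitivity (\int[P]_w (f w)%:E)%E.
  apply: ae_eq_integral => //.
  - apply/measurable_EFinP; rewrite /sqnorm.
    apply: measurable_sum => i; apply: measurable_sum => j.
    rewrite (ord1 j); apply: measurable_funX.
    rewrite (_ : (fun w => _) = (fun w => X T w i 0 - v i 0)).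
      by apply: measurable_funB => //; exact: mXt.
    by apply/funext => w; rewrite !mxE.
  - exact: measurable_int fi.
  apply: aeS state_decomposition => w Xw _; rewrite Xw// sqnorm_cV; congr EFin.
  apply: eq_bigr => i _; rewrite addrAC mxE -/(Z w) sqrrD.
  by rewrite mulr_natl mulrnAl.
rewrite -[LHS]fineK; last exact: integrable_fin_num fi.
congr EFin; rewrite -/(Rintegral _ _ _) Rintegral_sum//.
rewrite (eq_bigr (fun i => (mean T - v) i 0 ^+ 2 + \int[P]_w (Z w i 0 ^+ 2))); last first.
  move=> i _; rewrite RintegralD// RintegralD// RintegralZl// mean_Phi_zeta//.
  by rewrite mulr0 addr0 Rintegral_probability_cst.
rewrite big_split/= -sqnorm_cV; congr (_ + _).
have zz j l := sqintegrable_mul measurableT (szeta j TT) (szeta l TT).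
(* Phi(T, s) = Phi(T, 0) Phi(0, s) moves the s-independent factors out of the integral, leaving the
   covariance of zeta(T). *)
have -> : mxint `[0, T] (fun s => Phi T s *m G s *m (G s)^T *m (Phi T s)^T) =
    Phi T 0 *m mxint `[0, T] (fun r => Phi 0 r *m S r *m (Phi 0 r)^T) *m (Phi T 0)^T.
  have Lb := transition_inv_mxbounded T0 C0 Ai AC PhiE.
  have LSLi : mxintegrable `[0, T] (fun r => Phi 0 r *m S r *m (Phi 0 r)^T).
    apply: mxintegrable_mul_bounded => //; last exact: mxbounded_tr.
    exact: mxintegrable_bounded_mul.
  rewrite -(mxint_mull (mitv 0 T) _ LSLi) -mxint_mulr//; last first.
    apply: mxintegrable_bounded_mul => //; exact: mxbounded_cst.
  apply: eq_mxint => s; rewrite /= in_itv/= => sT.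
  by rewrite (transition_mul T0 C0 Ai AC PhiE sT TT) trmx_mul /S !mulmxA.
rewrite /mxtrace; apply: eq_bigr => i _.
rewrite mxE; under [RHS]eq_bigr do rewrite mxE [_^T _ _]mxE mulr_suml.
have -> : \int[P]_w (Z w i 0 ^+ 2) = \sum_j \sum_l
    \int[P]_w ((Phi T 0 i j * zeta T w j 0) * (Phi T 0 i l * zeta T w l 0)).
  rewrite -Rintegral_mul_sum//; last 2 first.
  - by move=> j; apply: sqintegrableZ => //; exact: szeta.
  - by move=> j; apply: sqintegrableZ => //; exact: szeta.
  by apply: eq_Rintegral => w _; rewrite expr2 /Z mxE.
rewrite exchange_big; apply: eq_bigr => l _; apply: eq_bigr => j _.
rewrite -cov_zeta -RintegralZl// -RintegralZr//.
  by apply: eq_Rintegral => w _; ring.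
exact: integrable_RZ.
Qed.

End state_moments.

(** * The parameter set *)

Section compact_tuple.
Context (R : realType) (d : nat) (K : set (tupleR R d)).
Let row (b : tupleR R d) : 'rV[R]_d := \row_i tnth b i.
Hypothesis cK : compact [set row b | b in K].

Let measurable_box (I : 'I_d -> set (measurableTypeR R)) :
  (forall i, measurable (I i)) ->
  measurable [set t : tupleR R d | forall i, I i (tnth t i)].
Proof.
move=> mI.
rewrite (_ : mkset _ = \bigcap_(i in setT) ((fun t : tupleR R d => tnth t i) @^-1` I i)).
  apply: fin_bigcap_measurable; first exact: finite_finset.
  by move=> i _; rewrite -[X in measurable X]setTI; exact: measurable_tnth.
by apply/seteqP; split => [t /= h i _|t h i]; exact: h.
Qed.

(** The norm on row vectors is the maximum norm, so a ball is a product of intervals and is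
    measurable for the product sigma-algebra. *)
Let measurable_ball_row (c : 'rV[R]_d) (e : R) : 0 < e ->
  measurable (row @^-1` ball c e).
Proof.
move=> e0; rewrite (_ : _ @^-1` _ = [set t : tupleR R d | forall i, ball (c 0 i) e (tnth t i)]).
  by apply: (measurable_box (I := fun i => ball (c 0 i) e)) => i; exact: measurable_ball.
apply/seteqP; split => [t /= [_ h] i|t /= h].
  by have := h 0 i; rewrite mxE.
split=> // i j; rewrite (ord1 i) mxE; exact: h.
Qed.

Let finite_net (e : R) : 0 < e -> exists F : set 'rV[R]_d,
  [/\ finite_set F, F `<=` [set row b | b in K] &
      K `<=` \bigcup_(c in F) (row @^-1` ball c e)].
Proof.
move=> e0; move: cK; rewrite compact_cover => /(_ _ [set row b | b in K]
  (fun c => (ball c e)^°)).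
case=> [i _||F FK Kcov].
- exact: open_interior.
- by move=> c Kc; exists c => //; exact: nbhsx_ballx.
exists [set` F]; split => [|c cF|b Kb]; [exact: finite_fset| |].
  by have := FK _ cF; exact: set_mem.
have [c cF bc] := Kcov (row b) (ex_intro2 _ _ b Kb erefl).
by exists c => //; exact: interior_subset.
Qed.

(** A compact set is closed, so it equals the intersection over n of the finite unions of balls of
    radius 1 / (n + 1) centred at its points. *)
Lemma measurable_compact_tuple : measurable K.
Proof.
have n0 (n : nat) : 0 < n.+1%:R^-1 :> R by rewrite invr_gt0.
pose F n := cid (finite_net (n0 n)).
rewrite (_ : K = \bigcap_n \bigcup_(c in projT1 (F n))
    (row @^-1` ball c (n.+1%:R^-1))).
  apply: bigcapT_measurable => n; apply: fin_bigcup_measurable; first by case: (projT2 (F n)).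
  by move=> c _; exact: measurable_ball_row.
apply/seteqP; split => [b Kb n _|b Fb].
  by case: (projT2 (F n)) => _ _; exact.
have : closure [set row b | b in K] (row b).
  move=> U /nbhs_ballP[e /= e0 eU].
  have [n _ ne] := near_infty_natSinv_lt (PosNum e0).
  have [c cF bc] := Fb n I.
  have [_ /(_ c cF) Kc _] := projT2 (F n).
  exists c; split => //; apply: eU; apply: ball_sym.
  by apply: le_ball bc; exact: ltW (ne n (leqnn n)).
rewrite -(closure_id _).1; last exact: compact_closed.
move=> [b' Kb' /rowP bb']; rewrite (_ : b = b')//.
by apply: eq_from_tnth => i; have := bb' i; rewrite !mxE.
Qed.

(** A bounded set lies in a cube, whose measure is a finite product of interval lengths. *)
Lemma compact_tuple_finite : (lebesgue_tuple R d K < +oo)%E.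
Proof.
have [M [Mr MK]] := compact_bounded cK.
pose I := `[- (`|M| + 1), `|M| + 1]%classic.
have MM : M < `|M| + 1 by have := ler_norm M; lra.
have KI : K `<=` [set t : tupleR R d | forall i, I (tnth t i)].
  move=> b Kb i; rewrite /I /= in_itv/= -ler_norml.
  have := MK _ MM (row b) (ex_intro2 _ _ b Kb erefl).
  apply: le_trans; rewrite [leRHS]mx_normrE.
  have := le_bigmax_cond 0 (fun ij : 'I_1 * 'I_d => `|row b ij.1 ij.2|) (j := (0, i)).
  by rewrite /= mxE; apply.
have mI : measurable (I : set (measurableTypeR R)) by exact: measurable_itv.
apply: (@le_lt_trans _ _ (lebesgue_tuple R d [set t | forall i, I (tnth t i)])).
  apply: le_measure => //; rewrite ?inE.
  - exact: measurable_compact_tuple.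
  - by exact: (measurable_box (I := fun=> I)).
rewrite (lebesgue_tuple_box (I := fun=> I))// /I lebesgue_measure_itv /=.
by case: ifP => _; rewrite -?EFinB prodEFin ltry.
Qed.
End compact_tuple.

(** * From classes on the product domain to almost every parameter *)

Section LpOn_entries.
Context d (S : measurableType d) (R : realType) (mu : {measure set S -> \bar R}).
Context (D : set S) (q r : nat) (f : S -> 'M[R]_(q, r)).
Hypothesis mD : measurable D.

Lemma LpOn2P : LpOn mu 2%:E D f <->
  forall i j, sqintegrable mu D (fun z => f z i j).
Proof.
split=> fD i j; last first.
  have [mf f2] := fD i j.
  have mfD : measurable_fun setT ((fun z => f z i j) \_ D).
    by apply/(measurable_restrictT _ mD).
  rewrite inE/=; apply/andP; split; first by rewrite inE.
  rewrite inE /finite_norm unlock /= poweR_lty//.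
  have [_] := integrableP _ _ _ f2; rewrite integral_mkcond; apply: le_lt_trans.
  rewrite le_eqVlt; apply/predU1P; left; apply: eq_integral => z _ /=.
  rewrite !patchE; case: ifPn => _ /=; last by rewrite normr0 powR0.
  by rewrite powR_mulrn// normrX.
have := fD i j; rewrite inE => /andP[mf _].
move: mf; rewrite inE/= => /(measurable_restrictT _ mD) mf.
split=> //; apply/(integrable_mkcond _ mD); rewrite restrict_EFin.
apply: (eq_Rintegrable measurableT _ (Lfun2_integrable_sqr (fD i j))) => z _.
by rewrite !patchE; case: ifP => // _; rewrite expr0n.
Qed.

Lemma LpOnoo_bounded i j : LpOn mu +oo%E D f ->
  measurable_fun D (fun z => f z i j) /\
  exists C, {ae mu, forall z, D z -> `|f z i j| <= C}.
Proof.
move=> /(_ i j); rewrite inE => /andP[mf]; rewrite inE /finite_norm unlock /= => foo.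
split; first by move: mf; rewrite inE/= => /(measurable_restrictT _ mD).
move: foo; case: ifPn => [mu0|mu0 _].
  move=> /(ess_supr_bounded (f := fun z => `|((fun z => f z i j) \_ D) z|))[C fC].
  by exists C; apply: aeS fC => z + Dz; rewrite patchE mem_set.
(* If the whole space has measure 0, every bound holds almost everywhere. *)
exists 0, setT; split => //.
by apply/eqP; rewrite eq_le measure_ge0 leNgt mu0.
Qed.

End LpOn_entries.

Lemma ae_forall_fin d (S : measurableType d) (R : realType)
    (mu : {measure set S -> \bar R}) (I : finType) (Q : I -> S -> Prop) :
  (forall i, {ae mu, forall x, Q i x}) -> {ae mu, forall x, forall i, Q i x}.
Proof. by move=> Qi; exact: filter_forall. Qed.

(** By Tonelli, the measure of the section of a null set is a nonnegative function with integral 0,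
    hence 0 for almost every y. *)
Lemma ae_section2 d1 d2 (T1 : measurableType d1) (T2 : measurableType d2) (R : realType)
    (m1 : {sigma_finite_measure set T1 -> \bar R})
    (m2 : {sigma_finite_measure set T2 -> \bar R}) (Q : T1 * T2 -> Prop) :
  {ae (m1 \x m2)%E, forall z, Q z} ->
  {ae m2, forall y, {ae m1, forall x, Q (x, y)}}.
Proof.
move=> [N [mN N0 QN]].
pose F y := (\int[m1]_x (\1_N (x, y))%:E)%E.
have mF : measurable_fun setT F by exact: indic_measurable_fun_fubini_tonelli_G.
have F0 : (\int[m2]_y F y = 0)%E.
  rewrite -indic_fubini_tonelli// -indic_fubini_tonelli1// integral_indic// setIT.
  exact: N0.
have : ae_eq m2 setT F (cst 0%E).
  apply/ae_eq_integral_abs => //.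
  rewrite -[RHS]F0; apply: eq_integral => y _; rewrite gee0_abs//.
  by apply: integral_ge0 => x _; rewrite lee_fin.
apply: aeS => y /(_ I) Fy; exists (ysection N y); split.
- exact: measurable_ysection.
- have <- : F y = 0%E by [].
  by rewrite -[RHS]/(fubini_G m1 (EFin \o \1_N) y) indic_fubini_tonelli_GE.
- move=> x /= Qx; rewrite /ysection/= inE; exact: QN.
Qed.

Section ge0_integral_ae.
Context d (S : measurableType d) (R : realType) (mu : {measure set S -> \bar R}).
Context (D : set S) (f h : S -> \bar R).
Local Open Scope ereal_scope.

(** The integral of a nonnegative function is a supremum over the simple functions below it, which
    is monotone for arbitrary functions. *)
Lemma ge0_le_integral_nonmeasurable : (forall x, D x -> 0 <= f x) ->
  (forall x, D x -> f x <= h x) ->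
  \int[mu]_(x in D) f x <= \int[mu]_(x in D) h x.
Proof.
move=> f0 fh; have h0 x : D x -> 0 <= h x.
  by move=> Dx; exact: le_trans (f0 x Dx) (fh x Dx).
rewrite !ge0_integralE//; apply: le_ereal_sup => _ [g gf <-]; exists g => // x.
apply: le_trans (gf x) _; rewrite !patchE; case: ifPn => // xD.
by apply: fh; exact: set_mem.
Qed.

End ge0_integral_ae.

(* Here and in the next lemma only [h] is assumed to be measurable. *)
Lemma ge0_ae_le_integral_nonmeasurable d (S : measurableType d) (R : realType)
    (mu : {measure set S -> \bar R}) (D : set S) (f h : S -> \bar R) :
  measurable D -> measurable_fun D h ->
  (forall x, D x -> 0 <= f x)%E ->
  {ae mu, forall x, D x -> (f x <= h x)%E} ->
  (\int[mu]_(x in D) f x <= \int[mu]_(x in D) h x)%E.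
Proof.
move=> mD mh f0 [N [mN N0 fhN]].
(* Raising h to infinity on the null set keeps its integral and makes the inequality hold
   everywhere. *)
pose h' x := if x \in N then +oo%E else h x.
have mh' : measurable_fun D h'.
  apply: measurable_fun_if => //.
  - by apply: measurable_funTS; apply: (measurable_fun_bool true); rewrite setTI preimage_mem_true.
  - by apply: measurable_funS mh => // x [].
have -> : (\int[mu]_(x in D) h x = \int[mu]_(x in D) h' x)%E.
  apply: ae_eq_integral => //; exists N; split => // x /= hx; apply: contrapT => Nx.
  by apply: hx => _; rewrite /h' memNset.
apply: ge0_le_integral_nonmeasurable => // x Dx.
rewrite /h'; case: ifPn => [_|/negP xN]; first by rewrite leey.
apply/negP => /negP fhx; apply/xN/mem_set/fhN => /= /(_ Dx) fhx'.
by rewrite fhx' in fhx.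
Qed.

Lemma ge0_ae_ge_integral_nonmeasurable d (S : measurableType d) (R : realType)
    (mu : {measure set S -> \bar R}) (D : set S) (f h : S -> \bar R) :
  measurable D -> measurable_fun D h ->
  (forall x, D x -> 0 <= f x)%E -> (forall x, D x -> 0 <= h x)%E ->
  {ae mu, forall x, D x -> (h x <= f x)%E} ->
  (\int[mu]_(x in D) h x <= \int[mu]_(x in D) f x)%E.
Proof.
move=> mD mh f0 h0 [N [mN N0 fhN]].
(* Dually, h is lowered to 0 on the null set. *)
pose h' x := if x \in N then 0%E else h x.
have mh' : measurable_fun D h'.
  apply: measurable_fun_if => //.
  - by apply: measurable_funTS; apply: (measurable_fun_bool true); rewrite setTI preimage_mem_true.
  - by apply: measurable_funS mh => // x [].
have -> : (\int[mu]_(x in D) h x = \int[mu]_(x in D) h' x)%E.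
  apply: ae_eq_integral => //; exists N; split => // x /= hx; apply: contrapT => Nx.
  by apply: hx => _; rewrite /h' memNset.
apply: ge0_le_integral_nonmeasurable => x Dx; rewrite /h'.
  by case: ifPn => // _; exact: h0.
case: ifPn => [_|/negP xN]; first exact: f0.
apply/negP => /negP fhx; apply/xN/mem_set/fhN => /= /(_ Dx) fhx'.
by rewrite fhx' in fhx.
Qed.

Lemma ae_bounded_integrable d (S : measurableType d) (R : realType)
    (mu : {measure set S -> \bar R}) (D : set S) (f : S -> R) (C : R) :
  measurable D -> (mu D < +oo)%E -> measurable_fun D f ->
  {ae mu, forall x, D x -> `|f x| <= C} -> mu.-integrable D (EFin \o f).
Proof.
move=> mD Doo mf fC; apply/integrableP; split; first exact/measurable_EFinP.
apply: (@le_lt_trans _ _ (\int[mu]_(x in D) `|C|%:E)%E).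
  apply: ae_ge0_le_integral => //.
  - by apply: measurableT_comp => //; exact/measurable_EFinP.
  - apply: aeS fC => x fC Dx /=; rewrite lee_fin.
    exact: le_trans (fC Dx) (ler_norm _).
by rewrite integral_cst// lte_mul_pinfty// lee_fin.
Qed.

Section sections.
Context d (S : measurableType d) (R : realType) (I : set (measurableTypeR R)) (K : set S).
Context (nu : {sigma_finite_measure set S -> \bar R}).
Notation mu := (@lebesgue_measure R).
Let TR := measurableTypeR R.
Hypothesis mI : measurable I.
Hypothesis mK : measurable K.
Implicit Types f : TR * S -> R.

Let mIK : measurable (I `*` K). Proof. exact: measurableX. Qed.

Let patch_section f t b : K b -> (f \_ (I `*` K)) (t, b) = ((fun t => f (t, b)) \_ I) t.
Proof.
move=> Kb; rewrite !patchE; have [tI|tI] := boolP (t \in I).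
  by rewrite mem_set//; split => //; exact: set_mem.
by rewrite memNset// => -[/= tI' _]; move/negP: tI; apply; exact: mem_set.
Qed.

Lemma measurable_section_fun f b : measurable_fun (I `*` K) f -> K b ->
  measurable_fun I (fun t => f (t, b)).
Proof.
move=> /(measurable_restrictT _ mIK) mf Kb; apply/(measurable_restrictT _ mI).
rewrite (_ : _ \_ _ = (fun t => (f \_ (I `*` K)) (t, b))).
  exact: (measurableT_comp mf (pair2_measurable b)).
by apply/funext => t; rewrite patch_section.
Qed.

Let sqr_patch f : sqintegrable (mu \x nu)%E (I `*` K) f ->
  (mu \x nu)%E.-integrable setT (EFin \o ((fun z => f z ^+ 2) \_ (I `*` K))).
Proof. by case=> _ /(integrable_mkcond _ mIK); rewrite restrict_EFin. Qed.

Lemma ae_sqintegrable_section f : sqintegrable (mu \x nu)%E (I `*` K) f ->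
  {ae nu, forall b, K b -> sqintegrable mu I (fun t => f (t, b))}.
Proof.
move=> sf; have := ae_integrable2 (sqr_patch sf).
apply: aeS => b bi Kb; split; first by case: sf => mf _; exact: measurable_section_fun.
apply/(integrable_mkcond _ mI); rewrite restrict_EFin.
by apply: (eq_Rintegrable measurableT _ bi) => t _; rewrite patch_section.
Qed.

Lemma integrable_section_sqr f : sqintegrable (mu \x nu)%E (I `*` K) f ->
  nu.-integrable K (EFin \o (fun b => \int[mu]_(t in I) f (t, b) ^+ 2)).
Proof.
move=> sf; have := integrable_Rintegral_section2 (sqr_patch sf).
move=> /(integrableS measurableT mK (@subsetT _ _)).
apply: (eq_Rintegrable mK) => b Kb; rewrite [RHS]Rintegral_mkcond.
by apply: eq_Rintegral => t _; rewrite patch_section.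
Qed.

End sections.

Section regular_parameter.
Context (R : realType) (d n m k : nat) (T : R) (K : set (tupleR R d)).
Context (A : R -> tupleR R d -> 'M[R]_n) (B : R -> tupleR R d -> 'M[R]_(n, m)).
Context (G : R -> tupleR R d -> 'M[R]_(n, k)).
Context (Phi : R -> R -> tupleR R d -> 'M[R]_n).
Notation mu := (@lebesgue_measure R).
Notation muK := (lebesgue_tuple R d).
Let TR := measurableTypeR R.
Hypothesis mK : measurable K.

(** What the fixed-parameter theory needs of b. The constant C is an argument of the record so that
    one value can serve almost every b. *)
Record regular_parameter (C : R) (b : tupleR R d) : Prop := {
  regular_A : mxintegrable `[0, T] (fun t => A t b) ;
  regular_A_bound : {ae mu, forall t, `[0, T]%classic t -> l1norm (A t b) <= C} ;
  regular_Phi : forall s, 0 <= s <= T ->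
    (forall i j, {within `[0, T], continuous (fun t => Phi t s b i j)}) /\
    forall t, 0 <= t <= T ->
      Phi t s b = 1%:M + mxint_from_to s t (fun r => A r b *m Phi r s b) ;
  regular_B : forall i j, sqintegrable mu `[0, T] (fun t => B t b i j) ;
  regular_G : forall i j, sqintegrable mu `[0, T] (fun t => G t b i j) }.

Let mI : measurable (`[0, T]%classic : set TR). Proof. by []. Qed.

Let mD : measurable (domain T K).
Proof. exact: measurableX. Qed.

Lemma in_LD_section p q (F : R -> tupleR R d -> 'M[R]_(p, q)) : in_LD T K 2%:E F ->
  {ae muK, forall b, K b -> forall i j, sqintegrable mu `[0, T] (fun t => F t b i j)}.
Proof.
move=> /(LpOn2P _ _ mD) sF.
have : {ae muK, forall b, forall ij : 'I_p * 'I_q, K b ->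
    sqintegrable mu `[0, T] (fun t => F t b ij.1 ij.2)}.
  apply: ae_forall_fin => -[i j].
  exact (ae_sqintegrable_section mI mK (sF i j)).
by apply: aeS => b sb Kb i j; exact: sb (i, j) Kb.
Qed.

Lemma in_LD_bounded_section p q (F : R -> tupleR R d -> 'M[R]_(p, q)) :
  in_LD T K +oo%E F -> exists2 C, 0 <= C &
  {ae muK, forall b, K b -> mxintegrable `[0, T] (fun t => F t b) /\
     {ae mu, forall t, `[0, T]%classic t -> l1norm (F t b) <= C}}.
Proof.
move=> FD.
have mF i j : measurable_fun (domain T K) (fun z => F z.1 z.2 i j).
  by have [] := LpOnoo_bounded mD i j FD.
have C (ij : 'I_p * 'I_q) : {C | {ae (mu \x muK)%E, forall z, domain T K z ->
    `|F z.1 z.2 ij.1 ij.2| <= C}}.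
  by apply: cid; have [] := LpOnoo_bounded mD ij.1 ij.2 FD.
(* The absolute values ensure a nonnegative constant: an essential bound on an empty or null domain
   may be negative. *)
exists (\sum_i \sum_j `|projT1 (C (i, j))|).
  by apply: sumr_ge0 => i _; exact: sumr_ge0.
have : {ae muK, forall b, forall ij : 'I_p * 'I_q, {ae mu, forall t,
    domain T K (t, b) -> `|F t b ij.1 ij.2| <= projT1 (C ij)}}.
  apply: ae_forall_fin => ij.
  exact (ae_section2 (projT2 (C ij))).
apply: aeS => b FC Kb.
have FC' ij : {ae mu, forall t, `[0, T]%classic t -> `|F t b ij.1 ij.2| <= projT1 (C ij)}.
  by apply: aeS (FC ij) => t + tT; apply.
split.
  move=> i j; apply: ae_bounded_integrable (FC' (i, j)) => //.
  - by rewrite /= lebesgue_measure_itv /=; case: ifP => _; rewrite -?EFinB ltry.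
  - exact: (measurable_section_fun mI mK (mF i j) Kb).
have := ae_forall_fin FC'; apply: aeS => t Ft tT.
apply: ler_sum => i _; apply: ler_sum => j _.
by apply: le_trans (Ft (i, j) tT) _; exact: ler_norm.
Qed.

Lemma ae_regular : in_LD T K +oo%E A -> in_LD T K 2%:E B -> in_LD T K 2%:E G ->
  is_transition T K A Phi ->
  exists2 C, 0 <= C & {ae muK, forall b, K b -> regular_parameter C b}.
Proof.
move=> AD BD GD trPhi; have [C C0 AC] := in_LD_bounded_section AD.
exists C => //.
apply: aeS2 (in_LD_section BD) _.
  exact: (fun b Bb H Kb => H (Bb Kb) Kb).
apply: aeS2 (in_LD_section GD) _.
  exact: (fun b Gb H Bb Kb => H (Gb Kb) Bb Kb).
by apply: aeS2 AC trPhi => b Ab Phib Gb Bb Kb; have [] := Ab Kb; split => //; exact: Phib.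
Qed.

End regular_parameter.

(** * Decomposition of the mean square error *)

Section ensemble_state.
Context (R : realType) (d n m k : nat) (T : R) (K : set (tupleR R d)).
Context (A : R -> tupleR R d -> 'M[R]_n) (B : R -> tupleR R d -> 'M[R]_(n, m)).
Context (G : R -> tupleR R d -> 'M[R]_(n, k)).
Context (dO : measure_display) (Omega : measurableType dO) (P : probability Omega R).
Context (W : R -> Omega -> 'cV[R]_k) (Phi : R -> R -> tupleR R d -> 'M[R]_n) (C : R).
Notation mu := (@lebesgue_measure R).
Notation muK := (lebesgue_tuple R d).
Let TR := measurableTypeR R.
Hypothesis T0 : 0 <= T.
Hypothesis mK : measurable K.
Hypothesis bW : brownian_motion P T W.
Hypothesis C0 : 0 <= C.
Hypothesis reg : {ae muK, forall b, K b -> regular_parameter T A B G Phi C b}.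
Context (x : tupleR R d -> 'cV[R]_n) (u : R -> 'cV[R]_m) (X : process R d n Omega).
Hypothesis uHT : in_HT T u.
Hypothesis solX : is_solution T K P A B G W x u X.

Let mI : measurable (`[0, T]%classic : set TR). Proof. by []. Qed.

Let mDO : measurable (domain T K `*` [set: Omega]).
Proof. by apply: measurableX => //; exact: measurableX. Qed.

Let mX i : measurable_fun setT ((fun z => X z.1.1 z.1.2 z.2 i 0) \_ (domain T K `*` setT)).
Proof. by apply/(measurable_restrictT _ mDO); case: solX. Qed.

Let XE t b w i : `[0, T]%classic t -> K b ->
  ((fun z => X z.1.1 z.1.2 z.2 i 0) \_ (domain T K `*` setT)) ((t, b), w) = X t b w i 0.
Proof. by move=> tT Kb; rewrite patchE mem_set. Qed.

Let measurable_path b i : K b ->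
  measurable_fun (`[0, T]%classic `*` setT : set (TR * Omega)) (fun z => X z.1 b z.2 i 0).
Proof.
move=> Kb; apply: (eq_measurable_fun (fun z =>
  ((fun z => X z.1.1 z.1.2 z.2 i 0) \_ (domain T K `*` setT)) ((z.1, b), z.2))).
  by move=> z /set_mem[/= zT _]; rewrite XE.
apply: measurable_funTS; apply: measurableT_comp (mX i) _.
apply/measurable_fun_pair; last exact: measurable_snd.
by apply/measurable_fun_pair; [exact: measurable_fst|exact: measurable_cst].
Qed.

(** The noise-free state at time t, by variation of constants. *)
Definition controlled_mean t b : 'cV[R]_n :=
  Phi t 0 b *m (x b + mxint `[0, t] (fun r => Phi 0 r b *m (B r b *m u r))).

Lemma regular_control b : regular_parameter T A B G Phi C b ->
  mxintegrable `[0, T] (fun r => B r b *m u r).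
Proof.
move=> rb i j; have /(LpOn2P _ _ mI) su := uHT.
have mT := mI.
apply: (@eq_Rintegrable _ _ _ mu _ mT (fun r => \sum_l B r b i l * u r l j)).
  by move=> r _; rewrite mxE.
apply: (@integrable_Rsum _ _ _ mu _ mT) => l _.
exact: (sqintegrable_mul mT (regular_B rb i l) (su l j)).
Qed.

Lemma ae_mean_state : {ae muK, forall b, K b -> forall t, 0 <= t <= T ->
  mean_state P X t b = controlled_mean t b}.
Proof.
case: solX => _ solXb; apply: aeS2 reg solXb => b rb Xb Kb t tT.
have [cX itoX] := Xb Kb; have rgb := rb Kb.
apply/colP => i; rewrite mxE unlock.
have [_ <-] := mean_stateE T0 bW C0 (regular_A rgb) (regular_A_bound rgb)
  (regular_Phi rgb) (regular_G rgb) (regular_control rgb)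
  (fun i => measurable_path i Kb) cX (fun _ _ => erefl) itoX i tT.
by [].
Qed.

Lemma ae_mean_square (v : tupleR R d -> 'cV[R]_n) : {ae muK, forall b, K b ->
  'E_P[fun w => sqnorm (X T b w - v b)]%E =
  (sqnorm (controlled_mean T b - v b) + \tr (covariance_mx Phi G T b))%:E}.
Proof.
case: solX => _ solXb; apply: aeS2 reg solXb => b rb Xb Kb.
have [cX itoX] := Xb Kb; have rgb := rb Kb; rewrite unlock.
exact (mean_square_stateE T0 bW C0 (regular_A rgb) (regular_A_bound rgb)
  (regular_Phi rgb) (regular_G rgb) (regular_control rgb)
  (fun i => measurable_path i Kb) cX (fun _ _ => erefl) itoX (v b)).
Qed.

Let measurable_state t i : 0 <= t <= T ->
  measurable_fun (K `*` setT : set (tupleR R d * Omega)) (fun z => X t z.1 z.2 i 0).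
Proof.
move=> tT; apply: (eq_measurable_fun (fun z =>
  ((fun z => X z.1.1 z.1.2 z.2 i 0) \_ (domain T K `*` setT)) ((t, z.1), z.2))).
  by move=> z /set_mem[/= Kz _]; rewrite XE//= in_itv.
apply: measurable_funTS; apply: measurableT_comp (mX i) _.
apply/measurable_fun_pair; last exact: measurable_snd.
by apply/measurable_fun_pair; [exact: measurable_cst|exact: measurable_fst].
Qed.

Let mKO : measurable (K `*` setT : set (tupleR R d * Omega)).
Proof. exact: measurableX. Qed.

(** Measurability is taken from the joint measurability of X rather than from [controlled_mean],
    since Phi is not assumed measurable in b. *)
Lemma measurable_mean_state t i : 0 <= t <= T ->
  measurable_fun K (fun b => mean_state P X t b i 0).
Proof.
move=> tT; apply: (eq_measurable_fun (fun b =>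
  \int[P]_w (((fun z => X t z.1 z.2 i 0) \_ (K `*` setT)) (b, w)))).
  move=> b /set_mem Kb; rewrite mxE unlock; apply: eq_Rintegral => w _.
  by rewrite patchE mem_set.
apply: measurable_funTS; apply: measurable_Rintegral_section1.
by apply/(measurable_restrictT _ mKO); exact: measurable_state.
Qed.

Lemma measurable_mean_square (v : tupleR R d -> 'cV[R]_n) :
  (forall i, measurable_fun K (fun b => v b i 0)) ->
  measurable_fun K (fun b => 'E_P[fun w => sqnorm (X T b w - v b)]%E).
Proof.
move=> mv; pose h (z : tupleR R d * Omega) := sqnorm (X T z.1 z.2 - v z.1).
have TT : 0 <= T <= T by rewrite T0 lexx.
have mh : measurable_fun setT (h \_ (K `*` setT)).
  apply/(measurable_restrictT _ mKO).
  apply: (eq_measurable_fun (fun z => \sum_i (X T z.1 z.2 i 0 - v z.1 i 0) ^+ 2)).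
    by move=> z _; rewrite /h sqnorm_cV; apply: eq_bigr => i _; rewrite !mxE.
  apply: measurable_sum => i; apply: measurable_funX; apply: measurable_funB.
    exact: measurable_state.
  apply/(measurable_restrictT _ mKO).
  rewrite (_ : _ \_ _ = ((fun b => v b i 0) \_ K) \o fst).
    by apply: measurableT_comp measurable_fst; apply/(measurable_restrictT _ mK).
  apply/funext => -[b w] /=; rewrite !patchE.
  have [bK|bK] := boolP (b \in K).
    by rewrite mem_set//; split => //; exact: set_mem.
  by rewrite memNset// => -[/= bK' _]; move/negP: bK; apply; exact: mem_set.
apply: (eq_measurable_fun (fun b => \int[P]_w ((h \_ (K `*` setT)) (b, w))%:E)%E).
  move=> b /set_mem Kb; rewrite unlock; apply: eq_integral => w _.
  by rewrite patchE mem_set.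
apply: measurable_funTS.
apply: (measurable_fun_fubini_tonelli_F (EFin \o (h \_ (K `*` setT)))) => /=.
  exact/measurable_EFinP.
by move=> z; rewrite lee_fin patchE; case: ifP => // _; exact: sqnorm_ge0.
Qed.

End ensemble_state.

Lemma mxtrace_mul_tr (R : realType) p q (M : 'M[R]_(p, q)) : \tr (M *m M^T) = sqnorm M.
Proof.
rewrite /mxtrace /sqnorm; apply: eq_bigr => i _; rewrite mxE.
by apply: eq_bigr => j _; rewrite mxE expr2.
Qed.

Lemma sqnorm_col (R : realType) p q (M : 'M[R]_(p, q)) :
  sqnorm M = \sum_j sqnorm (col j M).
Proof.
rewrite /sqnorm exchange_big; apply: eq_bigr => j _; apply: eq_bigr => i _.
by rewrite big_ord1 mxE.
Qed.

Lemma sqnorm_mulmx_mx (R : realType) p q r (M : 'M[R]_(p, q)) (N : 'M[R]_(q, r)) :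
  sqnorm (M *m N) <= p%:R * l1norm M ^+ 2 * sqnorm N.
Proof.
rewrite sqnorm_col [sqnorm N]sqnorm_col mulr_sumr; apply: ler_sum => j _.
by rewrite !colE -mulmxA; exact: sqnorm_mulmx.
Qed.

(** * The covariance term: integrability and separation from the squared bias *)

Section covariance_bound.
Context (R : realType) (d n m k : nat) (T : R) (K : set (tupleR R d)).
Context (A : R -> tupleR R d -> 'M[R]_n) (B : R -> tupleR R d -> 'M[R]_(n, m)).
Context (G : R -> tupleR R d -> 'M[R]_(n, k)).
Context (Phi : R -> R -> tupleR R d -> 'M[R]_n) (C : R).
Notation mu := (@lebesgue_measure R).
Notation muK := (lebesgue_tuple R d).
Let TR := measurableTypeR R.

Let integrandE t s b : Phi t s b *m G s b *m (G s b)^T *m (Phi t s b)^T =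
  (Phi t s b *m G s b) *m (Phi t s b *m G s b)^T.
Proof. by rewrite trmx_mul !mulmxA. Qed.

Lemma tr_covariance_ge0 t b : 0 <= \tr (covariance_mx Phi G t b).
Proof.
apply: sumr_ge0 => i _; rewrite mxE; apply: Rintegral_ge0 => s _.
rewrite integrandE mxE; apply: sumr_ge0 => l _.
by rewrite [_^T _ _]mxE -expr2 sqr_ge0.
Qed.

Hypothesis T0 : 0 <= T.
Hypothesis mK : measurable K.
Hypothesis C0 : 0 <= C.

Let mI : measurable (`[0, T]%classic : set TR). Proof. by []. Qed.

(** The trace of the integrand is [sqnorm] of Phi(T, s) G(s), and Phi(T, s) is uniformly bounded.
    Unlike the left side, the bound is known to be measurable and integrable in b. *)
Lemma tr_covariance_le b : regular_parameter T A B G Phi C b ->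
  \tr (covariance_mx Phi G T b) <= n%:R * transition_bound T n C ^+ 2 *
    \sum_i \sum_l \int[mu]_(s in `[0, T]) G s b i l ^+ 2.
Proof.
move=> rb; have mT := mI; set c := (n%:R * _).
have TT : 0 <= T <= T by rewrite T0 lexx.
have [mL _] := transition_inv_mxbounded T0 C0 (regular_A rb) (regular_A_bound rb)
  (regular_Phi rb).
have mG : mxmeasurable `[0, T] (fun s => G s b).
  by move=> i l; case: (regular_G rb i l).
have mF : mxmeasurable `[0, T] (fun s => Phi T s b *m G s b).
  (* As a function of s, Phi(T, s) is a constant matrix times Phi(0, s), whose measurability is
     known. *)
  have mP : mxmeasurable `[0, T] (fun s => Phi T 0 b *m Phi 0 s b *m G s b).
    by apply: mxmeasurable_mul mG; apply: mxmeasurable_mul mL => i j.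
  move=> i l; apply: eq_measurable_fun (mP i l) => s /set_mem; rewrite /= in_itv/= => sT.
  by rewrite (transition_mul T0 C0 (regular_A rb) (regular_A_bound rb)
    (regular_Phi rb) sT TT).
have Gi i l : mu.-integrable `[0, T] (EFin \o (fun s => G s b i l ^+ 2)).
  by case: (regular_G rb i l).
have Si : mu.-integrable `[0, T] (EFin \o (fun s => sqnorm (G s b))).
  rewrite /sqnorm; apply: (@integrable_Rsum _ _ _ mu _ mT) => i _.
  exact: (@integrable_Rsum _ _ _ mu _ mT).
have cSi := integrable_RZ mT c Si.
have le s : `[0, T]%classic s -> sqnorm (Phi T s b *m G s b) <= c * sqnorm (G s b).
  rewrite /= in_itv/= => /andP[s0 sT]; apply: le_trans (sqnorm_mulmx_mx _ _) _.
  apply: ler_wpM2r; first exact: sqnorm_ge0.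
  apply: ler_wpM2l; first exact: ler0n.
  have := transition_fwd_bound C0 (regular_A rb) (regular_A_bound rb)
    (regular_Phi rb) s0 sT (lexx _).
  by move=> h; rewrite ler_sqr// ?nnegrE ?l1norm_ge0 ?transition_bound_ge0.
have Fi i : mu.-integrable `[0, T]
    (EFin \o (fun s => (Phi T s b *m G s b *m (G s b)^T *m (Phi T s b)^T) i i)).
  apply: (@le_Rintegrable _ _ _ mu _ mT _ (fun s => c * sqnorm (G s b))) => //.
  - apply: (eq_measurable_fun (fun s => \sum_l (Phi T s b *m G s b) i l ^+ 2)).
      by move=> s _; rewrite integrandE mxE; apply: eq_bigr => l _; rewrite [_^T _ _]mxE expr2.
    by apply: measurable_sum => l; apply: measurable_funX; exact: mF.
  - move=> s sT; apply: le_trans (le s sT); rewrite integrandE -mxtrace_mul_tr.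
    have F0 j : 0 <= ((Phi T s b *m G s b) *m (Phi T s b *m G s b)^T) j j.
      by rewrite mxE; apply: sumr_ge0 => l _; rewrite [_^T _ _]mxE -expr2 sqr_ge0.
    by rewrite ger0_norm// /mxtrace (bigD1 i)//= lerDl sumr_ge0.
have -> : \sum_i \sum_l \int[mu]_(s in `[0, T]) G s b i l ^+ 2 =
    \int[mu]_(s in `[0, T]) sqnorm (G s b).
  rewrite /sqnorm Rintegral_sum//; last first.
    by move=> i _; exact: (@integrable_Rsum _ _ _ mu _ mT).
  by apply: eq_bigr => i _; rewrite Rintegral_sum.
rewrite -RintegralZl//.
have -> : \tr (covariance_mx Phi G T b) =
    \int[mu]_(s in `[0, T]) sqnorm (Phi T s b *m G s b).
  transitivity (\int[mu]_(s in `[0, T])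
    \sum_i (Phi T s b *m G s b *m (G s b)^T *m (Phi T s b)^T) i i).
    by rewrite Rintegral_sum//; apply: eq_bigr => i _; rewrite mxE.
  by apply: eq_Rintegral => s _; rewrite -mxtrace_mul_tr -integrandE.
apply: le_Rintegral => //.
apply: (@eq_Rintegrable _ _ _ mu _ mT (fun s =>
  \sum_i (Phi T s b *m G s b *m (G s b)^T *m (Phi T s b)^T) i i)).
  by move=> s _; rewrite -mxtrace_mul_tr -integrandE.
exact: (@integrable_Rsum _ _ _ mu _ mT).
Qed.

Hypothesis reg : {ae muK, forall b, K b -> regular_parameter T A B G Phi C b}.
Hypothesis GD : in_LD T K 2%:E G.

Lemma integral_tr_covariance_lty :
  (\int[muK]_(b in K) (\tr (covariance_mx Phi G T b))%:E < +oo)%E.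
Proof.
have mD : measurable (domain T K) by exact: measurableX.
pose c := n%:R * transition_bound T n C ^+ 2.
pose H b := c * \sum_i \sum_l \int[mu]_(s in `[0, T]) G s b i l ^+ 2.
have Hi : muK.-integrable K (EFin \o H).
  apply: integrable_RZ => //; apply: integrable_Rsum => // i _.
  apply: integrable_Rsum => // l _.
  by have /(LpOn2P _ _ mD) sG := GD; exact (integrable_section_sqr mI mK (sG i l)).
apply: (@le_lt_trans _ _ (\int[muK]_(b in K) (H b)%:E)%E).
  apply: ge0_ae_le_integral_nonmeasurable => //.
  - exact: measurable_int Hi.
  - by move=> b _; rewrite lee_fin tr_covariance_ge0.
  - by apply: aeS reg => b rb Kb; rewrite lee_fin; exact: tr_covariance_le (rb Kb).
by apply: le_lt_trans (ltry (\int[muK]_(b in K) H b)); rewrite fineK// (integrable_fin_num mK Hi).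
Qed.

End covariance_bound.

Section mean_square_error_decomposition.
Context (R : realType) (d n m k : nat) (T : R) (K : set (tupleR R d)).
Context (A : R -> tupleR R d -> 'M[R]_n) (B : R -> tupleR R d -> 'M[R]_(n, m)).
Context (G : R -> tupleR R d -> 'M[R]_(n, k)).
Context (dO : measure_display) (Omega : measurableType dO) (P : probability Omega R).
Context (W : R -> Omega -> 'cV[R]_k) (Phi : R -> R -> tupleR R d -> 'M[R]_n) (C : R).
Notation muK := (lebesgue_tuple R d).
Hypothesis T0 : 0 <= T.
Hypothesis mK : measurable K.
Hypothesis bW : brownian_motion P T W.
Hypothesis C0 : 0 <= C.
Hypothesis reg : {ae muK, forall b, K b -> regular_parameter T A B G Phi C b}.
Context (x : tupleR R d -> 'cV[R]_n) (u : R -> 'cV[R]_m) (X : process R d n Omega).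
Hypothesis uHT : in_HT T u.
Hypothesis solX : is_solution T K P A B G W x u X.
Context (v : tupleR R d -> 'cV[R]_n).
Hypothesis mv : forall i, measurable_fun K (fun b => v b i 0).

Lemma measurable_sqnorm_mean t : 0 <= t <= T ->
  measurable_fun K (fun b => sqnorm (mean_state P X t b - v b)).
Proof.
move=> tT; apply: (eq_measurable_fun (fun b =>
  \sum_i (mean_state P X t b i 0 - v b i 0) ^+ 2)).
  by move=> b _; rewrite sqnorm_cV; apply: eq_bigr => i _; rewrite [in RHS]mxE [(- v b) _ _]mxE.
apply: measurable_sum => i; apply: measurable_funX; apply: measurable_funB => //.
exact: (measurable_mean_state mK solX).
Qed.

Lemma mean_square_error_decomposition :
  (mean_square_error T K P X v =
   \int[muK]_(b in K) (sqnorm (mean_state P X T b - v b))%:E +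
   \int[muK]_(b in K) (\tr (covariance_mx Phi G T b))%:E)%E.
Proof.
have TT : 0 <= T <= T by rewrite T0 lexx.
pose E b := 'E_P[fun w => sqnorm (X T b w - v b)]%E.
pose s b := sqnorm (mean_state P X T b - v b).
(* A measurable version of tr C(T, b), recovered by subtracting the squared bias from the mean
   square error; the maximum with 0 keeps it nonnegative on the exceptional null set. *)
pose h b := Num.max 0 (fine (E b) - s b).
have mE : measurable_fun K E by exact: (measurable_mean_square T0 mK solX mv).
have ms : measurable_fun K s by exact: measurable_sqnorm_mean.
have mh : measurable_fun K h.
  apply: measurable_maxr => //; apply: measurable_funB => //.
  exact: (measurableT_comp (fine_measurable measurableT)).
have aeE : {ae muK, forall b, K b -> E b = (s b + \tr (covariance_mx Phi G T b))%:E}.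
  apply: aeS2 (ae_mean_state T0 mK bW C0 reg uHT solX)
    (ae_mean_square T0 mK bW C0 reg uHT solX v) => b bm bs Kb.
  by rewrite /E /s bs// (bm Kb).
have hE : {ae muK, forall b, K b -> \tr (covariance_mx Phi G T b) = h b}.
  apply: aeS aeE => b bE Kb; rewrite /h bE//= addrAC subrr add0r max_r//.
  exact: tr_covariance_ge0.
transitivity (\int[muK]_(b in K) ((s b)%:E + (h b)%:E))%E.
  apply: ae_eq_integral => //.
  - by apply: emeasurable_funD; apply/measurable_EFinP.
  - by apply: aeS2 aeE hE => b bE bh Kb; rewrite -/(E b) bE// bh// EFinD.
rewrite ge0_integralD//; first congr (_ + _)%E.
- apply/eqP; rewrite eq_le; apply/andP; split.
    apply: ge0_ae_ge_integral_nonmeasurable => //.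
    + exact/measurable_EFinP.
    + by move=> b _; rewrite lee_fin tr_covariance_ge0.
    + by move=> b _; rewrite lee_fin le_max lexx.
    + by apply: aeS hE => b bh Kb; rewrite bh.
  apply: ge0_ae_le_integral_nonmeasurable => //.
  + exact/measurable_EFinP.
  + by move=> b _; rewrite lee_fin tr_covariance_ge0.
  + by apply: aeS hE => b bh Kb; rewrite bh.
- by move=> b _; rewrite lee_fin sqnorm_ge0.
- exact/measurable_EFinP.
- by move=> b _; rewrite lee_fin le_max lexx.
- exact/measurable_EFinP.
Qed.

End mean_square_error_decomposition.

Lemma sqintegrable_ae_bounded_mul d (S : measurableType d) (R : realType)
    (mu : {measure set S -> \bar R}) (D : set S) (a f : S -> R) (C : R) :
  measurable D -> measurable_fun D a ->
  {ae mu, forall x, D x -> `|a x| <= C} -> sqintegrable mu D f ->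
  sqintegrable mu D (fun x => a x * f x).
Proof.
move=> mD ma aC [mf f2]; split; first exact: measurable_funM.
have Cf2 := integrable_RZ mD (C ^+ 2) f2.
apply/integrableP; split.
  by apply/measurable_EFinP/measurable_funX; exact: measurable_funM.
have /integrableP[mCf2] := Cf2; apply: le_lt_trans; apply: ae_ge0_le_integral => //.
- apply: measurableT_comp => //; apply/measurable_EFinP/measurable_funX.
  exact: measurable_funM.
- exact: measurableT_comp.
apply: aeS aC => x aC Dx; have {}aC := aC Dx.
rewrite /= lee_fin ger0_norm ?sqr_ge0// exprMn; apply: le_trans (ler_norm _).
apply: ler_wpM2r; first exact: sqr_ge0.
by rewrite -real_normK ?num_real// ler_sqr// nnegrE ?normr_ge0// (le_trans _ aC).
Qed.

Lemma normK_lt_integral (R : realType) (d n : nat) (K : set (tupleR R d))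
    (p : tupleR R d -> 'cV[R]_n) (e : R) : measurable K -> 0 < e ->
  (normK K p < e%:E)%E ->
  (\int[lebesgue_tuple R d]_(b in K) (sqnorm (p b))%:E < (e ^+ 2)%:E)%E.
Proof.
move=> mK e0; rewrite /normK unlock /=.
have -> : (\int[lebesgue_tuple R d]_(b in K) (sqnorm (p b))%:E =
    \int[lebesgue_tuple R d]_b ((`|((fun b => enorm (p b)) \_ K) b| `^ 2)%:E))%E.
  rewrite integral_mkcond; apply: eq_integral => b _; rewrite !patchE.
  case: ifPn => _; last by rewrite normr0 powR0.
  by rewrite powR_mulrn// real_normK ?num_real// sqr_sqrtr// sqnorm_ge0.
set J := (X in (X `^ _ < _)%E -> _); have J0 : (0 <= J)%E by exact: integral_ge0.
suff : (J `^ 2^-1 < e%:E -> J < (e ^+ 2)%:E)%E by [].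
case: J J0 => [r||] //; last by rewrite poweRyr ?invr_eq0.
rewrite poweR_EFin !lte_fin lee_fin => r0 re.
by rewrite -[r]sqr_sqrtr// ltr_sqr ?nnegrE ?sqrtr_ge0 ?(ltW e0)// -powR12_sqrt.
Qed.

(** * Steering the mean state *)

Definition truncated_control (R : realType) m (S : R) (u : R -> 'cV[R]_m) (t : R) : 'cV[R]_m :=
  if t <= S then u t else 0.

Section steering.
Context (R : realType) (d n m k : nat) (T : R) (K : set (tupleR R d)).
Context (A : R -> tupleR R d -> 'M[R]_n) (B : R -> tupleR R d -> 'M[R]_(n, m)).
Context (G : R -> tupleR R d -> 'M[R]_(n, k)).
Context (dO : measure_display) (Omega : measurableType dO) (P : probability Omega R).
Context (W : R -> Omega -> 'cV[R]_k) (Phi : R -> R -> tupleR R d -> 'M[R]_n) (C : R).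
Context (X : (tupleR R d -> 'cV[R]_n) -> (R -> 'cV[R]_m) -> process R d n Omega).
Notation mu := (@lebesgue_measure R).
Notation muK := (lebesgue_tuple R d).
Let TR := measurableTypeR R.
Hypothesis T0 : 0 <= T.
Hypothesis mK : measurable K.
Hypothesis Koo : (muK K < +oo)%E.
Hypothesis bW : brownian_motion P T W.
Hypothesis C0 : 0 <= C.
Hypothesis reg : {ae muK, forall b, K b -> regular_parameter T A B G Phi C b}.
Hypothesis solX : forall x u, in_HK K x -> in_HT T u ->
  is_solution T K P A B G W x u (X x u).

Let mI : measurable (`[0, T]%classic : set TR). Proof. by []. Qed.

Lemma in_HT_truncated S (u : R -> 'cV[R]_m) : in_HT T u -> in_HT T (truncated_control S u).
Proof.
move=> /(LpOn2P _ _ mI) su; apply/(LpOn2P _ _ mI) => i j.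
have [mu_ u2] := su i j.
have mS : measurable_fun (`[0, T]%classic : set TR) (fun t : TR => (t <= S)%R).
  exact: measurable_fun_ler.
have mt : measurable_fun (`[0, T]%classic : set TR) (fun t => truncated_control S u t i j).
  rewrite (_ : (fun t => _) = (fun t : TR => if (t <= S)%R then u t i j else 0)).
    apply: measurable_fun_if => //; apply: measurable_funS mu_ => // t [].
  by apply/funext => t; rewrite /truncated_control; case: ifP; rewrite ?mxE.
split => //; apply: (@le_Rintegrable _ _ _ mu _ mI _ (fun t => u t i j ^+ 2)) => //.
  exact: measurable_funX.
move=> t _; rewrite ger0_norm ?sqr_ge0// /truncated_control.
by case: ifP => // _; rewrite mxE expr0n sqr_ge0.
Qed.

Lemma mxint_truncated_control S (u : R -> 'cV[R]_m) p (F : R -> 'M[R]_(p, m)) : S <= T ->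
  mxint `[0, T] (fun r => F r *m truncated_control S u r) =
  mxint `[0, S] (fun r => F r *m u r).
Proof.
move=> ST; apply/matrixP => i j; rewrite mxE [RHS]mxE Rintegral_mkcond [RHS]Rintegral_mkcond.
apply: eq_Rintegral => r _; rewrite !patchE /truncated_control.
have [rS|rS] := boolP (r \in `[0, S]%classic).
  move: rS; rewrite inE/= in_itv/= => /andP[r0 rS].
  by rewrite rS mem_set//= in_itv/= r0 (le_trans rS).
case: ifPn => // /set_mem; rewrite /= in_itv/= => /andP[r0 _].
case: ifPn => [rS'|_]; last by rewrite mulmx0 mxE.
by move/negP: rS; case; apply: mem_set; rewrite /= in_itv/= r0.
Qed.

(** The target enters the initial state through v = Phi(T, 0) Phi(0, T) v, and Phi(T, S) then
    factors out because the control is 0 after S. *)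
Lemma controlled_mean_truncated (x v : tupleR R d -> 'cV[R]_n) u S b :
  regular_parameter T A B G Phi C b -> 0 <= S <= T ->
  controlled_mean B Phi x (truncated_control S u) T b - v b =
  Phi T S b *m controlled_mean B Phi (fun b => x b - Phi 0 T b *m v b) u S b.
Proof.
move=> rb ST; have TT : 0 <= T <= T by rewrite T0 lexx.
have /andP[_ S_T] := ST.
have rA := regular_A rb; have rC := regular_A_bound rb; have rP := regular_Phi rb.
rewrite /controlled_mean mulmxA (transition_mul T0 C0 rA rC rP ST TT).
rewrite -[X in _ = X *m _]mulmxA (transition_mulVV T0 C0 rA rC rP ST) mulmx1.
have -> : mxint `[0, T] (fun r => Phi 0 r b *m (B r b *m truncated_control S u r)) =
    mxint `[0, S] (fun r => Phi 0 r b *m (B r b *m u r)).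
  transitivity (mxint `[0, T] (fun r => (Phi 0 r b *m B r b) *m truncated_control S u r)).
    by apply: eq_mxint => r _; rewrite mulmxA.
  by rewrite mxint_truncated_control//; apply: eq_mxint => r _; rewrite mulmxA.
rewrite !mulmxDr mulmxN mulmxA (transition_mulV T0 C0 rA rC rP TT) mul1mx.
by rewrite addrAC.
Qed.

Lemma sqnorm_truncated_control (x v : tupleR R d -> 'cV[R]_n) u S b :
  regular_parameter T A B G Phi C b -> 0 <= S <= T ->
  sqnorm (controlled_mean B Phi x (truncated_control S u) T b - v b) <=
  n%:R * transition_bound T n C ^+ 2 *
    sqnorm (controlled_mean B Phi (fun b => x b - Phi 0 T b *m v b) u S b).
Proof.
move=> rb ST; rewrite (controlled_mean_truncated x v u rb ST).
have /andP[S0 S_T] := ST.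
apply: le_trans (sqnorm_mulmx _ _) _; apply: ler_wpM2r; first exact: sqnorm_ge0.
apply: ler_wpM2l; first exact: ler0n.
have := transition_fwd_bound C0 (regular_A rb) (regular_A_bound rb)
  (regular_Phi rb) S0 S_T (lexx _).
by move=> h; rewrite ler_sqr// ?nnegrE ?l1norm_ge0 ?transition_bound_ge0.
Qed.

Let in_HT0 : in_HT T (fun=> 0 : 'cV[R]_m).
Proof.
apply/(LpOn2P _ _ mI) => i j; have mT := mI.
apply: (@eq_sqintegrable _ _ _ mu _ mT (fun=> 0)); first by move=> t _; rewrite mxE.
split => //; apply: (@bounded_itv_integrable R T _ _ 0) => //.
by move=> t _; rewrite expr0n normr0.
Qed.

Let in_HK_cst (v : 'cV[R]_n) : in_HK K (fun=> v).
Proof.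
apply/(LpOn2P _ _ mK) => i j; split => //.
apply: (@ae_bounded_integrable _ _ _ muK _ _ `|v i j ^+ 2|) => //.
exact: aeW.
Qed.

(* [Phi T 0 b] need not be measurable in [b] off a null set; the means of the
   uncontrolled states started from the basis vectors form a version that is. *)
Let M b : 'M[R]_n :=
  \matrix_(i, j) mean_state P (X (fun=> delta_mx j 0) (fun=> 0)) T b i 0.

Let TT : 0 <= T <= T. Proof. by rewrite T0 lexx. Qed.

Let measurable_M i j : measurable_fun K (fun b => M b i j).
Proof.
under eq_fun do rewrite mxE.
exact (measurable_mean_state mK (solX (in_HK_cst (delta_mx j 0)) in_HT0) i TT).
Qed.

Let ae_M : {ae muK, forall b, K b -> M b = Phi T 0 b}.
Proof.
have h : {ae muK, forall b, forall j : 'I_n, K b -> forall t, 0 <= t <= T ->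
    mean_state P (X (fun=> delta_mx j 0) (fun=> 0)) t b =
    controlled_mean B Phi (fun=> delta_mx j 0) (fun=> 0) t b}.
  apply: ae_forall_fin => j.
  exact (ae_mean_state T0 mK bW C0 reg in_HT0 (solX (in_HK_cst (delta_mx j 0)) in_HT0)).
apply: aeS h => b bM Kb; apply/matrixP => i j; rewrite mxE bM// /controlled_mean.
have -> : mxint `[0, T] (fun r => Phi 0 r b *m (B r b *m (0 : 'cV[R]_m))) = 0.
  apply/matrixP => i' j'; rewrite mxE [RHS]mxE.
  rewrite (_ : (fun t => _) = fun=> 0); first by rewrite Rintegral_cst// mul0r.
  by apply/funext => r; rewrite !mulmx0 mxE.
by rewrite addr0 -colE mxE.
Qed.

Let ae_inv : {ae muK, forall b, K b -> cofactor_inv (M b) = Phi 0 T b /\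
  l1norm (Phi 0 T b) <= transition_bound T n C}.
Proof.
apply: aeS2 reg ae_M => b rb bM Kb; have rgb := rb Kb.
have rA := regular_A rgb; have rC := regular_A_bound rgb; have rP := regular_Phi rgb.
split; last exact (transition_inv_bound T0 C0 rA rC rP TT).
by apply: cofactor_invE; rewrite bM// (transition_mulV T0 C0 rA rC rP TT).
Qed.

(** Controllability quantifies over initial states in [in_HK], which demands measurability, so
    Phi(0, T, b) is replaced by the cofactor inverse of the measurable [M b]. The uniform bound on
    Phi(0, T, b) keeps the product in L2. *)
Lemma exists_measurable_backward_state (x v : tupleR R d -> 'cV[R]_n) :
  in_HK K x -> in_HK K v -> exists2 y, in_HK K y &
  {ae muK, forall b, K b -> y b = x b - Phi 0 T b *m v b}.
Proof.
move=> /(LpOn2P _ _ mK) sx /(LpOn2P _ _ mK) sv.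
exists (fun b => x b - cofactor_inv (M b) *m v b); last first.
  by apply: aeS ae_inv => b bM Kb; have [->] := bM Kb.
apply/(LpOn2P _ _ mK) => i j.
apply: (eq_sqintegrable mK (f := fun b => x b i j - \sum_l cofactor_inv (M b) i l * v b l j)).
  by move=> b _; rewrite [RHS]mxE [(- (_ *m _)) _ _]mxE [(_ *m _) _ _]mxE.
apply: sqintegrableB => //; apply: sqintegrable_sum => // l _.
apply: (@sqintegrable_ae_bounded_mul _ _ _ _ _ _ _ (transition_bound T n C)) => //.
  exact: measurable_cofactor_inv.
apply: aeS ae_inv => b bM Kb; have [-> le] := bM Kb.
by apply: le_trans le; exact: l1norm_entry.
Qed.

Lemma controllable_mean_error (x v : tupleR R d -> 'cV[R]_n) (e : R) :
  ensemble_controllable T K P X -> in_HK K x -> in_HK K v -> 0 < e ->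
  exists2 u, in_HT T u &
  (\int[muK]_(b in K) (sqnorm (mean_state P (X x u) T b - v b))%:E <= e%:E)%E.
Proof.
move=> ctrl xK vK e0; have [y yK yE] := exists_measurable_backward_state xK vK.
pose c := n%:R * transition_bound T n C ^+ 2.
have c0 : 0 <= c by rewrite mulr_ge0// sqr_ge0.
have c1 : 0 < c + 1 by rewrite ltr_wpDl.
(* Then c * f^2 = e * c / (c + 1) <= e; the summand 1 avoids dividing by 0 when c = 0. *)
pose f := Num.sqrt (e / (c + 1)).
have f0 : 0 < f by rewrite sqrtr_gt0 divr_gt0.
(* The target has been absorbed into the initial state y, so the state is steered to 0. *)
have [S [u [/andP[S0 ST] uT _ err]]] := ctrl f y (fun=> 0) f0 yK (in_HK_cst 0).
have SS : 0 <= S <= T by rewrite (ltW S0).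
exists (truncated_control S u); first exact: in_HT_truncated.
have uT' := in_HT_truncated S uT.
have mv i : measurable_fun K (fun b => v b i 0).
  by have /(LpOn2P _ _ mK)/(_ i 0)[] := vK.
pose q b := sqnorm (mean_state P (X y u) S b - 0).
have mq : measurable_fun K q.
  exact (measurable_sqnorm_mean mK (solX yK uT) (v := fun=> 0) (fun i => measurable_cst _) SS).
have q0 b : 0 <= q b by exact: sqnorm_ge0.
apply: (@le_trans _ _ (\int[muK]_(b in K) (c%:E * (q b)%:E))%E).
  apply: ae_ge0_le_integral => //.
  - by move=> b _; rewrite lee_fin sqnorm_ge0.
  - apply/measurable_EFinP.
    exact (measurable_sqnorm_mean mK (solX xK uT') mv TT).
  - by move=> b _; rewrite -EFinM lee_fin mulr_ge0.
  - by apply: emeasurable_funM => //; exact/measurable_EFinP.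
  apply: aeS2 reg (aeS2 _ yE (aeS2 _ (ae_mean_state T0 mK bW C0 reg uT (solX yK uT))
    (ae_mean_state T0 mK bW C0 reg uT' (solX xK uT')))); last 2 first.
  - exact: (fun b h1 h2 => conj h1 h2).
  - exact: (fun b h1 h2 => conj h1 h2).
  move=> b rb [by_ [bm bm']] Kb; rewrite -EFinM lee_fin (bm' Kb)// /q (bm Kb)// subr0.
  apply: le_trans (sqnorm_truncated_control x v u (rb Kb) SS) _.
  by rewrite /controlled_mean (by_ Kb).
rewrite ge0_integralZl//; last 2 first.
- exact/measurable_EFinP.
- by move=> b _; rewrite lee_fin.
have lt := normK_lt_integral mK f0 err.
apply: (@le_trans _ _ (c%:E * (f ^+ 2)%:E)%E).
  by apply: lee_wpmul2l; [rewrite lee_fin|exact: ltW].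
rewrite -EFinM lee_fin sqr_sqrtr; last by rewrite ltW// divr_gt0.
by rewrite mulrCA ler_piMr ?(ltW e0)// ler_pdivrMr// mul1r lerDl.
Qed.

End steering.

Theorem theorem5 (R : realType) (d n m k : nat) (T : R) (K : set (tupleR R d))
    (A : R -> tupleR R d -> 'M[R]_n) (B : R -> tupleR R d -> 'M[R]_(n, m))
    (G : R -> tupleR R d -> 'M[R]_(n, k))
    (dO : measure_display) (Omega : measurableType dO) (P : probability Omega R)
    (W : R -> Omega -> 'cV[R]_k)
    (X : (tupleR R d -> 'cV[R]_n) -> (R -> 'cV[R]_m) -> process R d n Omega)
    (Phi : R -> R -> tupleR R d -> 'M[R]_n)
    (x0 xF : tupleR R d -> 'cV[R]_n) :
  0 < T ->
  compact [set \row_i tnth b i | b in K] ->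
  in_LD T K +oo%E A -> in_LD T K 2%:E B -> in_LD T K 2%:E G ->
  brownian_motion P T W ->
  (forall x u, in_HK K x -> in_HT T u ->
     is_solution T K P A B G W x u (X x u)) ->
  is_transition T K A Phi ->
  ensemble_controllable T K P X ->
  in_HK K x0 -> in_HK K xF ->
  let J2 u := mean_square_error T K P (X x0 u) xF in
  let J2min :=
    (\int[lebesgue_tuple R d]_(b in K) (\tr (covariance_mx Phi G T b))%:E)%E in
  (forall u, in_HT T u -> (forall v, in_HT T v -> (J2 u <= J2 v)%E) ->
     {ae lebesgue_tuple R d, forall b, K b ->
        mxint `[0, T] (fun s => Phi 0 s b *m B s b *m u s)
        = Phi 0 T b *m xF b - x0 b}
     /\ J2 u = J2min) /\
  ereal_inf [set J2 u | u in [set u | in_HT T u]] = J2min.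
Proof.
move=> T0' cK AD BD GD bW solX trPhi ctrl x0K xFK J2 J2min.
have T0 := ltW T0'; have TT : 0 <= T <= T by rewrite T0 lexx.
have mK := measurable_compact_tuple cK; have Koo := compact_tuple_finite cK.
have [C C0 reg] := ae_regular mK AD BD GD trPhi.
have mF i : measurable_fun K (fun b => xF b i 0).
  by have /(LpOn2P _ _ mK)/(_ i 0)[] := xFK.
pose err u := (\int[lebesgue_tuple R d]_(b in K)
  (sqnorm (mean_state P (X x0 u) T b - xF b))%:E)%E.
have err0 u : (0 <= err u)%E by apply: integral_ge0 => b _; rewrite lee_fin sqnorm_ge0.
have J2E u : in_HT T u -> J2 u = (err u + J2min)%E.
  move=> uT; exact (mean_square_error_decomposition T0 mK bW C0 reg uT (solX _ _ x0K uT) mF).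
have Jmin0 : (0 <= J2min)%E.
  by apply: integral_ge0 => b _; rewrite lee_fin tr_covariance_ge0.
have Jminoo : (J2min < +oo)%E.
  exact (integral_tr_covariance_lty T0 mK C0 reg GD).
have Jmin_fin : J2min \is a fin_num by rewrite ge0_fin_numE.
have steer e : 0 < e -> exists2 u, in_HT T u & (J2 u <= e%:E + J2min)%E.
  move=> e0.
  have [u uT ue] := controllable_mean_error T0 mK Koo bW C0 reg solX ctrl x0K xFK e0.
  by exists u => //; rewrite J2E// leeD2r.
have infE : ereal_inf [set J2 u | u in [set u | in_HT T u]] = J2min.
  apply/eqP; rewrite eq_le; apply/andP; split.
    apply/lee_addgt0Pr => e e0; have [u uT ue] := steer e e0.
    by rewrite addeC; apply: le_trans ue; apply: ereal_inf_lbound; exists u.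
  by apply: le_ereal_inf_tmp => _ [u uT <-]; rewrite J2E// leeDr.
split=> // u uT umin.
(* A minimizer does at least as well as controls with arbitrarily small bias, and no control does
   better than [J2min]. *)
have Ju : J2 u = J2min.
  apply/eqP; rewrite eq_le; apply/andP; split; last by rewrite J2E// leeDr.
  apply/lee_addgt0Pr => e e0; have [v vT ve] := steer e e0.
  by rewrite addeC; apply: le_trans ve; exact: umin.
(* Finiteness of [J2min] allows cancelling it in J2 u = err u + J2min. *)
split=> //; have erru : err u = 0%E.
  apply/eqP; rewrite eq_le err0 andbT -(leeD2rE _ _ Jmin_fin) add0e -J2E//.
  by rewrite Ju.
have solu := solX _ _ x0K uT.
have : ae_eq (lebesgue_tuple R d) K
    (fun b => (sqnorm (mean_state P (X x0 u) T b - xF b))%:E) (cst 0%E).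
  apply/(ae_eq_integral_abs _ mK).
    by apply/measurable_EFinP; exact (measurable_sqnorm_mean mK solu mF TT).
  rewrite -[RHS]erru; apply: eq_integral => b _.
  by rewrite gee0_abs// lee_fin sqnorm_ge0.
move=> err_ae; apply: aeS2 reg (aeS2 _ err_ae (ae_mean_state T0 mK bW C0 reg uT solu)).
  2: exact: (fun b h1 h2 => conj h1 h2).
move=> b rb [eb mb] Kb.
have rA := regular_A (rb Kb); have rC := regular_A_bound (rb Kb).
have rP := regular_Phi (rb Kb).
(* The terminal mean equals the target for almost every b; applying Phi(0, T) and subtracting the
   initial state gives the stated equation. *)
have [/sqnorm_eq0/eqP] := eb Kb; rewrite subr_eq0 (mb Kb)// => /eqP <-.
rewrite /controlled_mean mulmxA (transition_mulVV T0 C0 rA rC rP TT) mul1mx.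
rewrite addrAC subrr add0r.
by apply: eq_mxint => r _; rewrite mulmxA.
Qed.
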